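(* Let $k$ be an algebraically closed field; all algebras are finite-dimensional $k$-algebras. (i) Let $A$ be a biserial algebra. Then the algebra $eAe$ is biserial for every idempotent $e\in A$. (ii) Let $A=kQ/I$ be a basic algebra, where $Q$ is a finite quiver and $I$ is an admissible ideal of $kQ$, with idempotents $e_1,\dots,e_n$ given by the paths of length zero. Then $A$ is biserial if and only if for every vertex $l\in Q_0$ the algebra $eAe$ with $e=e_l+\sum_{j\in N(l)}e_j$ is biserial. (iii) Let $A=kQ/I$ be a basic algebra as in (ii). Then $A$ is biserial if and only if for every vertex $l\in Q_0$ and every set $J(l)$ of neighbours of $l$ of type $\mathbb{D}_4$, the algebra $eAe$ with $e=e_l+\sum_{j\in J(l)}e_j$ is biserial.
   Context: Biserial: a finite-dimensional algebra $B$ is called biserial if for every indecomposable projective left or right $B$-module $P$ there exist uniserial submodules $U,V$ of $P$ with $\operatorname{rad}(P)=U+V$ (the sum not necessarily direct) such that $U\cap V$ is zero or simple. The algebra $eAe$ has unit $e$. For $A=kQ/I$ and $l\in Q_0$, the set of neighbouring vertices of $l$ is $N(l)=\{j\in Q_0 : j\neq l,\ j \text{ is connected to } l \text{ by at least one arrow of } Q \text{ (in either direction)}\}$. Sets of neighbours of $l$ of type $\mathbb{D}_4$: if $|N(l)|<4$, the only such set is $J(l)=N(l)$; if $|N(l)|\ge 4$, such a set is any subset $J(l)\subset N(l)$ with $|J(l)|=3$. *)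

(* Defs.v *)
From HB Require Import structures.
From mathcomp Require Import all_boot all_algebra generic_quotient ring_quotient.
From mathcomp Require Import boolp classical_sets.
From mathcomp Require Import finmap.
From mathcomp.multinomials Require Import monalg.

Set Implicit Arguments.
Unset Strict Implicit.
Unset Printing Implicit Defensive.

Import GRing.Theory.
Local Open Scope ring_scope.
Local Open Scope classical_set_scope.
Local Open Scope quotient_scope.

(* Rings are [pzRingType]s, so that the zero algebra (e.g. eAe for e = 0) is
   not excluded, as it would be by [algType].  A k-algebra structure on a ring
   is a ring morphism from k to its centre; it matters only for finite
   dimensionality, since being biserial depends on the ring alone. *)
Definition fd_algebra (k : fieldType) (A : pzRingType)
    (iota : {rmorphism k -> A}) : Prop :=
  (forall c a, iota c * a = a * iota c) /\
  exists n (b : 'I_n -> A),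
    forall a, exists c : 'I_n -> k, a = \sum_(i < n) iota (c i) * b i.

Section Modules.
Variables (R : pzRingType) (M : lmodType R).
Implicit Types U V W : set M.

Definition submodule U : Prop := GRing.submod_closed (mem U).

Definition submodule_sum U V : set M := [set x + y | x in U & y in V].

Definition simple_submodule U : Prop :=
  [/\ submodule U, U <> [set 0] &
      forall V, submodule V -> V `<=` U -> V = [set 0] \/ V = U].

Definition uniserial_submodule U : Prop :=
  submodule U /\
  forall V W, submodule V -> submodule W -> V `<=` U -> W `<=` U ->
    V `<=` W \/ W `<=` V.

Definition maximal_submodule U : Prop :=
  [/\ submodule U, U <> setT &
      forall V, submodule V -> U `<=` V -> V = U \/ V = setT].

Definition radical : set M := \bigcap_(U in maximal_submodule) U.

Definition indecomposable : Prop :=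
  (exists x : M, x <> 0) /\
  forall U V, submodule U -> submodule V ->
    submodule_sum U V = setT -> U `&` V = [set 0] ->
    U = [set 0] \/ V = [set 0].

Definition projective : Prop :=
  forall (X Y : lmodType R) (p : {linear X -> Y}) (f : {linear M -> Y}),
    (forall y, exists x, p x = y) ->
    exists g : {linear M -> X}, forall m, p (g m) = f m.

Definition biserial_module : Prop :=
  exists U V, [/\ uniserial_submodule U, uniserial_submodule V,
    radical = submodule_sum U V &
    U `&` V = [set 0] \/ simple_submodule (U `&` V)].

End Modules.

Definition left_biserial (B : pzRingType) : Prop :=
  forall P : lmodType B, projective P -> indecomposable P -> biserial_module P.

(* Right B-modules are left modules over the converse ring [B^c]. *)
Definition biserial (B : pzRingType) : Prop :=
  left_biserial B /\ left_biserial B^c.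

Section Corner.
Variables (A : pzRingType) (e : A) (he : e * e = e).

Definition corner_pred : {pred A} := fun x => `[< exists a, x = e * a * e >].

Record corner : predArgType :=
  Corner { corner_val : A; _ : corner_val \in corner_pred }.

HB.instance Definition _ := [isSub for corner_val].
HB.instance Definition _ := [Choice of corner by <:].

Lemma corner_predP x : x \in corner_pred <-> exists a, x = e * a * e.
Proof. by rewrite unfold_in; split=> /asboolP. Qed.

Fact corner_pred_zmod : zmod_closed corner_pred.
Proof.
split; first by apply/corner_predP; exists 0; rewrite mulr0 mul0r.
move=> x y /corner_predP[a ->] /corner_predP[b ->].
by apply/corner_predP; exists (a - b); rewrite mulrBr mulrBl.
Qed.
HB.instance Definition _ := GRing.isZmodClosed.Build A corner_pred
  corner_pred_zmod.
HB.instance Definition _ := [SubChoice_isSubZmodule of corner by <:].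

Fact corner_mul_closed (x y : corner) : val x * val y \in corner_pred.
Proof.
have /corner_predP[a ->] := valP x; have /corner_predP[b ->] := valP y.
by apply/corner_predP; exists (a * e * (e * b)); rewrite !mulrA.
Qed.

Fact corner_one_closed : e \in corner_pred.
Proof. by apply/corner_predP; exists e; rewrite !he. Qed.

Definition corner_mul (x y : corner) : corner := Corner (corner_mul_closed x y).
Definition corner_one : corner := Corner corner_one_closed.

End Corner.

(* eAe as a ring with unit e; the proof that e is idempotent is an argument
   because the unit law needs it. *)
Definition corner_ring (A : pzRingType) (e : A) (he : e * e = e) : Type :=
  corner e.
Arguments corner_ring {A} e he.

Section CornerRing.
Variables (A : pzRingType) (e : A) (he : e * e = e).
Local Notation eAe := (corner_ring e he).

HB.instance Definition _ := GRing.Zmodule.on eAe.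

Fact corner_mulA : associative (@corner_mul A e : eAe -> eAe -> eAe).
Proof. by move=> x y z; apply: val_inj; rewrite /= mulrA. Qed.

Fact corner_mul1 : left_id (corner_one he) (@corner_mul A e).
Proof.
move=> x; apply: val_inj => /=; have /corner_predP[a ->] := valP x.
by rewrite !mulrA he.
Qed.

Fact corner_mulr1 : right_id (corner_one he) (@corner_mul A e).
Proof.
move=> x; apply: val_inj => /=; have /corner_predP[a ->] := valP x.
by rewrite -!mulrA he.
Qed.

Fact corner_mulDl :
  left_distributive (@corner_mul A e : eAe -> eAe -> eAe) +%R.
Proof. by move=> x y z; apply: val_inj; rewrite /= mulrDl. Qed.

Fact corner_mulDr :
  right_distributive (@corner_mul A e : eAe -> eAe -> eAe) +%R.
Proof. by move=> x y z; apply: val_inj; rewrite /= mulrDr. Qed.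

HB.instance Definition _ := GRing.Zmodule_isPzRing.Build eAe
  corner_mulA corner_mul1 corner_mulr1 corner_mulDl corner_mulDr.

End CornerRing.

Section Ideals.
Variable R : pzRingType.
Implicit Types I J S : set R.

Definition two_sided_ideal I : Prop :=
  [/\ I 0, forall x y, I x -> I y -> I (x + y),
      forall a x, I x -> I (a * x) & forall a x, I x -> I (x * a)].

Definition ideal_gen S : set R :=
  \bigcap_(I in [set I | two_sided_ideal I /\ S `<=` I]) I.

Definition ideal_mul I J : set R := ideal_gen [set a * b | a in I & b in J].

Definition ideal_exp I (m : nat) : set R := iter m (ideal_mul I) setT.

End Ideals.

Section QuotientRing.
Variables (R : pzRingType) (I : set R) (hI : two_sided_ideal I).

Definition ideal_pred (_ : two_sided_ideal I) : {pred R} := fun x => `[< I x >].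

Lemma ideal_predP x : x \in ideal_pred hI <-> I x.
Proof. by rewrite unfold_in; split=> /asboolP. Qed.

Fact ideal_pred_zmod : zmod_closed (ideal_pred hI).
Proof.
have [I0 ID Il _] := hI; split; first by apply/ideal_predP.
move=> x y /ideal_predP Ix /ideal_predP Iy; apply/ideal_predP.
by apply: ID => //; rewrite -mulN1r; apply: Il.
Qed.
HB.instance Definition _ := GRing.isZmodClosed.Build R (ideal_pred hI)
  ideal_pred_zmod.

Definition quotient_ring : Type := Quotient.quot (ideal_pred hI).
HB.instance Definition _ := GRing.Zmodule.on quotient_ring.
HB.instance Definition _ := EqQuotient.on quotient_ring.

Definition quotient_proj (x : R) : quotient_ring := \pi_quotient_ring x.

Lemma quotient_projP x y :
  quotient_proj x = quotient_proj y <-> I (x - y).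
Proof.
rewrite -ideal_predP Quotient.idealrBE; exact: (rwP eqP).
Qed.

Lemma quotient_projD : {morph quotient_proj : x y / x + y}.
Proof. by move=> x y; rewrite /quotient_proj Quotient.pi_add. Qed.

Definition quotient_one : quotient_ring := quotient_proj 1.
Definition quotient_mul (x y : quotient_ring) : quotient_ring :=
  quotient_proj (repr x * repr y).

Lemma quotient_reprK : cancel repr quotient_proj.
Proof. exact: reprK. Qed.

Lemma quotient_projM x y :
  quotient_proj (x * y) = quotient_mul (quotient_proj x) (quotient_proj y).
Proof.
apply/quotient_projP.
have /quotient_projP hx := esym (quotient_reprK (quotient_proj x)).
have /quotient_projP hy := esym (quotient_reprK (quotient_proj y)).
have [_ ID Il Ir] := hI.
set x' := repr _ in hx *; set y' := repr _ in hy *.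
have -> : x * y - x' * y' = (x - x') * y + x' * (y - y').
  by rewrite mulrBl mulrBr addrA subrK.
by apply: ID; [apply: Ir | apply: Il].
Qed.

Fact quotient_mulA : associative quotient_mul.
Proof.
move=> x y z; rewrite -[x]quotient_reprK -[y]quotient_reprK -[z]quotient_reprK.
by rewrite -!quotient_projM mulrA.
Qed.

Fact quotient_mul1 : left_id quotient_one quotient_mul.
Proof. by move=> x; rewrite -[x]quotient_reprK -quotient_projM mul1r. Qed.

Fact quotient_mulr1 : right_id quotient_one quotient_mul.
Proof. by move=> x; rewrite -[x]quotient_reprK -quotient_projM mulr1. Qed.

Fact quotient_mulDl : left_distributive quotient_mul +%R.
Proof.
move=> x y z; rewrite -[x]quotient_reprK -[y]quotient_reprK -[z]quotient_reprK.
by rewrite -quotient_projD -!quotient_projM -quotient_projD mulrDl.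
Qed.

Fact quotient_mulDr : right_distributive quotient_mul +%R.
Proof.
move=> x y z; rewrite -[x]quotient_reprK -[y]quotient_reprK -[z]quotient_reprK.
by rewrite -quotient_projD -!quotient_projM -quotient_projD mulrDr.
Qed.

HB.instance Definition _ := GRing.Zmodule_isPzRing.Build quotient_ring
  quotient_mulA quotient_mul1 quotient_mulr1 quotient_mulDl quotient_mulDr.

Fact quotient_proj_zmod : zmod_morphism quotient_proj.
Proof.
move=> x y; apply: (addIr (quotient_proj y)).
by rewrite -quotient_projD !subrK.
Qed.
HB.instance Definition _ := GRing.isZmodMorphism.Build R quotient_ring
  quotient_proj quotient_proj_zmod.

Fact quotient_proj_monoid : monoid_morphism quotient_proj.
Proof. by split=> // x y; rewrite quotient_projM. Qed.
HB.instance Definition _ := GRing.isMonoidMorphism.Build R quotient_ring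
  quotient_proj quotient_proj_monoid.

End QuotientRing.

Record quiver := Quiver {
  vertex : finType;
  arrow : finType;
  source : arrow -> vertex;
  target : arrow -> vertex }.

Section Paths.
Variable Q : quiver.

Fixpoint walk (x : vertex Q) (s : seq (arrow Q)) : bool :=
  if s is a :: s' then (source a == x) && walk (target a) s' else true.

(* A path is its starting vertex with the list of its arrows in the order in
   which they are traversed. *)
Definition qpath : Type := {p : vertex Q * seq (arrow Q) | walk p.1 p.2}.
HB.instance Definition _ := SubChoice.on qpath.

Definition path_source (p : qpath) : vertex Q := (val p).1.
Definition path_arrows (p : qpath) : seq (arrow Q) := (val p).2.
Definition path_target (p : qpath) : vertex Q :=
  last (path_source p) [seq target a | a <- path_arrows p].

Definition trivial_path (x : vertex Q) : qpath :=
  exist (fun p => is_true (walk p.1 p.2)) (x, [::]) isT.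

Fact arrow_walk (a : arrow Q) : walk (source a) [:: a].
Proof. by rewrite /= eqxx. Qed.

Definition arrow_path (a : arrow Q) : qpath :=
  exist (fun p => is_true (walk p.1 p.2)) (source a, [:: a]) (arrow_walk a).

Lemma walk_cat x s t :
  walk x (s ++ t) = walk x s && walk (last x [seq target a | a <- s]) t.
Proof. by elim: s x => //= a s IHs x; rewrite IHs andbA. Qed.

(* First p, then q; the opposite convention gives the opposite algebra, for
   which being biserial means the same.  [insub] succeeds by [path_compE]. *)
Definition path_comp (p q : qpath) : option qpath :=
  if path_target p == path_source q
  then (insub (path_source p, path_arrows p ++ path_arrows q) : option qpath)
  else None.

Lemma path_compE p q : path_target p = path_source q ->
  exists2 r, path_comp p q = Some r &
    val r = (path_source p, path_arrows p ++ path_arrows q).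
Proof.
move=> pq; rewrite /path_comp pq eqxx; case: insubP => [r _ <-|]; first by exists r.
by rewrite /= walk_cat -/(path_target p) pq (valP p) (valP q).
Qed.

Lemma path_compN p q : path_target p != path_source q -> path_comp p q = None.
Proof. by rewrite /path_comp => /negPf ->. Qed.

Lemma path_comp_source p q r : path_comp p q = Some r ->
  path_source r = path_source p.
Proof.
have [pq|/path_compN -> //] := eqVneq (path_target p) (path_source q).
by have [r' -> vr'] := path_compE pq; case=> <-; rewrite /path_source vr'.
Qed.

Lemma path_comp_target p q r : path_comp p q = Some r ->
  path_target r = path_target q.
Proof.
have [pq|/path_compN -> //] := eqVneq (path_target p) (path_source q).
have [r' -> vr'] := path_compE pq; case=> <-.
rewrite /path_target /path_source /path_arrows vr' /= map_cat last_cat.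
by rewrite -/(path_arrows p) -/(path_target p) pq.
Qed.

Lemma path_compA p q r :
  obind (path_comp p) (path_comp q r) = obind (path_comp^~ r) (path_comp p q).
Proof.
have [pq|npq] := eqVneq (path_target p) (path_source q); last first.
  rewrite (path_compN npq) /=; case E: path_comp => [s|] //=.
  by apply: path_compN; rewrite (path_comp_source E).
have [qr|nqr] := eqVneq (path_target q) (path_source r); last first.
  rewrite (path_compN nqr) /=; case E: path_comp => [s|] //=.
  by rewrite path_compN // (path_comp_target E).
have [s es vs] := path_compE pq; have [t et vt] := path_compE qr.
rewrite es et /=.
have ps : path_target p = path_source t by rewrite (path_comp_source et).
have tr : path_target s = path_source r by rewrite (path_comp_target es).
have [u -> vu] := path_compE ps; have [v -> vv] := path_compE tr.
congr Some; apply: val_inj; rewrite vu vv.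
by rewrite /path_source /path_arrows vs vt /= catA.
Qed.

Lemma path_comp1l x p :
  path_comp (trivial_path x) p = if x == path_source p then Some p else None.
Proof.
have [->|nxp] := eqVneq; last by rewrite path_compN.
have [//|r -> vr] := @path_compE (trivial_path (path_source p)) p.
by congr Some; apply: val_inj; rewrite vr; case: p {r vr} => -[].
Qed.

Lemma path_comp1r x p :
  path_comp p (trivial_path x) = if x == path_target p then Some p else None.
Proof.
have [->|nxp] := eqVneq; last by rewrite path_compN // eq_sym.
have [//|r -> vr] := @path_compE p (trivial_path (path_target p)).
by congr Some; apply: val_inj; rewrite vr /= cats0; case: p {r vr} => -[].
Qed.

End Paths.

(* Finitely supported functions from paths to k.  The operations are locked:
   unfolding the ones of [malg] makes unification blow up. *)
Definition path_algebra (k : fieldType) (Q : quiver) : Type := {malg k[qpath Q]}.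
HB.instance Definition _ (k : fieldType) (Q : quiver) :=
  Choice.on (path_algebra k Q).

Section PathAlgebraOperations.
Variables (k : fieldType) (Q : quiver).
Local Notation kQ := (path_algebra k Q).

Definition path_coef (p : qpath Q) (f : kQ) : k := f@_p.
Definition path_supp (f : kQ) : {fset qpath Q} := msupp f.

Lemma kQ_eqP (f g : kQ) : (forall p, path_coef p f = path_coef p g) <-> f = g.
Proof. exact: malgP. Qed.

Lemma path_suppP (f : kQ) p : p \in path_supp f = (path_coef p f != 0).
Proof. by rewrite -mcoeff_neq0. Qed.

End PathAlgebraOperations.

HB.lock Definition kQ_zero (k : fieldType) (Q : quiver) : path_algebra k Q :=
  (0 : {malg k[qpath Q]}).
HB.lock Definition kQ_opp (k : fieldType) (Q : quiver)
  (f : path_algebra k Q) : path_algebra k Q := (- (f : {malg k[qpath Q]})).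
HB.lock Definition kQ_add (k : fieldType) (Q : quiver)
    (f g : path_algebra k Q) : path_algebra k Q :=
  (f : {malg k[qpath Q]}) + (g : {malg k[qpath Q]}).
HB.lock Definition kQ_scale (k : fieldType) (Q : quiver)
    (c : k) (f : path_algebra k Q) : path_algebra k Q :=
  c *: (f : {malg k[qpath Q]}).
HB.lock Definition path_elt (k : fieldType) (Q : quiver) (p : qpath Q) :
  path_algebra k Q := << p >>.

Section PathAlgebraLmodule.
Variables (k : fieldType) (Q : quiver).
Local Notation kQ := (path_algebra k Q).
Implicit Types (f g h : kQ) (p q : qpath Q).

Fact kQ_addA : associative (@kQ_add k Q).
Proof. by move=> f g h; rewrite kQ_add.unlock addrA. Qed.
Fact kQ_addC : commutative (@kQ_add k Q).
Proof. by move=> f g; rewrite kQ_add.unlock addrC. Qed.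
Fact kQ_add0 : left_id (kQ_zero k Q) (@kQ_add k Q).
Proof. by move=> f; rewrite kQ_add.unlock kQ_zero.unlock add0r. Qed.
Fact kQ_addN : left_inverse (kQ_zero k Q) (@kQ_opp k Q) (@kQ_add k Q).
Proof.
by move=> f; rewrite kQ_add.unlock kQ_zero.unlock kQ_opp.unlock addNr.
Qed.
HB.instance Definition _ := GRing.isZmodule.Build kQ
  kQ_addA kQ_addC kQ_add0 kQ_addN.

Lemma path_coef0 p : path_coef p (0 : kQ) = 0.
Proof. by rewrite -[0]/(kQ_zero k Q) /path_coef kQ_zero.unlock mcoeff0. Qed.

Lemma path_coefD p f g : path_coef p (f + g) = path_coef p f + path_coef p g.
Proof. by rewrite -[f + g]/(kQ_add f g) /path_coef kQ_add.unlock mcoeffD. Qed.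

Lemma path_coef_scale p c f :
  path_coef p (kQ_scale c f) = c * path_coef p f.
Proof. by rewrite /path_coef kQ_scale.unlock mcoeffZ. Qed.

Fact kQ_scaleA (a b : k) f : kQ_scale a (kQ_scale b f) = kQ_scale (a * b) f.
Proof. by apply/kQ_eqP => p; rewrite !path_coef_scale mulrA. Qed.
Fact kQ_scale1 : left_id 1 (@kQ_scale k Q).
Proof. by move=> f; apply/kQ_eqP => p; rewrite path_coef_scale mul1r. Qed.
Fact kQ_scaleDr : right_distributive (@kQ_scale k Q) +%R.
Proof.
move=> c f g; apply/kQ_eqP => p.
by rewrite !(path_coef_scale, path_coefD) mulrDr.
Qed.
Fact kQ_scaleDl f : {morph (@kQ_scale k Q)^~ f : a b / a + b}.
Proof.
move=> a b; apply/kQ_eqP => p.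
by rewrite !(path_coef_scale, path_coefD) mulrDl.
Qed.
HB.instance Definition _ := GRing.Zmodule_isLmodule.Build k kQ
  kQ_scaleA kQ_scale1 kQ_scaleDr kQ_scaleDl.

Lemma path_coefZ p c f : path_coef p (c *: f) = c * path_coef p f.
Proof. exact: path_coef_scale. Qed.

Lemma path_coef_elt p q : path_coef p (path_elt k q) = (p == q)%:R.
Proof. by rewrite /path_coef path_elt.unlock mcoeffU eq_sym. Qed.

Fact path_coef_zmod p : zmod_morphism (path_coef p : kQ -> k).
Proof.
move=> f g; apply: (addIr (path_coef p g)).
by rewrite -path_coefD !subrK.
Qed.
HB.instance Definition _ p := GRing.isZmodMorphism.Build kQ k (path_coef p)
  (path_coef_zmod p).

Lemma path_eltE f : f = \sum_(p <- path_supp f) path_coef p f *: path_elt k p.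
Proof.
apply/kQ_eqP => p; rewrite raddf_sum /=.
have E q : path_coef p (path_coef q f *: path_elt k q)
    = if p == q then path_coef q f else 0.
  by rewrite path_coefZ path_coef_elt; case: eqP; rewrite ?mulr1 ?mulr0.
under eq_bigr do rewrite E.
have [pf|pf] := boolP (p \in path_supp f).
  rewrite (bigD1_seq p) ?fset_uniq //= eqxx big1 ?addr0 // => q.
  by rewrite eq_sym => /negPf ->.
rewrite big_seq big1 => [|q qf]; last by case: eqP pf => // ->; rewrite qf.
by apply/eqP; move: pf; rewrite path_suppP negbK.
Qed.

Lemma kQ_ind (P : kQ -> Prop) : P 0 -> (forall f g, P f -> P g -> P (f + g)) ->
  (forall c p, P (c *: path_elt k p)) -> forall f, P f.
Proof. by move=> P0 PD PZ f; rewrite [f]path_eltE; apply: big_ind. Qed.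

End PathAlgebraLmodule.

Definition path_mul (k : fieldType) (Q : quiver) (p q : qpath Q) :
    path_algebra k Q :=
  if path_comp p q is Some r then path_elt k r else 0.

HB.lock Definition kQ_mul (k : fieldType) (Q : quiver)
    (f g : path_algebra k Q) : path_algebra k Q :=
  \sum_(p <- path_supp f) \sum_(q <- path_supp g)
    (path_coef p f * path_coef q g) *: path_mul k p q.
Arguments kQ_mul {k Q} f g.

Section PathAlgebra.
Variables (k : fieldType) (Q : quiver).
Local Notation kQ := (path_algebra k Q).
Implicit Types (f g h : kQ) (p q : qpath Q).
Local Notation path_elt := (path_elt k).
Local Notation path_mul := (path_mul k).
Local Notation kQ_mul := (@kQ_mul k Q).

Definition kQ_one : kQ := \sum_(x : vertex Q) path_elt (trivial_path x).

Lemma kQ_mulw (d1 d2 : {fset qpath Q}) f g :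
  {subset path_supp f <= d1} -> {subset path_supp g <= d2} ->
  kQ_mul f g = \sum_(p <- d1) \sum_(q <- d2)
    (path_coef p f * path_coef q g) *: path_mul p q.
Proof.
move=> /fsubsetP le1 /fsubsetP le2.
rewrite kQ_mul.unlock (big_fset_incl _ le1) /=.
  apply: eq_bigr => p _; apply: big_fset_incl => // q _.
  by rewrite path_suppP negbK => /eqP ->; rewrite mulr0 scale0r.
move=> p _; rewrite path_suppP negbK => /eqP ->.
by rewrite big1 // => q _; rewrite mul0r scale0r.
Qed.

Lemma path_suppD f g :
  {subset path_supp (f + g) <= (path_supp f `|` path_supp g)%fset}.
Proof.
move=> p; rewrite in_fsetU !path_suppP path_coefD; apply: contraR.
by rewrite negb_or !negbK => /andP[/eqP -> /eqP ->]; rewrite addr0.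
Qed.

Lemma path_suppZ c f : {subset path_supp (c *: f) <= path_supp f}.
Proof.
move=> p; rewrite !path_suppP path_coefZ; apply: contraNneq => ->.
by rewrite mulr0.
Qed.

Fact kQ_mulDl : left_distributive kQ_mul +%R.
Proof.
move=> f g h; pose d := (path_supp f `|` path_supp g)%fset.
have sf : {subset path_supp f <= d} by move=> p pf; rewrite in_fsetU pf.
have sg : {subset path_supp g <= d} by move=> p pg; rewrite in_fsetU pg orbT.
rewrite (@kQ_mulw d (path_supp h) (f + g)) //; last exact: path_suppD.
rewrite (@kQ_mulw d (path_supp h) f) // (@kQ_mulw d (path_supp h) g) //.
rewrite -big_split /=; apply: eq_bigr => p _; rewrite -big_split /=.
by apply: eq_bigr => q _; rewrite path_coefD mulrDl scalerDl.
Qed.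

Fact kQ_mulDr : right_distributive kQ_mul +%R.
Proof.
move=> h f g; pose d := (path_supp f `|` path_supp g)%fset.
have sf : {subset path_supp f <= d} by move=> p pf; rewrite in_fsetU pf.
have sg : {subset path_supp g <= d} by move=> p pg; rewrite in_fsetU pg orbT.
rewrite (@kQ_mulw (path_supp h) d h (f + g)) //; last exact: path_suppD.
rewrite (@kQ_mulw (path_supp h) d h f) // (@kQ_mulw (path_supp h) d h g) //.
rewrite -big_split /=; apply: eq_bigr => p _; rewrite -big_split /=.
by apply: eq_bigr => q _; rewrite path_coefD mulrDr scalerDl.
Qed.

Lemma kQ_mulZl c f g : kQ_mul (c *: f) g = c *: kQ_mul f g.
Proof.
rewrite (@kQ_mulw (path_supp f) (path_supp g)) //; last exact: path_suppZ.
rewrite kQ_mul.unlock scaler_sumr; apply: eq_bigr => p _.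
rewrite scaler_sumr; apply: eq_bigr => q _.
by rewrite path_coefZ scalerA mulrA.
Qed.

Lemma kQ_mulZr c f g : kQ_mul f (c *: g) = c *: kQ_mul f g.
Proof.
rewrite (@kQ_mulw (path_supp f) (path_supp g)) //; last exact: path_suppZ.
rewrite kQ_mul.unlock scaler_sumr; apply: eq_bigr => p _.
rewrite scaler_sumr; apply: eq_bigr => q _.
by rewrite path_coefZ scalerA mulrCA.
Qed.

Lemma kQ_mul0l g : kQ_mul 0 g = 0.
Proof. by have := kQ_mulZl 0 0 g; rewrite !scale0r. Qed.

Lemma kQ_mul0r g : kQ_mul g 0 = 0.
Proof. by have := kQ_mulZr 0 g 0; rewrite !scale0r. Qed.

Lemma kQ_mul_suml J (r : seq J) (F : J -> kQ) g :
  kQ_mul (\sum_(i <- r) F i) g = \sum_(i <- r) kQ_mul (F i) g.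
Proof.
by apply: (big_morph (kQ_mul^~ g)) => [x y|]; rewrite ?kQ_mulDl ?kQ_mul0l.
Qed.

Lemma kQ_mul_sumr J (r : seq J) (F : J -> kQ) g :
  kQ_mul g (\sum_(i <- r) F i) = \sum_(i <- r) kQ_mul g (F i).
Proof.
by apply: (big_morph (kQ_mul g)) => [x y|]; rewrite ?kQ_mulDr ?kQ_mul0r.
Qed.

Lemma path_elt_mul p q : kQ_mul (path_elt p) (path_elt q) = path_mul p q.
Proof.
have s1 (r : qpath Q) : {subset path_supp (path_elt r) <= [fset r]%fset}.
  move=> x; rewrite path_suppP path_coef_elt in_fset1; apply: contraR.
  by move=> /negPf ->.
rewrite (kQ_mulw (@s1 p) (@s1 q)) !big_seq_fset1 !path_coef_elt !eqxx.
by rewrite mulr1 scale1r.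
Qed.

Fact kQ_mulA : associative kQ_mul.
Proof.
have Ap p q r : kQ_mul (path_elt p) (kQ_mul (path_elt q) (path_elt r))
              = kQ_mul (kQ_mul (path_elt p) (path_elt q)) (path_elt r).
  rewrite !path_elt_mul /path_mul; move: (path_compA p q r).
  case: (path_comp q r) => [s|]; case: (path_comp p q) => [t|] /= E.
  - by rewrite !path_elt_mul /path_mul E.
  - by rewrite kQ_mul0l path_elt_mul /path_mul E.
  - by rewrite kQ_mul0r path_elt_mul /path_mul -E.
  - by rewrite kQ_mul0l kQ_mul0r.
move=> f g h; elim/kQ_ind: f => [|f f' IHf IHf'|a p].
- by rewrite !kQ_mul0l.
- by rewrite !kQ_mulDl IHf IHf'.
elim/kQ_ind: g => [|g g' IHg IHg'|b q].
- by rewrite !(kQ_mul0l, kQ_mul0r).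
- by rewrite !(kQ_mulDl, kQ_mulDr) IHg IHg'.
elim/kQ_ind: h => [|h h' IHh IHh'|c r].
- by rewrite !kQ_mul0r.
- by rewrite !kQ_mulDr IHh IHh'.
rewrite !(kQ_mulZl, kQ_mulZr) Ap !scalerA; congr (_ *: _).
by rewrite -[RHS]mulrA mulrC.
Qed.

Fact kQ_mul1 : left_id kQ_one kQ_mul.
Proof.
move=> f; elim/kQ_ind: f => [|f g IHf IHg|c p].
- by rewrite kQ_mul0r.
- by rewrite kQ_mulDr IHf IHg.
rewrite kQ_mulZr kQ_mul_suml (bigD1_seq (path_source p)) ?mem_index_enum //=;
  last exact: index_enum_uniq.
rewrite path_elt_mul /path_mul path_comp1l eqxx big1 ?addr0 // => x nx.
by rewrite path_elt_mul /path_mul path_comp1l (negPf nx).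
Qed.

Fact kQ_mulr1 : right_id kQ_one kQ_mul.
Proof.
move=> f; elim/kQ_ind: f => [|f g IHf IHg|c p].
- by rewrite kQ_mul0l.
- by rewrite kQ_mulDl IHf IHg.
rewrite kQ_mulZl kQ_mul_sumr (bigD1_seq (path_target p)) ?mem_index_enum //=;
  last exact: index_enum_uniq.
rewrite path_elt_mul /path_mul path_comp1r eqxx big1 ?addr0 // => x nx.
by rewrite path_elt_mul /path_mul path_comp1r (negPf nx).
Qed.

HB.instance Definition _ := GRing.Zmodule_isPzRing.Build kQ
  kQ_mulA kQ_mul1 kQ_mulr1 kQ_mulDl kQ_mulDr.

Lemma path_eltM p q : path_elt p * path_elt q = path_mul p q.
Proof. exact: path_elt_mul. Qed.

Definition arrow_ideal : set kQ :=
  ideal_gen (range (fun a : arrow Q => path_elt (arrow_path a))).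

Definition admissible (I : set kQ) : Prop :=
  two_sided_ideal I /\
  exists m : nat, [/\ (2 <= m)%N, ideal_exp arrow_ideal m `<=` I &
    I `<=` ideal_exp arrow_ideal 2].

End PathAlgebra.

Section BoundQuiverAlgebra.
Variables (k : fieldType) (Q : quiver).
Variables (I : set (path_algebra k Q)) (hI : admissible I).

Definition bound_quiver_algebra : pzRingType := quotient_ring (proj1 hI).

Definition vertex_idem (x : vertex Q) : bound_quiver_algebra :=
  quotient_proj (proj1 hI) (path_elt k (trivial_path x)).

Lemma vertex_idemM x y :
  vertex_idem x * vertex_idem y = if x == y then vertex_idem x else 0.
Proof.
rewrite -rmorphM /= path_eltM /path_mul path_comp1l /path_source /=.
by case: eqP => [->|_]; last exact: raddf0.
Qed.

End BoundQuiverAlgebra.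

Section Neighbours.
Variables (Q : quiver) (l : vertex Q).

Definition neighbours : {set vertex Q} :=
  [set j | (j != l) &&
    [exists a, ((source a == l) && (target a == j)) ||
               ((source a == j) && (target a == l))]]%SET.

Definition D4_neighbours (J : {set vertex Q}) : Prop :=
  if (#|neighbours| < 4)%N then J = neighbours
  else J \subset neighbours /\ #|J| = 3%N.

Lemma D4_neighbours_sub (J : {set vertex Q}) : D4_neighbours J -> J \subset neighbours.
Proof. by rewrite /D4_neighbours; case: ifP => _ => [->|[]]. Qed.

Variables (k : fieldType) (I : set (path_algebra k Q)) (hI : admissible I).

Definition local_idem (J : {set vertex Q}) : bound_quiver_algebra hI :=
  vertex_idem hI l + \sum_(j in J) vertex_idem hI j.

Lemma local_idemP (J : {set vertex Q}) : J \subset neighbours ->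
  local_idem J * local_idem J = local_idem J.
Proof.
move=> /fintype.subsetP sJN.
have lJ : l \notin J by apply/negP => /sJN; rewrite inE eqxx.
have -> : local_idem J = \sum_(j in (l |: J)%SET) vertex_idem hI j.
  by rewrite big_setU1.
rewrite mulr_suml; apply: eq_bigr => i iJ; rewrite mulr_sumr (bigD1 i) //=.
rewrite vertex_idemM eqxx big1 ?addr0 // => j /andP[_ nji].
by rewrite vertex_idemM eq_sym (negPf nji).
Qed.

End Neighbours.

(* Main.v *)
From HB Require Import structures.
Require Import Defs.
From mathcomp Require Import boolp functions.
From mathcomp Require Import all_boot all_algebra classical_sets.

(** Everything is reduced to a condition at each vertex [m] of [A], with radical
    [J]: there are homogeneous generators [u1], [u2] of the right module [e_m J]
    and [v1], [v2] of the left module [J e_m] (possibly 0) with [v1 u1 = 0] and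
    [v2 u2 = 0]; compare the bisected presentations of Vila-Freyer and
    Crawley-Boevey.

    If [A] is biserial, the left modules give a generating pair [p1], [p2] of
    [e_m J] with each [A p_i] uniserial, whence some arrow kills [p_i] on the
    left; right modules give the dual statement, and an exchange argument
    produces the four elements.  Conversely, if the condition holds at every
    vertex, then [J u] is generated by a single [u' u] with [u'] again one of
    the chosen generators, so that [A u] is uniserial, and comparing
    [v a x = v b y] inside the uniserial right module [v A] shows that [J] kills
    the intersection of [A x] and [A y].

    The condition at [m] sees only [m] and its neighbours, and is therefore
    inherited from the corner at these vertices.  When there are at least four
    neighbours, the corners at three of them show that [m] has exactly two
    arrows in and two arrows out, all to different neighbours, and that each of
    the four is annihilated by one on the other side; the exchange argument
    applies again.  That corners inherit biseriality holds because [M |-> e M]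
    preserves uniserial and simple submodules, sums and intersections. *)

Set Implicit Arguments.
Unset Strict Implicit.
Unset Printing Implicit Defensive.

Import GRing.Theory.
Local Open Scope ring_scope.

(** * Frames and generators of the radical *)

(** A [frame] abstracts a basic split algebra: scalars enter only as central elements [c] that
    describe [e i A e i] modulo [J]. Frames pass to the converse ring and to corners, so each
    one-sided result is proved once and read in [A^c] for the other side. Counting generators is
    replaced by exchange: modulo [J] a homogeneous coefficient is zero or a unit, and Nakayama's
    lemma lifts generators from [J/J^2]. One obstacle is that biseriality speaks of all
    indecomposable projectives, which need not be finitely generated a priori, while the arguments
    concern the modules [A e_i]; another is that in (i) the corner comes without a basic structure.
    Local idempotents settle both: if 1 is a finite sum of them, every indecomposable projective is
    isomorphic to some [A f], and being biserial becomes a condition on the sets [local_radical f],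
    which behave well under passage to corners. *)

Inductive ideal_pow (A : pzRingType) (J : set A) (n : nat) : A -> Prop :=
| ideal_pow0 : ideal_pow J n 0
| ideal_powD x y : ideal_pow J n x -> ideal_pow J n y -> ideal_pow J n (x + y)
| ideal_powP s : size s = n -> (forall y, y \in s -> J y) ->
    ideal_pow J n (\prod_(y <- s) y).

(* Some e i may be 0: a corner of A keeps the index set V. *)
Record frame (A : pzRingType) (V : finType) (e : V -> A) (J : set A) : Prop :=
  Frame {
    frame_orth : forall i j, e i * e j = if i == j then e i else 0;
    frame_sum : \sum_i e i = 1;
    frame_ideal : two_sided_ideal J;
    frame_nil : exists n, forall s : seq A, size s = n ->
      (forall y, y \in s -> J y) -> \prod_(y <- s) y = 0;
    frame_off : forall i j a, i != j -> J (e i * a * e j);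
    frame_diag : forall i a, exists c, [/\ forall x, c * x = x * c,
      c = 0 \/ exists d, d * c = 1 & J (e i * a * e i - c * e i)] }.

(** Sums of products of [n] elements do not distinguish left from right, so the converse ring only
    reverses the products. For [n = 0] these sums are just the natural multiples of 1, whence the
    exponents [n.+1] below. *)
Lemma ideal_pow_op (A : pzRingType) (J : set A) n (x : A) :
  @ideal_pow A^c J n x <-> ideal_pow J n x.
Proof.
split; elim=> [|y z _ IHy _ IHz|s sn sJ]; rewrite ?rev_prodr.
- exact: (@ideal_pow0 A).
- exact: (@ideal_powD A).
- by apply: (@ideal_powP A); rewrite ?size_rev // => y; rewrite mem_rev; apply: sJ.
- exact: (@ideal_pow0 A^c).
- exact: (@ideal_powD A^c).
have -> : \prod_(y <- s) y = \prod_(y <- rev s) (y : A^c).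
  by rewrite [RHS]rev_prodr revK.
by apply: (@ideal_powP A^c); rewrite ?size_rev // => y; rewrite mem_rev; apply: sJ.
Qed.

Lemma frame_op (A : pzRingType) (V : finType) (e : V -> A) (J : set A) :
  frame e J -> @frame A^c V e J.
Proof.
case=> orth sum1 [J0 JD Jl Jr] [n nil] off diag; split => //.
- by move=> i j; rewrite -[LHS]/(e j * e i : A) orth eq_sym; case: eqP => // ->.
- exists n => s sn sJ; rewrite rev_prodr nil ?size_rev // => y.
  by rewrite mem_rev; apply: sJ.
- by move=> i j a ij; rewrite eq_sym in ij; have := off j i a ij; rewrite -mulrA.
move=> i a; have [c [cc cu cJ]] := diag i a; exists c; split => //.
- by move=> x; apply: esym; apply: cc.
- by case: cu => [|[d dc]]; [left|right; exists d; rewrite -[LHS]/(c * d : A) cc].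
by move: cJ; rewrite -mulrA cc.
Qed.

(** The inverse is a geometric sum, hence a polynomial in [x]; the third clause lets it commute with
    idempotents in [off_unit]. *)
Lemma nilpotent_sub1_unit (R : pzRingType) (x : R) n : x ^+ n = 0 ->
  exists q, [/\ (1 - x) * q = 1, q * (1 - x) = 1 &
                forall y, GRing.comm y x -> GRing.comm y q].
Proof.
move=> xn; exists (\sum_(i < n) x ^+ i).
have cq y : GRing.comm y x -> GRing.comm y (\sum_(i < n) x ^+ i).
  by move=> yx; apply: commr_sum => i _; apply: commrX.
have E : (1 - x) * (\sum_(i < n) x ^+ i) = 1.
  by rewrite -opprB mulNr -subrX1 xn sub0r opprK.
split=> //; rewrite -[RHS]E; apply/esym/cq.
by apply: commr_sym; apply: commrB => //; apply: commr1.
Qed.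

Section Frame.
Variables (A : pzRingType) (V : finType) (e : V -> A) (J : set A).
Hypothesis F : frame e J.
Implicit Types (i j m s t : V) (a b c u v x y z g h : A).

Local Notation J2 := (ideal_pow J 2).

Lemma idemM i : e i * e i = e i.
Proof. by rewrite (frame_orth F) eqxx. Qed.

Lemma J0 : J 0. Proof. by case: (frame_ideal F). Qed.
Lemma JD x y : J x -> J y -> J (x + y).
Proof. by have [_ + _ _] := frame_ideal F; apply. Qed.
Lemma JMl a x : J x -> J (a * x).
Proof. by have [_ _ + _] := frame_ideal F; apply. Qed.
Lemma JMr a x : J x -> J (x * a).
Proof. by have [_ _ _ +] := frame_ideal F; apply. Qed.
Lemma JN x : J x -> J (- x).
Proof. by rewrite -mulN1r; apply: JMl. Qed.
Lemma JB x y : J x -> J y -> J (x - y).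
Proof. by move=> Jx /JN; apply: JD. Qed.

Lemma ideal_powS n x b : ideal_pow J n x -> J b -> ideal_pow J n.+1 (x * b).
Proof.
move=> + Jb; elim=> [|y z _ IHy _ IHz|s sn sJ].
- by rewrite mul0r; apply: ideal_pow0.
- by rewrite mulrDl; apply: ideal_powD.
have -> : \prod_(y <- s) y * b = \prod_(y <- rcons s b) y by rewrite big_rcons.
apply: ideal_powP; rewrite ?size_rcons ?sn // => y.
by rewrite mem_rcons inE => /predU1P[->|/sJ].
Qed.

Lemma ideal_powMr n x a : ideal_pow J n.+1 x -> ideal_pow J n.+1 (x * a).
Proof.
elim=> [|y z _ IHy _ IHz|s]; first by rewrite mul0r; apply: ideal_pow0.
  by rewrite mulrDl; apply: ideal_powD.
case/lastP: s => // s y; rewrite size_rcons => -[sn] sJ.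
rewrite big_rcons /= -mulrA; apply: ideal_powS.
  by apply: ideal_powP => // z zs; apply: sJ; rewrite mem_rcons inE zs orbT.
by apply: JMr; apply: sJ; rewrite mem_rcons inE eqxx.
Qed.

Lemma J2M x y : J x -> J y -> J2 (x * y).
Proof.
move=> Jx Jy; have -> : x * y = \prod_(z <- [:: x; y]) z.
  by rewrite !big_cons big_nil mulr1.
by apply: ideal_powP => // z; rewrite !inE => /orP[]/eqP ->.
Qed.

Lemma ideal_pow_nil : exists n, forall x, ideal_pow J n.+1 x -> x = 0.
Proof.
have [n nil] := frame_nil F; exists n => x.
elim=> [|y z _ -> _ ->|[//|y s] [sn] sJ]; rewrite ?addr0 //.
by rewrite big_cons nil ?mulr0 // => z zs; apply: sJ; rewrite inE zs orbT.
Qed.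

Lemma nilpotentJ x : J x -> exists n, x ^+ n = 0.
Proof.
move=> Jx; have [n nil] := frame_nil F; exists n.
rewrite -[RHS](nil (nseq n x)) ?size_nseq // ?big_nseq ?iter_mulr_1 //.
by move=> y; rewrite mem_nseq => /andP[_ /eqP ->].
Qed.

Lemma off_unit s t b : e t * b = b -> b * e s = b -> ~ J b ->
  t = s /\ exists b', [/\ b' * b = e s, b * b' = e t & e s * b' * e t = b'].
Proof.
move=> tb bs nJb; have [ts|nts] := eqVneq t s; last first.
  by case: nJb; rewrite -bs -tb; apply: (frame_off F).
split=> //; move: tb; rewrite {t}ts => tb.
have [c [cc cu]] := frame_diag F s b; rewrite tb bs => Jc.
case: cu => [c0|[d dc]]; first by case: nJb; rewrite c0 mul0r subr0 in Jc.
have dC x : d * x = x * d.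
  by rewrite -[RHS]mul1r -dc -!mulrA [c * _]mulrA cc -!mulrA cc dc mulr1.
pose n := e s - d * b.
have Jn : J n.
  have -> : n = - d * (b - c * e s).
    by rewrite mulrBr !mulNr opprK mulrA dc mul1r addrC.
  exact: JMl.
have nr : n * e s = n by rewrite mulrBl idemM -mulrA bs.
have nl : e s * n = n by rewrite mulrBr idemM mulrA -dC -mulrA tb.
have [k nk] := nilpotentJ Jn.
have [q [q1 q2 qc]] := nilpotent_sub1_unit nk.
have qe : e s * q = q * e s by apply: qc; rewrite /GRing.comm nr nl.
have dbE : d * b = (1 - n) * e s by rewrite mulrBl mul1r nr opprB addrC subrK.
have dbE' : b * d = e s * (1 - n) by rewrite -dC dbE mulrBl mul1r nr mulrBr mulr1 nl.
exists (d * (q * e s)); split.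
- by rewrite -!mulrA tb mulrA dC -mulrA dbE mulrA q2 mul1r.
- by rewrite mulrA dbE' -mulrA [_ * (q * _)]mulrA q1 mul1r idemM.
by rewrite mulrA -dC -!mulrA idemM -qe [e s * (_ * _)]mulrA idemM.
Qed.

Lemma sum_idemr x : x = \sum_i x * e i.
Proof. by rewrite -mulr_sumr (frame_sum F) mulr1. Qed.

Definition homog m s u := [/\ J u, e m * u = u & u * e s = u].

Lemma homog0 m s : homog m s 0.
Proof. by split; [exact: J0|rewrite mulr0|rewrite mul0r]. Qed.

Definition rgens m x y :=
  [/\ exists s, homog m s x, exists s, homog m s y &
      forall z, J z -> e m * z = z -> exists g h, z = x * g + y * h].

Lemma rgensC m x y : rgens m x y -> rgens m y x.
Proof.
case=> hx hy gen; split=> // z Jz mz; have [g [h ->]] := gen z Jz mz.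
by exists h, g; rewrite addrC.
Qed.

(* Nakayama's lemma for the right module e_m J, J being nilpotent. *)
Lemma nakayama m (K : A -> Prop) :
  K 0 -> (forall x y, K x -> K y -> K (x + y)) -> (forall x a, K x -> K (x * a)) ->
  (forall x, K x -> e m * x = x) ->
  (forall z, J z -> e m * z = z -> exists2 k, K k & J2 (z - k)) ->
  forall z, J z -> e m * z = z -> K z.
Proof.
move=> K0 KD KM Km gen.
have step n : forall z, J z -> e m * z = z ->
    exists2 k, K k & ideal_pow J n.+1 (z - k).
  elim: n => [|n IHn] z Jz mz.
    exists 0; rewrite ?subr0 //.
    have -> : z = \prod_(y <- [:: z]) y by rewrite big_cons big_nil mulr1.
    by apply: ideal_powP => // y; rewrite inE => /eqP ->.
  have [k Kk J2k] := gen z Jz mz.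
  suff [k' Kk' Pk'] : exists2 k', K k' & ideal_pow J n.+2 (e m * (z - k) - k').
    exists (k + k'); first exact: KD.
    by move: Pk'; rewrite mulrBr mz Km // opprD addrA.
  elim: J2k => [|x y _ [k1 K1 P1] _ [k2 K2 P2]|[//|a [//|b [|//]]] _ sJ].
  - by exists 0; rewrite ?mulr0 ?subr0 //; apply: ideal_pow0.
  - exists (k1 + k2); first exact: KD.
    by rewrite mulrDr opprD addrACA; apply: ideal_powD.
  have Ja : J a by apply: sJ; rewrite mem_head.
  have Jb : J b by apply: sJ; rewrite !inE eqxx orbT.
  have [||k' Kk' Pk'] := IHn (e m * a); rewrite ?mulrA ?idemM //; first exact: JMl.
  exists (k' * b); first exact: KM.
  by rewrite !big_cons big_nil mulr1 mulrA -mulrBl; apply: ideal_powS.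
have [n nil] := ideal_pow_nil => z Jz mz.
by have [k Kk /nil/subr0_eq ->] := step n z Jz mz.
Qed.

Lemma rgens_nakayama m x y :
  (exists s, homog m s x) -> (exists s, homog m s y) ->
  (forall z, J z -> e m * z = z -> exists g h, J2 (z - (x * g + y * h))) ->
  rgens m x y.
Proof.
move=> hx hy gen; split=> //.
have [[s [_ mx _]] [t [_ my _]]] := (hx, hy).
apply: (@nakayama m (fun z => exists g h, z = x * g + y * h)).
- by exists 0, 0; rewrite !mulr0 addr0.
- by move=> _ _ [g [h ->]] [g' [h' ->]]; exists (g + g'), (h + h'); rewrite !mulrDr addrACA.
- by move=> _ a [g [h ->]]; exists (g * a), (h * a); rewrite mulrDl !mulrA.
- by move=> _ [g [h ->]]; rewrite mulrDr !mulrA mx my.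
by move=> z Jz mz; have [g [h J2z]] := gen z Jz mz; exists (x * g + y * h) => //; exists g, h.
Qed.

(** Steinitz exchange: the coefficient [e s * g * e t] is a unit, so [x] is recovered from [z] and
    [y]. *)
Lemma rgens_exchange1 m s t x y z g h :
  rgens m x y -> homog m s x -> homog m t z ->
  z = x * g + y * h -> ~ J (e s * g * e t) -> rgens m z y.
Proof.
move=> [_ hy gen] [Jx mx xs] hz zE nJ.
have [_ [g' [_ gg' _]]] : s = t /\ _ :=
  @off_unit t s (e s * g * e t) ltac:(by rewrite !mulrA idemM)
    ltac:(by rewrite -!mulrA idemM) nJ.
have [_ _ zt] := hz.
have xE : x = z * g' - y * (h * e t * g').
  have -> : y * (h * e t * g') = y * h * e t * g' by rewrite !mulrA.
  rewrite -mulrBl -{1}zt -mulrBl zE addrK.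
  have -> : x * g * e t * g' = x * (e s * g * e t * g') by rewrite !mulrA xs.
  by rewrite gg' xs.
split=> //; first by exists t.
move=> w Jw mw; have [a [b ->]] := gen w Jw mw.
exists (g' * a), (b - h * e t * g' * a).
by rewrite {1}xE mulrBl mulrBr !mulrA addrAC addrA.
Qed.

Lemma homogMr s t m x g : homog m s x -> x * (e s * g * e t) = x * g * e t.
Proof. by case=> _ _ xs; rewrite !mulrA xs. Qed.

Lemma rgens_coef m r s t x y z :
  rgens m x y -> homog m r x -> homog m s y -> homog m t z ->
  exists g h, z = x * (e r * g * e t) + y * (e s * h * e t).
Proof.
case=> _ _ gen hx hy [Jz mz zt]; have [g [h zE]] := gen z Jz mz; exists g, h.
by rewrite (homogMr _ _ hx) (homogMr _ _ hy) -mulrDl -zE zt.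
Qed.

Lemma idem_corner s t a : e s * (e s * a * e t) * e t = e s * a * e t.
Proof. by rewrite !mulrA idemM -!mulrA idemM. Qed.

(** Were the coefficient of [x] in [J], [z] would be a right multiple of [y] modulo [J^2]. *)
Lemma rgens_exchange2 m t x y z : rgens m x y -> homog m t z ->
  (forall h, ~ J2 (z - y * h)) -> rgens m z y.
Proof.
move=> gxy hz nJ; have [[r hx] [s hy] _] := gxy.
have [g [h zE]] := rgens_coef gxy hx hy hz.
apply: (rgens_exchange1 gxy hx hz zE); rewrite idem_corner => Jg.
apply: (nJ (e s * h * e t)); rewrite zE addrK.
by apply: J2M => //; case: hx.
Qed.

Lemma rgens_exchange m t x y z : rgens m x y -> homog m t z -> ~ J2 z ->
  rgens m z y \/ rgens m z x.
Proof.
move=> gxy hz nJ; have [[r hx] [s hy] _] := gxy.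
have [g [h zE]] := rgens_coef gxy hx hy hz.
case: (pselect (J (e r * g * e t))) => [Jg|nJg]; last first.
  by left; apply: (rgens_exchange1 gxy hx hz zE); rewrite idem_corner.
case: (pselect (J (e s * h * e t))) => [Jh|nJh]; last first.
  right; rewrite addrC in zE.
  by apply: (rgens_exchange1 (rgensC gxy) hy hz zE); rewrite idem_corner.
case: nJ; rewrite zE; case: hx hy => [Jx _ _] [Jy _ _].
by apply: ideal_powD; apply: J2M.
Qed.

(* P generates e_m J as a right module modulo J^2. *)
Definition rspan m (P : A -> Prop) := forall K : A -> Prop,
  (forall x y, K x -> K y -> K (x + y)) -> (forall x a, K x -> K (x * a)) ->
  (forall x, J2 x -> K x) -> (forall x s, P x -> homog m s x -> K x) ->
  forall z, J z -> e m * z = z -> K z.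

(** If every homogeneous element of [P] is a right multiple of [y] modulo [J^2], then [y] alone
    generates and 0 serves as its companion; otherwise an exception is exchanged for [x]. *)
Lemma rgens_select1 m (P : A -> Prop) x y : rspan m P -> rgens m x y ->
  exists2 p, P p \/ p = 0 & rgens m p y.
Proof.
move=> spanP gxy; have [_ hy _] := gxy; have [t [_ my _]] := hy.
have [allK|] := pselect (forall p s, P p -> homog m s p -> exists h, J2 (p - y * h)).
  exists 0; first by right.
  apply: rgens_nakayama => //; first by exists m; apply: homog0.
  move=> z Jz mz; suff [h J2z] : exists h, J2 (z - y * h).
    by exists 0, h; rewrite mul0r add0r.
  apply: (spanP (fun z => exists h, J2 (z - y * h))) => //.
  - move=> a b [g Jg] [h Jh]; exists (g + h); rewrite mulrDr opprD addrACA.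
    exact: ideal_powD.
  - by move=> a b [g Jg]; exists (g * b); rewrite mulrA -mulrBl; apply: ideal_powMr.
  by move=> a J2a; exists 0; rewrite mulr0 subr0.
move=> /existsNP[p] /existsNP[s] /not_implyP[Pp] /not_implyP[hp nK].
exists p; first by left.
by apply: (rgens_exchange2 gxy hp) => h Jh; apply: nK; exists h.
Qed.

Lemma rgens_select m (P : A -> Prop) x y : rspan m P -> rgens m x y ->
  exists p p', [/\ P p \/ p = 0, P p' \/ p' = 0 & rgens m p p'].
Proof.
move=> spanP /(rgens_select1 spanP)[p Pp] /rgensC/(rgens_select1 spanP)[p' Pp' g].
by exists p', p.
Qed.

(** Uniseriality of the right module [q A], tested on cyclic submodules. *)
Definition runiserial q :=
  forall a b, (exists c, q * a = q * b * c) \/ (exists c, q * b = q * a * c).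

Lemma runiserial0 : runiserial 0.
Proof. by move=> a b; left; exists 0; rewrite !mul0r. Qed.

(** The elements [q x] and [q y] of [q A] are comparable, say [q x = q y c]; then [x - y c], made
    homogeneous, may replace [x] and is killed by [q]. *)
Lemma runiserial_kill m q x y : rgens m x y -> runiserial q ->
  exists w w', rgens m w w' /\ q * w = 0.
Proof.
have main x' y' c : rgens m x' y' -> q * x' = q * y' * c ->
    exists w w', rgens m w w' /\ q * w = 0.
  move=> [[s hx] [t hy] gen] qE; exists (x' - y' * (e t * c * e s)), y'.
  have [[Jx mx xs] [Jy my yt]] := (hx, hy).
  have qw : q * (x' - y' * (e t * c * e s)) = 0.
    by rewrite (homogMr _ _ hy) mulrBr !mulrA -qE -[q * x' * _]mulrA xs subrr.
  split=> //; split; last 1 first.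
  - move=> z Jz mz; have [g [h ->]] := gen z Jz mz.
    exists g, (e t * c * e s * g + h); rewrite mulrDr addrA mulrBl !mulrA.
    by rewrite subrK.
  - exists s; split; first by apply: JB => //; apply: JMr.
      by rewrite mulrBr !mulrA mx my.
    by rewrite mulrBl xs -!mulrA idemM.
  by exists t.
move=> gxy uq; case: (uq x y) => -[c qE]; first exact: (main x y c).
by apply: (main y x c) => //; apply: rgensC.
Qed.

End Frame.

(** * Left-hand notions, and the exchange argument at a vertex *)

Definition lhomog (A : pzRingType) (V : finType) (e : V -> A) (J : set A)
  (m s : V) (x : A) : Prop := @homog A^c V e J m s x.
Definition lgens (A : pzRingType) (V : finType) (e : V -> A) (J : set A)
  (m : V) (x y : A) : Prop := @rgens A^c V e J m x y.
Definition lspan (A : pzRingType) (V : finType) (e : V -> A) (J : set A)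
  (m : V) (P : A -> Prop) : Prop := @rspan A^c V e J m P.
Definition luniserial (A : pzRingType) (x : A) : Prop := @runiserial A^c x.

Lemma luniserialP (A : pzRingType) (x : A) : luniserial x <->
  forall a b : A, (exists c : A, a * x = c * (b * x)) \/
                  (exists c : A, b * x = c * (a * x)).
Proof. by []. Qed.

Definition bisected (A : pzRingType) (V : finType) (e : V -> A) (J : set A) m :=
  exists u1 u2 v1 v2, [/\ rgens e J m u1 u2, lgens e J m v1 v2,
    v1 * u1 = 0 & v2 * u2 = 0].

Section Bisection.
Variables (A : pzRingType) (V : finType) (e : V -> A) (J : set A).
Hypothesis F : frame e J.
Let Fc := frame_op F.
Implicit Types (i j m s t : V) (a b c u v x y z g h : A).

Local Notation J2 := (ideal_pow J 2).

Lemma lhomogE s t x : lhomog e J s t x <-> [/\ J x, x * e s = x & e t * x = x].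
Proof. by []. Qed.

Lemma lgensP m x y : lgens e J m x y <->
  [/\ exists s, lhomog e J m s x, exists s, lhomog e J m s y &
      forall z, J z -> z * e m = z -> exists g h, z = g * x + h * y].
Proof. by []. Qed.

(** An element of [e m J e s] is a combination of [p s] and [p' s] with left coefficients. Modulo
    [J] these are central scalars or vanish, so modulo [J^2] they can be moved to the right: left
    generators at all vertices give right generators at [m]. *)
Lemma lgens_rspan (p p' : V -> A) m :
  (forall s, lgens e J s (p s) (p' s)) ->
  rspan e J m (fun x => exists s, x = p s \/ x = p' s).
Proof.
move=> gp K KD KM KJ KP.
have K0 : K 0 by apply: KJ; apply: ideal_pow0.
have KMl s x g : (x = p s \/ x = p' s) -> K (e m * g * x).
  move=> xp; have [t] : exists t, lhomog e J s t x.
    by have [h1 h2 _] := gp s; case: xp => ->.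
  move=> /lhomogE[Jx xs tx].
  have [mt|nmt] := eqVneq m t; last first.
    rewrite -tx mulrA; apply: KJ. apply: J2M => //.
    exact: (frame_off F).
  have [c [cc _ Jc]] := frame_diag F m g; rewrite -mt in tx.
  have -> : e m * g * x = (e m * g * e m - c * e m) * x + x * c.
    by rewrite mulrBl -!mulrA tx cc subrK.
  apply: KD; first by apply: KJ; apply: J2M.
  by apply: KM; apply: (KP x s) => //; exists s.
move=> z Jz mz; rewrite (sum_idemr F z); apply: (big_ind K) => // s _.
have /lgensP[_ _ gen] := gp s.
have [||g [h ze]] := gen (z * e s).
- exact: (JMr F).
- by rewrite -mulrA (idemM F).
rewrite -mz -mulrA ze mulrDr !mulrA.
by apply: KD; apply: (KMl s); [left|right].
Qed.

Lemma lgens_exchange m t x y z : lgens e J m x y -> lhomog e J m t z -> ~ J2 z ->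
  lgens e J m z y \/ lgens e J m z x.
Proof.
move=> gxy hz nJ; apply: (rgens_exchange Fc gxy hz) => /ideal_pow_op; exact: nJ.
Qed.

(** The annihilators [y1], [y2] may be dependent modulo [J^2], and so may [w1], [w2]. Exchange [y1]
    into [q1], [q2]; the surviving [q] has a partner [w], which is exchanged into [p1], [p2]. If
    [p1] survives, [p1], [w] go with [y1], [q]. If [p2] survives, exchange [y2] into [y1], [q]: then
    either [p2], [w] go with [y2], [q], or the original [p2], [p1] go with [y2], [y1]. *)
Lemma bisected_matching m p1 p2 y1 y2 s1 s2 q1 q2 w1 w2 t1 t2 :
  rgens e J m p1 p2 -> lhomog e J m s1 y1 -> lhomog e J m s2 y2 ->
  ~ J2 y1 -> ~ J2 y2 -> y1 * p1 = 0 -> y2 * p2 = 0 ->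
  lgens e J m q1 q2 -> homog e J m t1 w1 -> homog e J m t2 w2 ->
  ~ J2 w1 -> ~ J2 w2 -> q1 * w1 = 0 -> q2 * w2 = 0 ->
  bisected e J m.
Proof.
move=> gp hy1 hy2 nJ1 nJ2 yp1 yp2 gq hw1 hw2 nw1 nw2 qw1 qw2.
have [q [w [t [gyq hw nw qw]]]] : exists q w t,
    [/\ lgens e J m y1 q, homog e J m t w, ~ J2 w & q * w = 0].
  have [gy|gy] := lgens_exchange gq hy1 nJ1; first by exists q2, w2, t2.
  by exists q1, w1, t1.
have [gw|gw] := rgens_exchange F gp hw nw; last first.
  by exists p1, w, y1, q; split=> //; apply: rgensC.
have [g|g] := lgens_exchange gyq hy2 nJ2.
  by exists p2, w, y2, q; split=> //; apply: rgensC.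
by exists p2, p1, y2, y1; split=> //; apply: rgensC.
Qed.

End Bisection.

Lemma rgens_drop (A : pzRingType) (V : finType) (e : V -> A) (J : set A) m x y :
  frame e J -> rgens e J m x y -> ideal_pow J 2 x -> rgens e J m y 0.
Proof.
move=> F [hx hy gen] J2x; apply: rgens_nakayama => //; first by exists m; apply: homog0 F _ _.
move=> z Jz mz; have [g [h ->]] := gen z Jz mz; exists h, 0.
by rewrite mul0r addr0 addrK; apply: ideal_powMr F _ _ _ _.
Qed.

Lemma bisected_of_uniserial (A : pzRingType) (V : finType) (e : V -> A) (J : set A)
    (p p' q q' : V -> A) : frame e J ->
  (forall s, [/\ lgens e J s (p s) (p' s), luniserial (p s) & luniserial (p' s)]) ->
  (forall s, [/\ rgens e J s (q s) (q' s), runiserial (q s) & runiserial (q' s)]) ->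
  forall m, bisected e J m.
Proof.
move=> F gp gq m; have Fc := frame_op F.
pose P (x : A) := exists s, x = p s \/ x = p' s.
pose Q (x : A) := exists s, x = q s \/ x = q' s.
have spanP : rspan e J m P by apply: (lgens_rspan F) => s; case: (gp s).
have spanQ : lspan e J m Q by apply: (lgens_rspan Fc) => s; case: (gq s).
have LU x : P x \/ x = 0 -> luniserial x.
  case=> [[s xE]|->]; last exact: runiserial0.
  by have [_ u u'] := gp s; case: xE => ->.
have RU x : Q x \/ x = 0 -> runiserial x.
  case=> [[s xE]|->]; last exact: runiserial0.
  by have [_ u u'] := gq s; case: xE => ->.
have [gpm _ _] := gp m; have [gqm _ _] := gq m.
have killL x : P x \/ x = 0 -> exists w w', lgens e J m w w' /\ w * x = 0.
  by move=> /LU; apply: (runiserial_kill Fc gpm).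
have killR x : Q x \/ x = 0 -> exists w w', rgens e J m w w' /\ x * w = 0.
  by move=> /RU; apply: (runiserial_kill F gqm).
(* If one side needs only one generator, the second is taken to be 0 and its annihilation is
   automatic. *)
have [[x gx]|nr1] := pselect (exists x, rgens e J m x 0).
  have [p0 /killL[w [w' [gw wp]]] gp0] := rgens_select1 F spanP gx.
  by exists p0, 0, w, w'; rewrite mulr0.
have [[x gx]|nl1] := pselect (exists x, lgens e J m x 0).
  have [q0 /killR[w [w' [gw wp]]] gq0] := rgens_select1 Fc spanQ gx.
  by exists w, w', q0, 0; rewrite mul0r.
have [p1 [p2 [/killL[y1 [y1' [gy1 yp1]]] /killL[y2 [y2' [gy2 yp2]]] gpp]]] :=
  rgens_select F spanP gqm.
have [q1 [q2 [/killR[w1 [w1' [gw1 qw1]]] /killR[w2 [w2' [gw2 qw2]]] gqq]]] :=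
  rgens_select Fc spanQ gpm.
(* Both sides now need two generators, so no member of a generating pair lies in [J^2]. *)
have nJl w w' : lgens e J m w w' -> ~ ideal_pow J 2 w.
  move=> g /ideal_pow_op J2w; apply: nl1; exists w'.
  exact: (rgens_drop Fc g).
have nJr w w' : rgens e J m w w' -> ~ ideal_pow J 2 w.
  by move=> g J2w; apply: nr1; exists w'; apply: (rgens_drop F g).
have [[s1 h1] _ _] := gy1; have [[s2 h2] _ _] := gy2.
have [[t1 k1] _ _] := gw1; have [[t2 k2] _ _] := gw2.
by apply: (bisected_matching F gpp h1 h2 _ _ yp1 yp2 gqq k1 k2 _ _ qw1 qw2);
  [apply: nJl gy1|apply: nJl gy2|apply: nJr gw1|apply: nJr gw2].
Qed.

(** * Independent generating pairs, chosen at every vertex *)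

Definition rindep (A : pzRingType) (J : set A) (x y : A) :=
  (x = 0 \/ forall g, ~ ideal_pow J 2 (x - y * g)) /\
  (y = 0 \/ forall g, ~ ideal_pow J 2 (y - x * g)).

Definition lindep (A : pzRingType) (J : set A) (x y : A) : Prop :=
  @rindep A^c J x y.

(** A redundant generator is replaced by 0 and the other one is left alone, so that vanishing
    products still vanish afterwards. *)
Lemma rgens_indep (A : pzRingType) (V : finType) (e : V -> A) (J : set A) m x y :
  frame e J -> rgens e J m x y -> exists x' y',
  [/\ x' = x \/ x' = 0, y' = y \/ y' = 0, rgens e J m x' y' & rindep J x' y'].
Proof.
move=> F gxy.
have drop x1 y1 g : rgens e J m x1 y1 -> ideal_pow J 2 (x1 - y1 * g) ->
    rgens e J m 0 y1.
  move=> [_ hy gen] J2x; apply: rgens_nakayama => //.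
    by exists m; apply: homog0 F _ _.
  move=> z Jz mz; have [a [b ->]] := gen z Jz mz; exists 0, (g * a + b).
  rewrite mul0r add0r mulrDr opprD addrACA subrr addr0 mulrA -mulrBl.
  exact: ideal_powMr F _ _ _ _.
have [x' [x'E gx' ix']] : exists x', [/\ x' = x \/ x' = 0, rgens e J m x' y &
    x' = 0 \/ forall g, ~ ideal_pow J 2 (x' - y * g)].
  have [[g J2x]|ng] := pselect (exists g, ideal_pow J 2 (x - y * g)).
    by exists 0; split; [right| apply: drop J2x|left].
  by exists x; split; [left| |right => g J2x; apply: ng; exists g].
have [[g J2y]|ng] := pselect (exists g, ideal_pow J 2 (y - x' * g)).
  exists x', 0; split=> //; [by right|exact/rgensC/(drop _ _ g _ J2y)/rgensC|].
  split; last by left.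
  case: ix' => [|nx']; [by left|right=> h; rewrite mul0r].
  by have := nx' 0; rewrite mulr0.
exists x', y; split=> //; first by left.
by split=> //; right=> g J2y; apply: ng; exists g.
Qed.

(** The index [~~ b] names the other member of a pair: [v m b] kills [u m b], so of the two chosen
    generators only [v m (~~ b)] can act on [u m b] nontrivially. *)
Record bisection (A : pzRingType) (V : finType) (e : V -> A) (J : set A)
    (u v : V -> bool -> A) : Prop := Bisection {
  bisection_rgens : forall m b, rgens e J m (u m b) (u m (~~ b));
  bisection_lgens : forall m b, lgens e J m (v m b) (v m (~~ b));
  bisection_mul : forall m b, v m b * u m b = 0;
  bisection_rindep : forall m b, rindep J (u m b) (u m (~~ b));
  bisection_lindep : forall m b, lindep J (v m b) (v m (~~ b)) }.

Lemma bisection_op (A : pzRingType) (V : finType) (e : V -> A) (J : set A) u v :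
  bisection e J u v -> @bisection A^c V e J v u.
Proof.
case=> gu gv uv iu iv; split=> m b; [exact: gv|exact: gu|exact: uv|exact: iv|].
(* [lindep] over [A^c] refers to the converse of the converse ring, hence two conversions of
   [ideal_pow]. *)
move: (iu m b) => [h1 h2]; split.
  by case: h1 => [->|h1]; [left|right=> g /ideal_pow_op/ideal_pow_op; apply: h1].
by case: h2 => [->|h2]; [left|right=> g /ideal_pow_op/ideal_pow_op; apply: h2].
Qed.

Lemma bisection_exists (A : pzRingType) (V : finType) (e : V -> A) (J : set A) :
  frame e J -> (forall m, bisected e J m) -> exists u v, bisection e J u v.
Proof.
move=> F bis.
have H m : exists uv : (bool -> A) * (bool -> A),
  [/\ forall b, rgens e J m (uv.1 b) (uv.1 (~~ b)),
      forall b, lgens e J m (uv.2 b) (uv.2 (~~ b)),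
      forall b, uv.2 b * uv.1 b = 0,
      forall b, rindep J (uv.1 b) (uv.1 (~~ b)) &
      forall b, lindep J (uv.2 b) (uv.2 (~~ b))].
  have [u1 [u2 [v1 [v2 [gu gv uv1 uv2]]]]] := bis m.
  have [x1 [x2 [x1E x2E gx ix]]] := rgens_indep F gu.
  have [y1 [y2 [y1E y2E gy iy]]] := rgens_indep (frame_op F) gv.
  exists (fun b : bool => if b then x1 else x2, fun b : bool => if b then y1 else y2).
  split=> -[] //=; try exact: rgensC; last 1 first.
  - by case: iy; split.
  - by case: y1E => ->; case: x1E => ->; rewrite ?mulr0 ?mul0r.
  - by case: y2E => ->; case: x2E => ->; rewrite ?mulr0 ?mul0r.
  by case: ix; split.
have [f Hf] := boolp.choice H.
by exists (fun m => (f m).1), (fun m => (f m).2); split=> m b; have [] := Hf m.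
Qed.
Lemma J_fix (A : pzRingType) (V : finType) (e : V -> A) (J : set A) j x :
  frame e J -> J j -> x = j * x -> x = 0.
Proof.
move=> F Jj xE; have [k jk] := nilpotentJ F Jj.
have [q [_ q1 _]] := nilpotent_sub1_unit jk.
by rewrite -[x]mul1r -q1 -mulrA mulrBl mul1r -xE subrr mulr0.
Qed.

(* A chain w, j1 w, j2 j1 w, ... each term of which generates the radical of
   the module generated by the previous one exhausts all submodules of A w. *)
Lemma luniserial_chain (A : pzRingType) (V : finType) (e : V -> A) (J : set A)
    (C : A -> Prop) : frame e J ->
  (forall w, C w -> w = 0 \/ (exists t, e t * w = w) /\
     exists j', [/\ J j', C (j' * w) &
       forall j, J j -> exists a, j * w = a * (j' * w)]) ->
  forall w, C w -> luniserial w.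
Proof.
move=> F HC; have [N nil] := frame_nil F.
suff H n w : C w -> (forall s, size s = n -> (forall y, y \in s -> J y) ->
    (\prod_(y <- s) y) * w = 0) -> luniserial w.
  move=> w Cw; apply: (H N) => // s sN sJ.
  by rewrite nil ?mul0r.
elim: n w => [|n IHn] w Cw nilw.
  have -> : w = 0 by have := nilw [::] erefl (fun _ => ltac:(by [])); rewrite big_nil mul1r.
  exact: runiserial0.
have [->|[[t tw] [j' [Jj' Cj' gen]]]] := HC w Cw; first exact: runiserial0.
have uw' : luniserial (j' * w).
  apply: IHn => // s sn sJ; rewrite mulrA.
  have <- : \prod_(y <- rcons s j') y = (\prod_(y <- s) y) * j' by rewrite big_rcons.
  apply: nilw => [|y]; first by rewrite size_rcons sn.
  by rewrite mem_rcons inE => /predU1P[->|/sJ].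
have full b : ~ J (b * e t) -> exists c, c * b * w = w.
  move=> nJ; have [s nJs] : exists s, ~ J (e s * b * e t).
    apply: contrapT => /forallNP nJs; apply: nJ.
    rewrite -[b]mul1r -(frame_sum F) !mulr_suml.
    apply: big_ind => [||s _]; [exact: (J0 F)|exact: (JD F)|exact: contrapT].
  have [||_ [c [cb _ _]]] := @off_unit _ _ _ _ F t s (e s * b * e t) _ _ nJs.
  - by rewrite !mulrA (idemM F).
  - by rewrite -!mulrA (idemM F).
  exists (c * e s).
  by rewrite -[RHS]tw -cb -!mulrA tw.
apply/luniserialP => a b; have [Ja|nJa] := pselect (J (a * e t)); last first.
  by have [c cE] := full a nJa; right; exists (b * c); rewrite -mulrA [c * _]mulrA cE.
have [Jb|nJb] := pselect (J (b * e t)); last first.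
  by have [c cE] := full b nJb; left; exists (a * c); rewrite -mulrA [c * _]mulrA cE.
have [a' aE] := gen _ Ja; have [b' bE] := gen _ Jb.
rewrite -mulrA tw in aE; rewrite -mulrA tw in bE; rewrite aE bE.
by move/luniserialP: uw'; apply.
Qed.

(** * Uniseriality of the modules generated by a bisection *)

Section BisectionUniserial.
Variables (A : pzRingType) (V : finType) (e : V -> A) (J : set A).
Variables (u v : V -> bool -> A).
Hypotheses (F : frame e J) (B : bisection e J u v).
Let Fc := frame_op F.
Implicit Types (l m s t : V) (a b c x y z g h : A).

Let U x := exists m (i : bool), x = u m i.

(** The [u] are right generators at the vertices where they start. By [lgens_rspan] in the converse
    ring, those ending at [l] also generate [J e_l] on the left, and two of them suffice. This links
    the data at different vertices. *)
Lemma bisection_lgens_u l : exists x y,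
  [/\ U x \/ x = 0, U y \/ y = 0, lgens e J l x y & lindep J x y].
Proof.
have spanU : lspan e J l (fun x => exists s, x = u s true \/ x = u s false).
  apply: (lgens_rspan Fc) => s; exact: (bisection_rgens B s true).
have [x0 [y0 [hx0 hy0 g0]]] := rgens_select Fc spanU (bisection_lgens B l true).
have [x [y [hx hy gxy ixy]]] := rgens_indep Fc g0.
have E x1 : (exists s, x1 = u s true \/ x1 = u s false) \/ x1 = 0 -> U x1 \/ x1 = 0.
  by case=> [[s [|] ->]|->]; [left; exists s, true|left; exists s, false|right].
exists x, y; split=> //.
  by case: hx => ->; [apply: E|right].
by case: hy => ->; [apply: E|right].
Qed.

(** Since [v0] kills [x0], [J x0 = A v1 x0]. For the step to be repeated, [v1] has to be traded for
    one of the [u]: left generators [y], [z] of [J e_m] are taken from that family, and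
    [y x0 = cy v1 x0], [z x0 = cz v1 x0]. If a coefficient is a unit, the corresponding element
    works. *)
Lemma bisection_next x : U x -> (exists t, e t * x = x) /\
  exists2 y, U y \/ y = 0 & forall j, J j -> exists a, j * x = a * (y * x).
Proof.
case=> [m [i ->]]; have [[t [_ tx _]] _ _] := bisection_rgens B m i.
split; first by exists m.
have gv := bisection_lgens B m i; have /lgensP[_ _ genv] := gv.
have vu := bisection_mul B m i.
set x0 := u m i in vu tx *; set v0 := v m i in vu gv genv *; set v1 := v m (~~ i) in gv genv *.
have Jx j : J j -> exists h, j * x0 = h * (v1 * x0).
  move=> Jj; have [||g [h E]] := genv (j * e m); first exact: (JMr F).
    by rewrite -mulrA (idemM F).
  by exists h; rewrite -{1}tx mulrA E mulrDl -!mulrA vu mulr0 add0r.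
have [y [z [Uy Uz gyz _]]] := bisection_lgens_u m.
have [[r hr] [s hs] _] := gv.
have [[ty hy] [tz hz] _] := gyz; have /lgensP[_ _ gen] := gyz.
have coef w tw : lhomog e J m tw w -> exists c,
    [/\ e tw * c = c, c * e s = c & w * x0 = c * v1 * x0].
  move=> /lhomogE[Jw wm tww]; have [g [h E]] := genv w Jw wm.
  have /lhomogE[_ _ sv1] := hs.
  exists (e tw * h * e s); split; first by rewrite !mulrA (idemM F).
    by rewrite -!mulrA (idemM F).
  rewrite -[_ * v1]mulrA sv1 -tww {1}E mulrDr mulrDl !mulrA.
  by rewrite -[_ * v0 * x0]mulrA vu mulr0 add0r.
have unit w tw c : e tw * c = c -> c * e s = c -> ~ J c -> w * x0 = c * v1 * x0 ->
    forall j, J j -> exists a, j * x0 = a * (w * x0).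
  move=> h1 h2 nJ wE j /Jx[h ->].
  have [_ [c' [cc' _ _]]] := off_unit F h1 h2 nJ.
  have /lhomogE[_ _ sv1] := hs.
  by exists (h * c'); rewrite wE -!mulrA [c' * _]mulrA cc' [e s * _]mulrA sv1.
have [cy [cy1 cy2 yE]] := coef y ty hy; have [cz [cz1 cz2 zE]] := coef z tz hz.
have [Jcy|nJ] := pselect (J cy); last by exists y => //; exact: (unit y ty cy).
have [Jcz|nJ] := pselect (J cz); last by exists z => //; exact: (unit z tz cz).
(* Both coefficients are in [J], so [v1 x0] lies in [J v1 x0]; hence it is 0 and [J x0 = 0]. *)
exists 0; first by right.
move=> j /Jx[h ->]; exists 0; rewrite mul0r.
have /lhomogE[Jv1 v1m _] := hs; have [g' [h' E]] := gen v1 Jv1 v1m.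
suff -> : v1 * x0 = 0 by rewrite mulr0.
apply: (J_fix F (j := g' * cy + h' * cz)).
  by apply: (JD F); apply: (JMl F).
by rewrite mulrDl -!mulrA [cy * _]mulrA [cz * _]mulrA -yE -zE {1}E mulrDl !mulrA.
Qed.

Lemma bisection_luniserial m (b : bool) : luniserial (u m b).
Proof.
pose C w := exists x z, [/\ U x \/ x = 0 & w = x * z].
apply: (luniserial_chain F (C := C)); last first.
  by exists (u m b), 1; rewrite mulr1; split=> //; left; exists m, b.
move=> _ [x [z [[Ux|->] ->]]]; last by left; rewrite mul0r.
right; have [[t tx] [y Uy gen]] := bisection_next Ux.
split; first by exists t; rewrite mulrA tx.
exists y; split.
- case: Uy => [[s [i ->]]|->]; last exact: (J0 F).
  by have [[r []]] := bisection_rgens B s i.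
- by exists y, (x * z).
by move=> j /gen[a E]; exists a; rewrite !mulrA E !mulrA.
Qed.

(** Expand [g' x] in the generators [y], [u'] of [e_m J]. As [v' u' = 0], only the coefficient of
    [y] matters and [c v' y = c v' y G]. If [G] is in [J], this forces 0. If [G] is a unit, then [y]
    lies in [u' A + J^2] as soon as [g' x] does, against independence. *)
Lemma bisection_factor l m s (i k : bool) c g :
  let x := u s i in let y := u m k in let v' := v m (~~ k) in
  x * e l = x -> y * e l = y -> x <> y -> y <> 0 ->
  c * v' * y = c * v' * g * x -> c * v' * y = 0.
Proof.
move=> x y v' xl yl nxy y0 cE; pose g' := e m * g * e s.
have [[_ [Jx sx _]] _ _] := bisection_rgens B s i.
have [[_ [Jy my _]] [_ [Ju mu _]] gen] := bisection_rgens B m k.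
have [[_ /lhomogE[Jv' v'm _]] _ _] := bisection_lgens B m (~~ k).
rewrite -/x -/y -/v' in Jx sx Jy my gen Jv' v'm *; set u' := u m (~~ k) in Ju mu gen.
have vu' : v' * u' = 0 by apply: (bisection_mul B).
have g'x : e m * (g' * x) = g' * x by rewrite !mulrA (idemM F).
have [h1 [h2 gE]] := gen _ (JMl F g' Jx) g'x.
pose G := e l * h1 * e l.
have wG : c * v' * y = c * v' * y * G.
  have -> : c * v' * y * G = c * v' * y * h1 * e l by rewrite !mulrA -[_ * y * e l]mulrA yl.
  rewrite {1}cE; transitivity (c * v' * (g' * x) * e l).
    by rewrite /g' -!mulrA xl sx [v' * (e m * _)]mulrA v'm.
  rewrite gE mulrDr -[_ * (u' * _)]mulrA [v' * (u' * _)]mulrA vu' mul0r mulr0 addr0.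
  by rewrite !mulrA.
have [JG|nJG] := pselect (J G); first exact: (J_fix (frame_op F) JG wG).
have [||_ [G' [_ GG' _]]] := @off_unit _ _ _ _ F l l G _ _ nJG.
- by rewrite /G !mulrA (idemM F).
- by rewrite /G -!mulrA (idemM F).
have [//|ny] := (bisection_rindep B m k).1; exfalso.
suff [g3 J2g3] : exists g3, ideal_pow J 2 (g' * x - u' * g3).
  apply: (ny ((g3 - h2 * e l) * G')).
  have yE : y = (g' * x - u' * (h2 * e l)) * G'.
    have gE' : g' * x = y * G + u' * (h2 * e l).
      by rewrite /G !mulrA yl -mulrDl -gE -mulrA xl.
    by rewrite gE' addrK -mulrA GG' yl.
  rewrite -/y {1}yE -/u' [u' * (_ * G')]mulrA -mulrBl mulrBr opprB addrA subrK.
  exact: ideal_powMr F _ _ _ _.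
(* If [g'] is in [J], then [g' x] is in [J^2]. Otherwise [s = m], and [x], being different from [y],
   is [u'] itself, on which [g'] acts modulo [J] as a central scalar. *)
have [Jg'|nJg'] := pselect (J g').
  by exists 0; rewrite mulr0 subr0; apply: J2M.
have [||ms _] := @off_unit _ _ _ _ F s m g' _ _ nJg'.
- by rewrite /g' !mulrA (idemM F).
- by rewrite /g' -!mulrA (idemM F).
have ik : i = ~~ k.
  have nik : i <> k by move=> ik; apply: nxy; rewrite /x /y ms ik.
  by move: nik; clear; case: i k => -[] // /(_ erefl).
have xu : x = u' by rewrite /x /u' -ms ik.
have [c0 [cc _ Jc]] := frame_diag F m g; exists c0.
rewrite -xu -[x in x * c0]sx -ms -mulrA -cc mulrA -cc -mulrBl /g' -ms.
exact: J2M.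
Qed.
End BisectionUniserial.

(** * The intersection of the two left ideals at a vertex *)

Section BisectionIntersection.
Variables (A : pzRingType) (V : finType) (e : V -> A) (J : set A).
Variables (u v : V -> bool -> A).
Hypotheses (F : frame e J) (B : bisection e J u v).
Implicit Types (l m n s t : V) (i k : bool) (a b c x y z g h : A).

Let U x := exists m i, x = u m i.

Lemma bisection_runiserial m i : runiserial (v m i).
Proof. exact: (bisection_luniserial (frame_op F) (bisection_op B) m i). Qed.

(* As y is not in A x, an element of A x and A y does not generate A y, hence lies
   in J y = A v' y, where v' is the other generator at the end of y. *)
Lemma bisection_reduce m k n a x : e n * a = a -> ~ (exists c, u m k = c * x) ->
  (exists c, a * u m k = c * x) ->
  exists c, a * u m k = c * v m (~~ k) * u m k.
Proof.
move=> na nyx [c0 ayE]; set y := u m k in nyx ayE *.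
have [[_ [_ my _]] _ _] := bisection_rgens B m k; rewrite -/y in my.
have [/lgensP[_ _ gen] vy] := (bisection_lgens B m k, bisection_mul B m k).
rewrite -/y in vy.
have ayE' : a * y = a * e m * y by rewrite -mulrA my.
have [Ja|nJa] := pselect (J (a * e m)).
  have [|g [h E]] := gen _ Ja; first by rewrite -mulrA (idemM F).
  by exists h; rewrite ayE' E mulrDl -mulrA vy mulr0 add0r.
have [||_ [a' [aa' _ _]]] := @off_unit _ _ _ _ F m n (a * e m) _ _ nJa.
- by rewrite mulrA na.
- by rewrite -mulrA (idemM F).
case: nyx; exists (a' * c0).
by rewrite -mulrA -ayE ayE' mulrA aa' my.
Qed.

(** It suffices to multiply by the generators [v n i'] of [J e_n]. By [bisection_reduce] the common
    element factors through [v s (~~ i)] on one side and [v m (~~ k)] on the other. In the uniserial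
    module [v n i' A] one of [v n i' c1 v s (~~ i)] and [v n i' c2 v m (~~ k)] is a right multiple
    of the other, and either case is an instance of [bisection_factor]. *)
Lemma bisection_inter l x y a b j : U x \/ x = 0 -> U y \/ y = 0 ->
  lgens e J l x y -> lindep J x y -> a * x = b * y -> J j -> j * (a * x) = 0.
Proof.
move=> Ux Uy [[s0 /lhomogE[Jx xl _]] [t0 /lhomogE[Jy yl _]] _] [ix iy] abE Jj.
have [->|/eqP x0] := eqVneq x 0; first by rewrite !mulr0.
have [y0|/eqP y0] := eqVneq y 0; first by rewrite abE y0 !mulr0.
case: Ux => [[s [i xE]]|//]; case: Uy => [[m [k yE]]|//].
have nxy : ~ (exists c, x = c * y).
  case=> c E; case: ix => [//|/(_ c)]; apply.
  rewrite [X in ideal_pow _ _ X](_ : _ = 0); first exact: (@ideal_pow0 A^c).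
  by rewrite {1}E; exact: subrr.
have nyx : ~ (exists c, y = c * x).
  case=> c E; case: iy => [//|/(_ c)]; apply.
  rewrite [X in ideal_pow _ _ X](_ : _ = 0); first exact: (@ideal_pow0 A^c).
  by rewrite {1}E; exact: subrr.
have nexy : x <> y by move=> E; apply: nxy; exists 1; rewrite mul1r.
rewrite (sum_idemr F j) mulr_suml big1 // => n _.
have /lgensP[_ _ gen] := bisection_lgens B n true.
have [||g [h ->]] := gen (j * e n); first exact: (JMr F).
  by rewrite -mulrA (idemM F).
suff H i' : v n i' * (a * x) = 0 by rewrite mulrDl -!mulrA !H !mulr0 addr0.
have nv : v n i' * e n = v n i'.
  by have [[r /lhomogE[]]] := bisection_lgens B n i'.
have vE z : v n i' * z = v n i' * (e n * z) by rewrite mulrA nv.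
have abn : e n * a * x = e n * b * y by rewrite -!mulrA abE.
have nn c : e n * (e n * c) = e n * c by rewrite mulrA (idemM F).
have [c1 c1E] : exists c1, e n * a * x = c1 * v s (~~ i) * x.
  rewrite xE; apply: (@bisection_reduce s i n _ y); rewrite ?nn -?xE //.
  by exists (e n * b).
have [c2 c2E] : exists c2, e n * b * y = c2 * v m (~~ k) * y.
  rewrite yE; apply: (@bisection_reduce m k n _ x); rewrite ?nn -?yE //.
  by exists (e n * a).
have c12 : c1 * v s (~~ i) * x = c2 * v m (~~ k) * y by rewrite -c1E -c2E.
rewrite vE [e n * _]mulrA.
have [[c cE]|[c cE]] := bisection_runiserial n i' (c1 * v s (~~ i)) (c2 * v m (~~ k)).
  rewrite abn c2E !mulrA yE; apply: (@bisection_factor _ _ _ _ _ _ F B l m s i k _ c);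
    rewrite -?xE -?yE //.
  transitivity (v n i' * (c2 * v m (~~ k) * y)); first by rewrite !mulrA.
  by rewrite -c12 mulrA cE !mulrA.
rewrite c1E !mulrA xE; apply: (@bisection_factor _ _ _ _ _ _ F B l s m k i _ c);
  rewrite -?xE -?yE //; first exact/nesym.
transitivity (v n i' * (c1 * v s (~~ i) * x)); first by rewrite !mulrA.
by rewrite c12 mulrA cE !mulrA.
Qed.
End BisectionIntersection.

(** * Indecomposable projective modules *)

Local Open Scope classical_set_scope.

Section Submodules.
Variables (R : pzRingType).
Implicit Types (M N : lmodType R).

Lemma submoduleP M (U : set M) : submodule U <->
  U 0 /\ forall a x y, U x -> U y -> U (a *: x + y).
Proof.
split=> [[U0 UD]|[U0 UD]].
  split; first by move: U0; rewrite in_setE.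
  by move=> a x y Ux Uy; have := UD a x y; rewrite !in_setE; apply.
split; first by rewrite in_setE.
by move=> a x y; rewrite !in_setE; apply: UD.
Qed.

Lemma submodule0 M (U : set M) : submodule U -> U 0.
Proof. by case/submoduleP. Qed.

Lemma submoduleD M (U : set M) x y : submodule U -> U x -> U y -> U (x + y).
Proof. by case/submoduleP=> _ UD Ux Uy; have := UD 1 x y Ux Uy; rewrite scale1r. Qed.

Lemma submoduleZ M (U : set M) a x : submodule U -> U x -> U (a *: x).
Proof. by case/submoduleP=> U0 UD Ux; have := UD a x 0 Ux U0; rewrite addr0. Qed.

Lemma submoduleI M (U V : set M) : submodule U -> submodule V -> submodule (U `&` V).
Proof.
move=> /submoduleP[U0 UD] /submoduleP[V0 VD]; apply/submoduleP; split=> //.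
by move=> a x y [Ux Vx] [Uy Vy]; split; [apply: UD|apply: VD].
Qed.

Lemma submodule_sum_sub M (U V : set M) : submodule U -> submodule V ->
  U `<=` submodule_sum U V /\ V `<=` submodule_sum U V.
Proof.
move=> sU sV; split=> x Ux.
  by exists x => //; exists 0; [exact: submodule0|rewrite addr0].
by exists 0; [exact: submodule0|exists x; rewrite ?add0r].
Qed.

Lemma submodule_preimage M N (h : {linear M -> N}) (V : set N) :
  submodule V -> submodule (h @^-1` V).
Proof.
move=> /submoduleP[V0 VD]; apply/submoduleP; split; first by rewrite /= linear0.
by move=> a x y Vx Vy; rewrite /= linearP; apply: VD.
Qed.

Lemma submodule_image M N (h : {linear M -> N}) (U : set M) :
  submodule U -> submodule (h @` U).
Proof.
move=> /submoduleP[U0 UD]; apply/submoduleP; split; first by exists 0; rewrite ?linear0.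
by move=> a _ _ [x Ux <-] [y Uy <-]; exists (a *: x + y); rewrite ?linearP //; apply: UD.
Qed.

Lemma uniserial_image M N (h : {linear M -> N}) (U : set M) :
  uniserial_submodule U -> uniserial_submodule (h @` U).
Proof.
move=> [sU uU]; split; first exact: submodule_image.
move=> V W sV sW VU WU.
have le V1 V2 : V1 `<=` h @` U -> U `&` h @^-1` V1 `<=` U `&` h @^-1` V2 -> V1 `<=` V2.
  by move=> V1U le12 y V1y; have [x Ux hx] := V1U y V1y; rewrite -hx in V1y *;
     have [] := le12 x (conj Ux V1y).
have [||||VW|WV] := uU (U `&` h @^-1` V) (U `&` h @^-1` W).
- exact/submoduleI/submodule_preimage.
- exact/submoduleI/submodule_preimage.
- by move=> x [].
- by move=> x [].
- by left; apply: le VU VW.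
by right; apply: le WU WV.
Qed.

Lemma simple_image M N (h : {linear M -> N}) (U : set M) :
  (forall x, U x -> h x = 0 -> x = 0) -> simple_submodule U -> simple_submodule (h @` U).
Proof.
move=> inj [sU nU U1]; split; first exact: submodule_image.
  move=> hU0; apply: nU; rewrite predeqE => x; split=> [Ux|->]; last exact: submodule0.
  apply: inj => //; have : (h @` U) (h x) by exists x.
  by rewrite hU0.
move=> V sV VU; have [||V0|VE] := U1 (U `&` h @^-1` V).
- exact/submoduleI/submodule_preimage.
- by move=> x [].
- left; rewrite predeqE => y; split=> [Vy|->]; last exact: submodule0.
  have [x Ux hx] := VU y Vy; rewrite -hx in Vy *.
  have : (U `&` h @^-1` V) x by split.
  by rewrite V0 => ->; rewrite /= linear0.
right; rewrite predeqE => y; split=> [/VU//|[x Ux <-]].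
by have [] : (U `&` h @^-1` V) x by rewrite VE.
Qed.

(** [biserial_module] with an arbitrary set in place of the radical, so that it can be carried along
    maps injective only on that set. *)
Definition biserial_set M (X : set M) := exists U V,
  [/\ uniserial_submodule U, uniserial_submodule V, X = submodule_sum U V &
      U `&` V = [set 0] \/ simple_submodule (U `&` V)].

Lemma biserial_set_sub M (X U V : set M) : uniserial_submodule U ->
  uniserial_submodule V -> X = submodule_sum U V -> U `<=` X /\ V `<=` X.
Proof. by move=> [sU _] [sV _] ->; apply: submodule_sum_sub. Qed.

Lemma biserial_set_image M N (h : {linear M -> N}) (X : set M) :
  (forall x, X x -> h x = 0 -> x = 0) -> biserial_set X -> biserial_set (h @` X).
Proof.
move=> inj [U [V [uU uV XE UV]]]; exists (h @` U), (h @` V).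
have [UX VX] := biserial_set_sub uU uV XE.
have [[sU _] [sV _]] := (uU, uV).
have hI : h @` U `&` h @` V = h @` (U `&` V).
  rewrite predeqE => y; split=> [[[x Ux <-] [z Vz zx]]|[x [Ux Vx] <-]]; last first.
    by split; exists x.
  have /subr0_eq xz : x - z = 0.
    apply: inj; last by rewrite linearB zx subrr.
    rewrite XE; exists x => //; exists (- z) => //.
    by rewrite -scaleN1r; apply: submoduleZ.
  by exists x => //; split=> //; rewrite xz.
split; [exact: uniserial_image|exact: uniserial_image| |].
  rewrite XE predeqE => y; split=> [[_ [x Ux [z Vz <-]] <-]|].
    by exists (h x); [exists x|exists (h z); [exists z|rewrite linearD]].
  move=> [_ [x Ux <-] [_ [z Vz <-] <-]]; exists (x + z); last by rewrite linearD.
  by exists x => //; exists z.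
rewrite hI; case: UV => [->|sUV]; [left|right].
  by rewrite image_set1 linear0.
by apply: simple_image => // x [/UX Xx _]; apply: inj.
Qed.

End Submodules.

(** * Local idempotents and the modules [A f] *)

Definition local_idempotent (A : pzRingType) (f : A) := f * f = f /\
  forall a, (exists b, b * (f * a * f) = f) \/ (exists b, b * (f - f * a * f) = f).

(* For f = 0 the second condition is vacuous, so that the result is {0}. *)
Definition local_radical (A : pzRingType) (f : A) : set A^o :=
  [set x : A^o | (x : A) * f = x /\ ((exists a, a * (x : A) = f) -> f = 0)].

Section LocalRadical.
Variables (A : pzRingType) (f : A) (lf : local_idempotent f).
Local Notation M := (local_radical f).
Implicit Types a b x y : A.

(** If [a (x + y) = f], then [f a x] and [f a y] add up to [f] in [f A f], so one of them is left
    invertible and [x] or [y] generates [A f]. *)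
Lemma local_radicalD x y : M x -> M y -> M (x + y).
Proof.
have [ff loc] := lf; move=> [xf nx] [yf ny]; split; first by rewrite mulrDl xf yf.
move=> [a aE].
have fE : f * a * x + f * a * y = f by rewrite -mulrDr -mulrA aE ff.
have axf : f * (a * x) * f = f * a * x by rewrite -!mulrA xf.
case: (loc (a * x)) => -[b bE].
  by apply: nx; exists (b * f * a); rewrite -[RHS]bE axf !mulrA.
have fB : f - f * a * x = f * a * y by rewrite -{1}fE addrAC subrr add0r.
by apply: ny; exists (b * f * a); rewrite -[RHS]bE axf fB !mulrA.
Qed.

Lemma local_radicalZ a x : M x -> M (a * x).
Proof.
move=> [xf nx]; split; first by rewrite -mulrA xf.
by move=> [b bE]; apply: nx; exists (b * a); rewrite -mulrA.
Qed.

Lemma local_radical0 : M 0.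
Proof. by split; rewrite ?mul0r // => -[a]; rewrite mulr0. Qed.

Lemma local_radical_submodule : submodule (M : set A^o).
Proof.
apply/submoduleP; split; first exact: local_radical0.
by move=> a x y Mx My; apply: local_radicalD => //; apply: local_radicalZ.
Qed.

End LocalRadical.
Section Generator.
Variables (A : pzRingType) (P : lmodType A) (x : P).

Definition scale_on (a : A^o) : P := (a : A) *: x.

Fact scale_on_linear : linear scale_on.
Proof. by move=> c a b; rewrite /scale_on scalerDl scalerA. Qed.

HB.instance Definition _ := GRing.isLinear.Build A A^o P _ scale_on scale_on_linear.

(** The annihilator condition makes [a f |-> a x] an isomorphism from [A f]. The image of
    [local_radical f] contains every proper submodule, hence is the only maximal one. *)
Lemma generator_radical (f : A) : local_idempotent f -> f <> 0 -> f *: x = x ->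
  (forall y, exists a, y = a *: x) -> (forall a, a *: x = 0 -> a * f = 0) ->
  @radical A P = scale_on @` local_radical f.
Proof.
move=> lf f0 fx gen ann; set K := _ @` _.
have sK : submodule K by apply: submodule_image; apply: local_radical_submodule.
have nxK : ~ K x.
  move=> [a [af na] ax]; apply: f0; apply: na; exists 1; rewrite mul1r.
  apply: subr0_eq; have [ff _] := lf.
  have := ann (a - f); rewrite mulrBl af ff; apply.
  by rewrite scalerBl fx -[X in X - _ = 0]/(scale_on a) ax subrr.
have big V : submodule V -> V <> setT -> V `<=` K.
  move=> sV nV y Vy; have [a yE] := gen y.
  exists (a * f); last by rewrite /scale_on -scalerA fx.
  have [ff _] := lf; split; first by rewrite -mulrA ff.
  move=> [b bE]; case: nV; rewrite predeqE => z; split=> // _.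
  have [c ->] := gen z; apply: submoduleZ => //.
  rewrite -fx -bE -!scalerA fx -yE; exact: submoduleZ.
have KT : K <> setT by move=> KT; apply: nxK; rewrite KT.
have maxK : maximal_submodule K.
  split=> // V sV KV; have [->|/(big _ sV) VK] := pselect (V = setT); first by right.
  by left; rewrite predeqE => y; split=> [/VK|/KV].
rewrite predeqE => y; split=> [/(_ K maxK)//|Ky V [sV nV mV]].
by have [<-|//] := mV K sK (big V sV nV).
Qed.

End Generator.

Section Principal.
Variables (A : pzRingType) (f : A).

Definition principal_pred : {pred A^o} := fun x => (x : A) * f == x.

Record principal : predArgType :=
  Principal { principal_val : A^o; _ : principal_val \in principal_pred }.

HB.instance Definition _ := [isSub for principal_val].
HB.instance Definition _ := [Choice of principal by <:].

Fact principal_pred_submod : GRing.submod_closed principal_pred.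
Proof.
split; first by rewrite unfold_in mul0r.
move=> a x y; rewrite !unfold_in => /eqP xf /eqP yf.
by rewrite mulrDl -[(a *: x : A) * f]mulrA xf yf.
Qed.
HB.instance Definition _ := GRing.isSubmodClosed.Build A A^o principal_pred
  principal_pred_submod.
HB.instance Definition _ := [SubChoice_isSubLmodule of principal by <:].

Hypothesis ff : f * f = f.

Fact principal_gen_subproof : (f : A^o) \in principal_pred.
Proof. by rewrite unfold_in ff. Qed.
Definition principal_gen : principal := Principal principal_gen_subproof.

Lemma principal_val_gen (a : A) : \val (a *: principal_gen) = a * f :> A.
Proof. by rewrite linearZ. Qed.

Lemma principal_valM (y : principal) : (\val y : A) * f = \val y.
Proof. by have := valP y; rewrite unfold_in => /eqP. Qed.

Lemma principal_genE (y : principal) : y = (\val y : A) *: principal_gen.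
Proof. by apply: val_inj; rewrite principal_val_gen principal_valM. Qed.

Lemma principal_projective : projective principal.
Proof.
move=> X Y p h surj; have [x px] := surj (h principal_gen).
pose g : {linear principal -> X} := @scale_on A X (f *: x) \o \val.
have pfx : p (f *: x) = h principal_gen.
  have fgen : principal_gen = f *: principal_gen.
    by apply: val_inj; rewrite principal_val_gen ff.
  by rewrite [in RHS]fgen !linearZZ px.
exists g => y; by rewrite [in RHS](principal_genE y) [RHS]linearZZ -pfx -[RHS]linearZZ.
Qed.

Lemma principal_indecomposable : local_idempotent f -> f <> 0 -> indecomposable principal.
Proof.
move=> lf f0; split.
  by exists principal_gen => /(congr1 val).
move=> U W sU sW UW UW0.
have gU a (V : set principal) y : submodule V -> V y ->
    a * (f * (\val y : A) * f) = f -> V = setT.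
  move=> sV Vy aE; rewrite predeqE => z; split=> // _; rewrite (principal_genE z).
  apply: submoduleZ => //.
  suff -> : principal_gen = (a * f) *: y by apply: submoduleZ.
  apply: val_inj; rewrite linearZ /= -[RHS]/(a * f * (\val y : A)) -[LHS]aE.
  by rewrite -mulrA principal_valM !mulrA.
have [x Ux [y Wy xyE]] : submodule_sum U W principal_gen by rewrite UW.
have fE : (\val x : A) + (\val y : A) = f by rewrite -[RHS]/(\val principal_gen) -xyE.
have [_ loc] := lf; case: (loc (\val x)) => -[b bE].
  right; rewrite predeqE => z; split=> [Wz|->]; last exact: submodule0.
  by rewrite -UW0; split=> //; rewrite (gU b U x).
left; rewrite predeqE => z; split=> [Uz|->]; last exact: submodule0.
rewrite -UW0; split=> //; rewrite (gU b W y) //.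
have fxy : f * (\val x : A) * f + f * (\val y : A) * f = f.
  by rewrite -mulrDl -mulrDr fE !ff.
by rewrite -[RHS]bE -[X in _ = b * (X - _)]fxy addrAC subrr add0r.
Qed.

End Principal.
Lemma left_biserial_local_radical (A : pzRingType) (f : A) :
  left_biserial A -> local_idempotent f -> f <> 0 ->
  biserial_set (local_radical f : set A^o).
Proof.
move=> bA lf f0; have [ff _] := lf.
have := bA (principal f) (principal_projective ff) (principal_indecomposable ff lf f0).
rewrite /biserial_module -/(biserial_set _).
rewrite (@generator_radical _ _ (principal_gen ff) f lf f0); first 1 last.
- by apply: val_inj; rewrite principal_val_gen ff.
- by move=> y; exists (\val y); rewrite -principal_genE.
- by move=> a a0; rewrite -(principal_val_gen ff) a0.
move=> /(@biserial_set_image _ _ _ (\val : {linear principal f -> A^o})).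
rewrite image_comp (_ : _ @` _ = local_radical f) => [|].
  by apply=> y _ y0; apply: val_inj.
rewrite predeqE => x; split=> [[a Ma <-]|Mx]; last first.
  by exists x => //; rewrite [LHS](principal_val_gen ff); case: Mx.
by rewrite (_ : (\val \o _) a = a) // [LHS](principal_val_gen ff); case: Ma.
Qed.

(** * Elimination over local idempotents *)

Section Elimination.
Variable A : pzRingType.

(** [local_idempotent] supplies left inverses only. If [b] is a left inverse of [f - f t], then
    [b f] differs from [f] by a radical element, so it has a left inverse as well, which must be
    [f - f t]; thus [b f] is also a right inverse. *)
Lemma local_radical_sub_inv (f t : A) : local_idempotent f -> local_radical f t ->
  exists b, (f - f * t) * b = f.
Proof.
move=> lf Mt; have [ff loc] := lf; have [tf nt] := Mt.
have [f0|/eqP f0] := eqVneq f 0; first by exists 0; rewrite mulr0.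
have nM a : a * t <> f by move=> aE; apply: f0; apply: nt; exists a.
have [t0 t0E] : exists t0, t0 = f * t by exists (f * t).
have ft0 : f * t0 = t0 by rewrite t0E mulrA ff.
have t0f : t0 * f = t0 by rewrite t0E -mulrA tf.
rewrite -t0E; have [[b]|[b0]] := loc t0; rewrite ft0 t0f.
  by rewrite t0E mulrA => /nM.
move=> b0E; have [b bE0] : exists b, b = f * b0 by exists (f * b0).
have fb : f * b = b by rewrite bE0 mulrA ff.
have bE : b * (f - t0) = f by rewrite bE0 -mulrA b0E ff.
have bB : b * f = f + b * t0 by rewrite -[in RHS]bE mulrBr subrK.
have btE : f * - (b * t0) * f = - (b * t0).
  by rewrite mulrN mulNr mulrA fb -mulrA t0f.
have [[c]|[c]] := loc (- (b * t0)); rewrite btE.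
  by rewrite -mulNr t0E !mulrA => /nM.
rewrite opprK -bB => cE.
have cf : c * f = f - t0.
  have -> : f - t0 = f * (f - t0) by rewrite mulrBr ff ft0.
  rewrite -{2}cE -!mulrA; congr (c * _).
  by rewrite mulrBr ff ft0 bE.
by exists (b * f); rewrite -cf -mulrA [f * _]mulrA fb.
Qed.

(* Nakayama's lemma for a row vector r = r T, T having its entries in the
   radicals, by eliminating one coordinate at a time. *)
Lemma local_radical_elim n (r f : nat -> A) (t : nat -> nat -> A) :
  (forall l, local_idempotent (f l)) -> (forall l, r l * f l = r l) ->
  (forall k l, local_radical (f l) (t k l)) ->
  (forall l, (l < n)%N -> r l = \sum_(k < n) r k * t k l) ->
  forall l, (l < n)%N -> r l = 0.
Proof.
move=> lf rf; elim: n t => // n IHn t Mt rE.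
have [b bE] := local_radical_sub_inv (lf n) (Mt n n).
(* The last equation, solved for [r n]. *)
have rn : r n = \sum_(k < n) r k * (t k n * b).
  have := rE n (ltnSn n); rewrite big_ord_recr /=.
  rewrite -{1 2}rf -mulrA => /eqP; rewrite -subr_eq -mulrBr => /eqP E.
  rewrite -rf -bE mulrA E mulr_suml.
  by apply: eq_bigr => k _; rewrite mulrA.
have r0 l : (l < n)%N -> r l = 0.
  (* Substituting [r n] corrects the remaining entries by the last row and column; they stay in the
     radicals. *)
  apply: (IHn (fun k l => t k l + t k n * b * t n l)) => [k {}l|{}l ln].
    by apply: local_radicalD => //; apply: local_radicalZ.
  rewrite (rE l (ltnW ln)) big_ord_recr /= rn mulr_suml -big_split /=.
  by apply: eq_bigr => k _; rewrite mulrDr !mulrA.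
move=> l; rewrite ltnS leq_eqVlt => /predU1P[->|/r0 //].
by rewrite rn big1 // => k _; rewrite r0 ?mul0r.
Qed.

End Elimination.

(** * The free module on the elements of [P], and dual bases *)

Section FreeModule.
Variables (A : pzRingType) (P : lmodType A).

Definition finsupp_pred : {pred P -> A^o} :=
  fun g => `[< exists s : seq P, forall x, x \notin s -> g x = 0 >].

Record finsupp : predArgType :=
  Finsupp { finsupp_val : P -> A^o; _ : finsupp_val \in finsupp_pred }.

HB.instance Definition _ := [isSub for finsupp_val].
HB.instance Definition _ := [Choice of finsupp by <:].

Fact finsupp_pred_submod : GRing.submod_closed finsupp_pred.
Proof.
split; first by rewrite unfold_in; apply/asboolP; exists [::].
move=> a g h; rewrite !unfold_in => /asboolP[s sg] /asboolP[t th].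
apply/asboolP; exists (s ++ t) => x; rewrite mem_cat negb_or => /andP[xs xt].
by rewrite -[LHS]/(a *: g x + h x) sg // th // scaler0 addr0.
Qed.
HB.instance Definition _ := GRing.isSubmodClosed.Build A (P -> A^o) finsupp_pred
  finsupp_pred_submod.
HB.instance Definition _ := [SubChoice_isSubLmodule of finsupp by <:].

Definition finsupp_coef (x : P) (g : finsupp) : A^o := (\val g : P -> A^o) x.

Fact finsupp_coef_linear x : linear (finsupp_coef x).
Proof. by move=> a g h; rewrite /finsupp_coef linearP. Qed.
HB.instance Definition _ x := GRing.isLinear.Build A finsupp A^o _ (finsupp_coef x)
  (finsupp_coef_linear x).

Lemma finsuppP (g : finsupp) :
  exists s : seq P, uniq s /\ forall x, x \notin s -> finsupp_coef x g = 0.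
Proof.
have := valP g; rewrite unfold_in => /asboolP[s sg]; exists (undup s).
by split=> [|x]; rewrite ?undup_uniq // mem_undup => /sg.
Qed.

Definition finsupp_sum (g : finsupp) : P :=
  \sum_(x <- sval (cid (finsuppP g))) (finsupp_coef x g : A) *: x.

Lemma finsupp_sumE (g : finsupp) (s : seq P) : uniq s ->
  (forall x, x \notin s -> finsupp_coef x g = 0) ->
  finsupp_sum g = \sum_(x <- s) (finsupp_coef x g : A) *: x.
Proof.
rewrite /finsupp_sum; case: cid => t [ut tg] /= us sg.
have E r : \sum_(x <- r) (finsupp_coef x g : A) *: x =
    \sum_(x <- [seq x <- r | finsupp_coef x g != 0]) (finsupp_coef x g : A) *: x.
  rewrite big_filter [RHS]big_mkcond /=; apply: eq_bigr => x _.
  by case: eqP => //= ->; rewrite scale0r.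
rewrite (E t) (E s); apply: perm_big; apply: uniq_perm; rewrite ?filter_uniq // => x.
rewrite !mem_filter; case: eqP => //= gx0.
have -> : x \in t by apply: contraT => /tg.
by apply/esym; apply: contraT => /sg.
Qed.

Fact finsupp_sum_linear : linear finsupp_sum.
Proof.
move=> a g h; have [s [us sg]] := finsuppP g; have [t [ut th]] := finsuppP h.
pose r := undup (s ++ t).
have rP x : x \notin r -> finsupp_coef x g = 0 /\ finsupp_coef x h = 0.
  by rewrite mem_undup mem_cat negb_or => /andP[/sg -> /th ->].
have ur : uniq r by apply: undup_uniq.
rewrite !(@finsupp_sumE _ r) // => [|x /rP[]//|x /rP[]//|x /rP[g0 h0]]; last first.
  by rewrite linearP /= g0 h0 scaler0 addr0.
rewrite scaler_sumr -big_split /=; apply: eq_bigr => x _.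
by rewrite linearP /= scalerDl scalerA.
Qed.
HB.instance Definition _ := GRing.isLinear.Build A finsupp P _ finsupp_sum
  finsupp_sum_linear.

Lemma finsupp_sum_surj y : exists g, finsupp_sum g = y.
Proof.
have py : (fun x : P => if x == y then 1 else 0 : A^o) \in finsupp_pred.
  rewrite unfold_in; apply/asboolP; exists [:: y] => x; rewrite inE.
  by move/negPf ->.
exists (Finsupp py); rewrite (@finsupp_sumE _ [:: y]) // => [|x].
  by rewrite big_seq1 /finsupp_coef /= eqxx scale1r.
by rewrite inE /finsupp_coef /= => /negPf ->.
Qed.

(** The functionals are the coordinates of a section of the surjection from the free module on [P];
    only finitely many are nonzero at [y]. *)
Lemma projective_dual_basis : projective P -> forall y : P, exists s : seq P,
  exists c : P -> {linear P -> A^o}, y = \sum_(x <- s) (c x y : A) *: x.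
Proof.
move=> projP y; have [h hE] := projP finsupp P finsupp_sum idfun finsupp_sum_surj.
have [s [us sy]] := finsuppP (h y).
exists s, (fun x => finsupp_coef x \o h : {linear P -> A^o}).
by rewrite -{1}[y]hE; apply: finsupp_sumE.
Qed.

End FreeModule.
(** If a functional followed by right multiplication by [f i] takes a value outside the radical, it
    is onto [A f i] and splits, and indecomposability identifies [P] with [A f i]. Otherwise the
    coordinates of a nonzero [y0] form a row vector fixed by a matrix with radical entries, and
    elimination makes them all 0. *)
Lemma projective_local_generator (A : pzRingType) (I : finType) (f : I -> A)
    (P : lmodType A) :
  (forall i, local_idempotent (f i)) -> \sum_i f i = 1 ->
  projective P -> indecomposable P ->
  exists i x, [/\ f i <> 0, f i *: x = x, forall y : P, exists a, y = a *: x &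
                  forall a, a *: x = 0 -> a * f i = 0].
Proof.
move=> lf f1 projP [[y0 y0n] indP].
have [s [c y0E]] := projective_dual_basis projP y0.
suff [x [y [i nM]]] : exists x y i, ~ local_radical (f i) ((c x y : A) * f i).
  have [ff _] := lf i.
  have [[a aE] f0] : (exists a, a * ((c x y : A) * f i) = f i) /\ f i <> 0.
    move: nM => /not_andP[|/not_implyP//].
    by rewrite -mulrA ff.
  pose z := (f i * a) *: y.
  have zE : (c x z : A) * f i = f i.
    by rewrite linearZ -[RHS]ff -[X in _ = _ * X]aE !mulrA.
  have fz : f i *: z = z by rewrite /z scalerA mulrA ff.
  have cz b : (c x (b *: z) : A) * f i = b * f i.
    by rewrite linearZ -[LHS]mulrA zE.
  pose U : set P := [set b *: z | b in setT].
  pose W : set P := [set w | (c x w : A) * f i = 0].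
  have sU : submodule U.
    apply/submoduleP; split; first by exists 0; rewrite ?scale0r.
    by move=> b _ _ [b1 _ <-] [b2 _ <-]; exists (b * b1 + b2); rewrite // scalerDl scalerA.
  have sW : submodule W.
    apply/submoduleP; split; first by rewrite /W /= linear0 mul0r.
    move=> b w1 w2 W1 W2; rewrite /W /= linearP mulrDl.
    by rewrite [X in _ + X]W2 addr0 -[LHS]mulrA [X in _ * X]W1 mulr0.
  have UW : submodule_sum U W = setT.
    rewrite predeqE => w; split=> // _; exists (((c x w : A) * f i) *: z).
      by exists ((c x w : A) * f i).
    exists (w - ((c x w : A) * f i) *: z); last by rewrite addrC subrK.
    rewrite /W /= linearB mulrBl [X in _ - X]cz -mulrA ff; exact: subrr.
  have UW0 : U `&` W = [set 0].
    rewrite predeqE => w; split=> [[[b _ <-]]|->]; last by split; exact: submodule0.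
    by rewrite /W /= cz => bf; rewrite -fz scalerA bf scale0r.
  have [U0|W0] := indP U W sU sW UW UW0.
    have z0 : z = 0.
      have Uz : U z by exists 1; rewrite ?scale1r.
      by rewrite U0 in Uz.
    by case: f0; rewrite -zE z0 linear0 mul0r.
  exists i, z; split=> // [y1|b bz]; last by rewrite -cz bz linear0 mul0r.
  have : submodule_sum U W y1 by rewrite UW.
  by case=> _ [b _ <-] [w]; rewrite W0 => -> <-; exists b; rewrite addr0.
apply: contrapT => nM.
have {}nM x y i : local_radical (f i) ((c x y : A) * f i).
  by apply: contrapT => h; apply: nM; exists x, y, i.
have [i0 _|I0] := pickP (fun i : I => true); last first.
  have A0 : 1 = 0 :> A by rewrite -f1 big1 // => i; have := I0 i.
  by apply: y0n; rewrite -[y0]scale1r A0 scale0r.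
(* The elimination is indexed by natural numbers, so the pairs are numbered along [L]. *)
pose L := [seq (x, i) | x <- s, i <- enum I].
pose nL k := nth (y0, i0) L k.
pose r k : A := (c (nL k).1 y0 : A) * f (nL k).2.
pose t k l : A := f (nL k).2 * ((c (nL l).1 (nL k).1 : A) * f (nL l).2).
have fidem i : f i * f i = f i by case: (lf i).
have sumL (F : P -> I -> A) :
    \sum_(k < size L) F (nL k).1 (nL k).2 = \sum_(x <- s) \sum_i F x i.
  rewrite -(big_mkord xpredT (fun k => F (nL k).1 (nL k).2)).
  rewrite -(big_nth (y0, i0) xpredT (fun p => F p.1 p.2)) big_allpairs.
  by apply: eq_bigr => x _; rewrite big_enum.
have r0 l : (l < size L)%N -> r l = 0.
  apply: (@local_radical_elim A _ r (fun k => f (nL k).2) t) => // {l}.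
  - by move=> l; rewrite /r -mulrA fidem.
  - by move=> k l; apply: local_radicalZ.
  move=> l _; pose G x i : A :=
    ((c x y0 : A) * f i) * (f i * ((c (nL l).1 x : A) * f (nL l).2)).
  rewrite [RHS](sumL G) /r {1}y0E linear_sum mulr_suml; apply: eq_bigr => x _.
  rewrite linearZ -[LHS]mulrA -{1}[c _ x * _]mul1r -f1 mulr_suml mulr_sumr.
  by apply: eq_bigr => i _; rewrite /G -mulrA [f i * (f i * _)]mulrA fidem.
apply: y0n; rewrite y0E big_seq big1 // => x xs.
rewrite -[c x y0 : A]mulr1 -f1 mulr_sumr scaler_suml big1 // => i _.
have xiL : (x, i) \in L by apply: allpairs_f => //; rewrite mem_enum.
have := r0 (index (x, i) L); rewrite index_mem /r /nL nth_index //= => -> //.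
by rewrite scale0r.
Qed.

Lemma left_biserial_of_local (A : pzRingType) (I : finType) (f : I -> A) :
  (forall i, local_idempotent (f i)) -> \sum_i f i = 1 ->
  (forall i, f i <> 0 -> biserial_set (local_radical (f i) : set A^o)) ->
  left_biserial A.
Proof.
move=> lf f1 bf P projP indP.
have [i [x [f0 fx gen ann]]] := projective_local_generator lf f1 projP indP.
rewrite /biserial_module -/(biserial_set _) (@generator_radical _ _ x (f i)) //.
apply: biserial_set_image (bf i f0) => a [af _] a0.
by rewrite -af; apply: ann.
Qed.

(** * Corners *)

(** Corners up to isomorphism: [corner_ring e he] embeds in [A] in this way and its converse ring in
    [A^c], so one transfer argument serves both sides. *)
Record corner_embedding (A B : pzRingType) (e : A) (j : B -> A) : Prop :=
  CornerEmbedding {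
    corner_inj : injective j;
    corner_morphB : zmod_morphism j;
    corner_morphM : {morph j : x y / x * y};
    corner_morph1 : j 1 = e;
    corner_surj : forall a, exists b, j b = e * a * e }.

Lemma corner_embedding_op (A B : pzRingType) (e : A) (j : B -> A) :
  corner_embedding e j -> @corner_embedding A^c B^c e j.
Proof.
case=> inj jB jM j1 surj; split; [exact: inj|exact: jB| |exact: j1|move=> a].
  by move=> x y; apply: jM.
by have [b bE] := surj a; exists b; rewrite bE -mulrA.
Qed.

Lemma corner_embedding_val (A : pzRingType) (e : A) (he : e * e = e) :
  @corner_embedding A (corner_ring e he) e val.
Proof.
split; [exact: val_inj|by []|by []|by []|move=> a].
have ae : e * a * e \in corner_pred e by apply/corner_predP; exists a.
by exists (Corner ae).
Qed.

Section CornerTransfer.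
Variables (A B : pzRingType) (e : A) (j : B -> A).
Hypothesis C : corner_embedding e j.

Let jM := corner_morphM C.
Let jB := corner_morphB C.

Lemma corner0 : j 0 = 0.
Proof. by have := jB 0 0; rewrite !subrr. Qed.

Lemma cornerD x y : j (x + y) = j x + j y.
Proof.
have jN z : j (- z) = - j z by rewrite -sub0r jB corner0 sub0r.
by rewrite -[y in LHS]opprK jB jN opprK.
Qed.

Lemma corner_sum (I : finType) (f : I -> B) : j (\sum_i f i) = \sum_i j (f i).
Proof. by apply: (big_morph j cornerD corner0). Qed.

Lemma corner_idl b : e * j b = j b.
Proof. by rewrite -(corner_morph1 C) -jM mul1r. Qed.

Lemma corner_idr b : j b * e = j b.
Proof. by rewrite -(corner_morph1 C) -jM mulr1. Qed.

Lemma corner_localE f : local_idempotent (j f) -> local_idempotent f.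
Proof.
move=> [ff loc]; have ff' : f * f = f by apply: (corner_inj C); rewrite jM.
have inv z b : b * j z = j f -> f * z = z -> exists b', b' * z = f.
  move=> bE fz; have [b' b'E] := corner_surj C (j f * b * j f).
  exists b'; apply: (corner_inj C); rewrite jM b'E !mulrA corner_idl.
  rewrite -[_ * e * _]mulrA corner_idl -mulrA -jM fz -mulrA bE -jM ff' //.
split=> // a; case: (loc (j a)) => -[b]; rewrite -!jM -?jB => /inv h; [left|right].
  by apply: h; rewrite !mulrA ff'.
by apply: h; rewrite mulrBr !mulrA !ff'.
Qed.

Lemma corner_local_radicalE f b : local_radical f b <-> local_radical (j f) (j b).
Proof.
split=> -[bf nb].
  split; first by rewrite -jM [X in j X]bf.
  move=> [a aE]; rewrite nb ?corner0 //.
  have [c cE] := corner_surj C a; exists c; apply: (corner_inj C).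
  by rewrite jM cE -!mulrA corner_idl aE corner_idl.
split; first by apply: (corner_inj C); rewrite jM.
move=> [a aE]; apply: (corner_inj C); rewrite corner0; apply: nb.
by exists (j a); rewrite -jM [X in j X]aE.
Qed.

Lemma corner_submodule (U : set A^o) : submodule U -> submodule (j @^-1` U : set B^o).
Proof.
move=> /submoduleP[U0 UD]; apply/submoduleP; split; first by rewrite /= corner0.
by move=> a x y Ux Uy; rewrite /= cornerD jM; apply: UD.
Qed.

(* The largest submodule of U lying over V. *)
Definition corner_lift (U : set A^o) (V : set B^o) : set A^o :=
  [set x : A^o | U x /\ forall a, exists2 v, V v & j v = e * (a * (x : A))].

Lemma corner_lift_submodule (U : set A^o) (V : set B^o) : submodule U -> submodule V ->
  submodule (corner_lift U V).
Proof.
move=> /submoduleP[U0 UD] /submoduleP[V0 VD]; apply/submoduleP; split.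
  by split=> // a; exists 0 => //; rewrite corner0 !mulr0.
move=> c x y [Ux Vx] [Uy Vy]; split; first exact: UD.
move=> a; have [v1 Vv1 v1E] := Vx (a * c); have [v2 Vv2 v2E] := Vy a.
exists (v1 + v2); first by rewrite -[v1](@scale1r _ B^o); apply: VD.
by rewrite cornerD v1E v2E -!mulrDr -mulrA -mulrDr.
Qed.

(** Pulling back along [j] recovers [V], so [corner_lift U] reflects inclusions; this carries
    uniserial and simple submodules to the corner. *)
Lemma corner_liftE (U : set A^o) (V : set B^o) (b : B) :
  submodule V -> V `<=` (j @^-1` U : set B^o) ->
  corner_lift U V (j b) <-> V b.
Proof.
move=> sV VU; split=> [[_ /(_ 1)[v Vv]]|Vb].
  by rewrite mul1r corner_idl => /(corner_inj C) <-.
split; first exact: VU.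
move=> a; have [c cE] := corner_surj C a; exists (c * b).
  by rewrite -[c * b]/((c : B) *: (b : B^o)); apply: submoduleZ.
by rewrite jM cE -!mulrA corner_idl.
Qed.

Lemma corner_uniserial (U : set A^o) :
  uniserial_submodule U -> uniserial_submodule (j @^-1` U : set B^o).
Proof.
move=> [sU uU]; split; first exact: corner_submodule.
move=> V W sV sW VU WU.
have le (V1 V2 : set B^o) : submodule V1 -> submodule V2 -> V1 `<=` j @^-1` U ->
    V2 `<=` j @^-1` U -> corner_lift U V1 `<=` corner_lift U V2 -> V1 `<=` V2.
  move=> s1 s2 h1 h2 le12 b Vb.
  by apply/(corner_liftE b s2 h2)/le12/(corner_liftE b s1 h1).
have [||||h|h] := uU (corner_lift U V) (corner_lift U W).
- exact: corner_lift_submodule.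
- exact: corner_lift_submodule.
- by move=> x [].
- by move=> x [].
- by left; apply: le h.
by right; apply: le h.
Qed.

Lemma corner_simple (U : set A^o) : simple_submodule U ->
  j @^-1` U = [set 0] \/ simple_submodule (j @^-1` U : set B^o).
Proof.
move=> [sU _ U1]; have [->|nU] := pselect (j @^-1` U = [set 0]); first by left.
right; split=> //; first exact: corner_submodule.
move=> V sV VU; have [||V0|VE] := U1 (corner_lift U V).
- exact: corner_lift_submodule.
- by move=> x [].
- left; rewrite predeqE => b; split=> [/(corner_liftE b sV VU)|->]; last exact: submodule0.
  by rewrite V0 => b0; apply: (corner_inj C); rewrite corner0.
right; rewrite predeqE => b; split=> [/VU//|Ub].
by apply/(corner_liftE b sV VU); rewrite VE.
Qed.

(** Multiplying [j b = x + y] by [e] on the left keeps both summands in their submodules and brings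
    them into [e A e], since they are fixed by [j f] on the right. *)
Lemma corner_biserial_set f : biserial_set (local_radical (j f) : set A^o) ->
  biserial_set (local_radical f : set B^o).
Proof.
move=> [U [V [uU uV XE UV]]]; exists (j @^-1` U), (j @^-1` V).
have [UX VX] := biserial_set_sub uU uV XE; have [[sU _] [sV _]] := (uU, uV).
split; [exact: corner_uniserial|exact: corner_uniserial| |].
  rewrite predeqE => b; split=> [/corner_local_radicalE|].
    rewrite XE => -[x Ux [y Vy xyE]].
    have lift (W : set A^o) z : submodule W -> W `<=` local_radical (j f) -> W z ->
        exists2 z', W (j z') & j z' = e * z.
      move=> sW WX Wz; have [zf _] := WX z Wz.
      have [z' z'E] := corner_surj C z.
      have {}z'E : j z' = e * z by rewrite z'E -zf -!mulrA corner_idr.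
      by exists z' => //; rewrite z'E; apply: (submoduleZ e sW Wz).
    have [x' Ux' x'E] := lift U x sU UX Ux; have [y' Vy' y'E] := lift V y sV VX Vy.
    exists x' => //; exists y' => //; apply: (corner_inj C).
    by rewrite cornerD x'E y'E -mulrDr [x + y]xyE corner_idl.
  move=> [x Ux [y Vy <-]]; apply/corner_local_radicalE; rewrite XE cornerD.
  by exists (j x) => //; exists (j y).
rewrite -preimage_setI; case: UV => [->|/corner_simple//].
left; rewrite predeqE => b; split=> [|->] /=; last exact: corner0.
by move=> b0; apply: (corner_inj C); rewrite corner0.
Qed.

Lemma left_biserial_corner (I : finType) (f : I -> B) :
  left_biserial A -> (forall i, local_idempotent (j (f i))) -> \sum_i f i = 1 ->
  left_biserial B.
Proof.
move=> bA lf f1; apply: (left_biserial_of_local (f := f)) => // [i|i f0].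
  exact: corner_localE.
apply: corner_biserial_set; apply: left_biserial_local_radical => // jf0.
by apply: f0; apply: (corner_inj C); rewrite corner0.
Qed.

End CornerTransfer.

(** * Idempotents of finite-dimensional algebras *)

Section FiniteDimension.
Variables (k : fieldType) (A : pzRingType) (iota : {rmorphism k -> A}).
Hypothesis fdA : fd_algebra iota.

Definition subspace (S : set A) := [/\ S 0, forall x y, S x -> S y -> S (x + y) &
  forall c x, S x -> S (iota c * x)].

(** [d S] is the largest rank of a matrix whose row space is mapped into [S] by the parametrisation
    [phi]. The kernel of [phi] adds the same amount for all subspaces, which does not affect strict
    monotonicity. *)
Lemma fd_dimension : exists d : set A -> nat, forall S T, subspace S -> subspace T ->
  S `<=` T -> forall x, T x -> ~ S x -> (d S < d T)%N.
Proof.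
have [_ [n [b bE]]] := fdA.
pose phi (v : 'rV[k]_n) : A := \sum_(i < n) iota (v ord0 i) * b i.
have phiD v w : phi (v + w) = phi v + phi w.
  by rewrite -big_split; apply: eq_bigr => i _; rewrite mxE rmorphD mulrDl.
have phiZ c v : phi (c *: v) = iota c * phi v.
  by rewrite mulr_sumr; apply: eq_bigr => i _; rewrite mxE rmorphM mulrA.
have phi_surj x : exists v, phi v = x.
  have [c ->] := bE x; exists (\row_i c i).
  by apply: eq_bigr => i _; rewrite mxE.
pose R (S : set A) r := exists2 M : 'M[k]_n,
  (forall v : 'rV_n, (v <= M)%MS -> S (phi v)) & \rank M = r.
pose d S := (\max_(r < n.+1 | `[< R S r >]) r)%N.
have dR S : subspace S -> R S (d S).
  move=> [S0 _ _]; have R0 : `[< R S (ord0 : 'I_n.+1) >].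
    apply/asboolP; exists 0; last by rewrite mxrank0.
    move=> v; rewrite submx0 => /eqP ->; rewrite /phi big1 // => i _.
    by rewrite mxE rmorph0 mul0r.
  rewrite /d; have [|r /asboolP Rr ->//] :=
    @eq_bigmax_cond _ (fun r : 'I_n.+1 => `[< R S r >]) (fun r => r : nat).
  by apply/card_gt0P; exists ord0.
exists d => S T sS sT ST x Tx nSx.
have [M MS rM] := dR S sS; have [v0 v0x] := phi_surj x.
have [T0 TD TZ] := sT.
have v0M : ~~ (v0 <= M)%MS by apply/negP => /MS; rewrite v0x.
pose M' := (M + v0)%MS.
have ltM : (\rank M < \rank M')%N.
  have := ltmxErank M M'; rewrite /ltmx addsmxSl /= => <-.
  by apply: contra v0M; apply: submx_trans; apply: addsmxSr.
have RT : R T (\rank M').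
  exists M' => // v /sub_addsmxP[[u1 u2] /= ->]; rewrite phiD; apply: TD.
    by apply: ST; apply: MS; apply: submxMl.
  by rewrite [u2]mx11_scalar mul_scalar_mx phiZ v0x; apply: TZ.
rewrite -rM; apply: (leq_trans ltM).
have rn : (\rank M' < n.+1)%N by rewrite ltnS rank_leq_row.
apply: (@leq_bigmax_cond _ (fun r : 'I_n.+1 => `[< R T r >]) (fun r => r : nat)
  (Ordinal rn)).
exact/asboolP.
Qed.

(** From an index [r0] of minimal dimension on, the chain is constant; the comparison with [r + r]
    is the one Fitting's argument needs. *)
Lemma pi_regular_chain (I : nat -> set A) : (forall r, subspace (I r)) ->
  (forall r s, (r <= s)%N -> I s `<=` I r) ->
  exists r0, forall r, (r0 <= r)%N -> I r `<=` I (r + r)%N.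
Proof.
move=> sI decI; have [d dP] := fd_dimension.
have : exists m, `[< exists r, d (I r) = m >] by exists (d (I 0%N)); apply/asboolP; exists 0%N.
move=> /ex_minnP[m /asboolP[r0 dr0] min]; exists r0 => r r0r x Ix.
apply: contrapT => nIx.
have lt1 := dP _ _ (sI (r + r)%N) (sI r) (decI _ _ (leq_addr r r)) x Ix nIx.
have : (m <= d (I (r + r)%N))%N by apply: min; apply/asboolP; exists (r + r)%N.
rewrite leqNgt => /negP; apply; apply: (leq_trans lt1); rewrite -dr0.
case: (pselect (exists y, I r0 y /\ ~ I r y)) => [[y [Iy nIy]]|nlt].
  exact: ltnW (dP _ _ (sI r) (sI r0) (decI _ _ r0r) y Iy nIy).
suff -> : I r = I r0 by [].
rewrite predeqE => y; split=> [|Iy]; first exact: decI.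
by apply: contrapT => nIy; apply: nlt; exists y.
Qed.

Lemma strongly_pi_regular (a : A) : exists n y z,
  a ^+ n.+1 = a ^+ n.+1 * a ^+ n.+1 * y /\ a ^+ n.+1 = z * (a ^+ n.+1 * a ^+ n.+1).
Proof.
have [cent _] := fdA.
have [||r1 R1] := @pi_regular_chain (fun r => [set x | exists y, x = a ^+ r * y]).
- move=> r; split=> [|_ _ [x ->] [y ->]|c _ [x ->]].
  + by exists 0; rewrite mulr0.
  + by exists (x + y); rewrite mulrDr.
  + by exists (iota c * x); rewrite !mulrA cent.
- move=> r s rs _ [x ->]; exists (a ^+ (s - r) * x).
  by rewrite mulrA -exprD subnKC.
have [||r2 R2] := @pi_regular_chain (fun r => [set x | exists y, x = y * a ^+ r]).
- move=> r; split=> [|_ _ [x ->] [y ->]|c _ [x ->]].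
  + by exists 0; rewrite mul0r.
  + by exists (x + y); rewrite mulrDl.
  + by exists (iota c * x); rewrite !mulrA.
- move=> r s rs _ [x ->]; exists (x * a ^+ (s - r)).
  by rewrite -mulrA -exprD subnK.
pose n := maxn r1 r2; exists n.
have [|y yE] := R1 n.+1 (leqW (leq_maxl _ _)) (a ^+ n.+1).
  by exists 1; rewrite mulr1.
have [|z zE] := R2 n.+1 (leqW (leq_maxr _ _)) (a ^+ n.+1).
  by exists 1; rewrite mul1r.
by exists y, z; rewrite -exprD.
Qed.

(** Fitting's argument: for a high power [t] of [x = f a f], [z t = t y] is an idempotent below [f].
    If it is [f], then [x] is invertible in [f A f]; if it is 0, then [x] is nilpotent and [f - x]
    is invertible. Inverses on both sides are kept so that [f] is local in [A^c] as well. *)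
Lemma primitive_local (f : A) : f * f = f ->
  (forall g, g * g = g -> f * g = g -> g * f = g -> g = 0 \/ g = f) ->
  local_idempotent f /\ @local_idempotent A^c f.
Proof.
move=> ff prim.
have H a : (exists b c, b * (f * a * f) = f /\ (f * a * f) * c = f) \/
           (exists b c, b * (f - f * a * f) = f /\ (f - f * a * f) * c = f).
  set x := f * a * f.
  have fx : f * x = x by rewrite /x !mulrA ff.
  have xf : x * f = x by rewrite /x -!mulrA ff.
  have [n [y [z [tE1 tE2]]]] := strongly_pi_regular x; set t := x ^+ n.+1 in tE1 tE2.
  have ft : f * t = t by rewrite /t exprS mulrA fx.
  have tf : t * f = t by rewrite /t exprSr -mulrA xf.
  have gE : z * t = t * y by rewrite {1}tE1 !mulrA -[z * t * t]mulrA -tE2.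
  have [|||g0|gf] := prim (z * t).
  - by rewrite {2}gE -!mulrA [t * (t * y)]mulrA -tE1.
  - by rewrite gE mulrA ft.
  - by rewrite -mulrA tf.
  - right; have t0 : t = 0 by rewrite tE1 -mulrA -gE g0 mulr0.
    have [q [q1 q2 _]] := nilpotent_sub1_unit t0.
    have fxE : f - x = (1 - x) * f by rewrite mulrBl mul1r xf.
    have fxE' : f - x = f * (1 - x) by rewrite mulrBr mulr1 fx.
    exists q, q; split; first by rewrite fxE mulrA q2 mul1r.
    by rewrite fxE' -mulrA q1 mulr1.
  left; exists (z * x ^+ n), (x ^+ n * y); split.
    by rewrite -mulrA -exprSr.
  by rewrite mulrA -exprS -gE.
split; split=> // a.
  by case: (H a) => -[b [c [bE cE]]]; [left|right]; exists b.
have E : (f : A^c) * a * f = (f * a * f : A) := mulrA (f : A) (a : A) (f : A).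
by rewrite E; case: (H a) => -[b [c [bE cE]]]; [left|right]; exists c.
Qed.

(** An [e] that is not primitive splits as [g + (e - g)], and [g A], [(e - g) A] are strictly
    smaller than [e A]: induction on dimension. *)
Lemma local_decomposition (e : A) : e * e = e -> exists s : seq A,
  (forall f, f \in s ->
     [/\ local_idempotent f, @local_idempotent A^c f, e * f = f & f * e = f]) /\
  \sum_(f <- s) f = e.
Proof.
have [cent _] := fdA; have [d dP] := fd_dimension.
pose I (f : A) : set A := [set x | exists y, x = f * y].
have sI f : subspace (I f).
  split=> [|_ _ [x ->] [y ->]|c _ [x ->]].
  - by exists 0; rewrite mulr0.
  - by exists (x + y); rewrite mulrDr.
  by exists (iota c * x); rewrite !mulrA cent.
have [m] := ubnP (d (I e)); elim: m e => // m IHm e; rewrite ltnS => de ee.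
have [prim|] := pselect (forall g, g * g = g -> e * g = g -> g * e = g -> g = 0 \/ g = e).
  have [l1 l2] := primitive_local ee prim.
  by exists [:: e]; split=> [f|]; rewrite ?big_seq1 // inE => /eqP ->.
move=> /existsNP[g] /not_implyP[gg] /not_implyP[eg] /not_implyP[ge] /not_orP[g0 gne].
have sub h : h * h = h -> e * h = h -> ~ I h e -> exists s : seq A,
  (forall f, f \in s ->
     [/\ local_idempotent f, @local_idempotent A^c f, h * f = f & f * h = f]) /\
  \sum_(f <- s) f = h.
  move=> hh eh nI; apply: IHm => //; apply: leq_trans de.
  apply: (dP _ _ (sI h) (sI e) _ e _ nI); last by exists e.
  by move=> _ [x ->]; exists (h * x); rewrite mulrA eh.
pose h := e - g.
have [|s [sP sE]] := sub g gg eg.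
  by move=> [x ex]; apply: gne; rewrite -ge ex mulrA gg.
have hh : h * h = h by rewrite /h mulrBr !mulrBl ee eg ge gg subrr subr0.
have eh : e * h = h by rewrite /h mulrBr ee eg.
have he : h * e = h by rewrite /h mulrBl ee ge.
have [|t [tP tE]] := sub h hh eh.
  move=> [x ex]; apply: g0; rewrite -ge ex mulrA /h mulrBr ge gg subrr mul0r //.
exists (s ++ t); split=> [f|]; last by rewrite big_cat sE tE /= /h addrC subrK.
rewrite mem_cat => /orP[/sP|/tP] [l1 l2 h1 h2]; split=> //.
- by rewrite -h1 mulrA eg.
- by rewrite -h2 -mulrA ge.
- by rewrite -h1 mulrA eh.
by rewrite -h2 -mulrA he.
Qed.

End FiniteDimension.

(** * Biserial frames *)

Lemma biserial_corner_decomposition (A B : pzRingType) (e : A) (j : B -> A) (s : seq A) :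
  corner_embedding e j ->
  (forall f, f \in s ->
     [/\ local_idempotent f, @local_idempotent A^c f, e * f = f & f * e = f]) ->
  \sum_(f <- s) f = e -> biserial A -> biserial B.
Proof.
move=> C sP sE [bA bAc].
have fP (i : 'I_(size s)) := sP _ (mem_nth 0 (ltn_ord i)).
have H (i : 'I_(size s)) : exists b, j b = nth 0 s i.
  have [_ _ ef fe] := fP i; have [b bE] := corner_surj C (nth 0 s i).
  by exists b; rewrite bE ef fe.
have [g gE] := boolp.choice H.
have g1 : \sum_i g i = 1.
  apply: (corner_inj C); rewrite (corner_sum C) (corner_morph1 C) -sE (big_nth 0) big_mkord.
  by apply: eq_bigr => i _; rewrite gE.
split.
  by apply: (left_biserial_corner C bA _ g1) => i; rewrite gE; case: (fP i).
apply: (left_biserial_corner (corner_embedding_op C) bAc _ g1) => i.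
by rewrite gE; case: (fP i).
Qed.

Section FrameModules.
Variables (A : pzRingType) (V : finType) (e : V -> A) (J : set A).
Hypothesis F : frame e J.
Implicit Types (i m s t : V) (a b x y z : A).

Lemma frame_local i : local_idempotent (e i).
Proof.
split=> [|a]; first exact: idemM F i.
have [Ja|nJa] := pselect (J (e i * a * e i)); [right|left].
  have [n xn] := nilpotentJ F Ja; have [q [_ q2 _]] := nilpotent_sub1_unit xn.
  exists q; have -> : e i - e i * a * e i = (1 - e i * a * e i) * e i.
    by rewrite mulrBl mul1r -!mulrA (idemM F).
  by rewrite mulrA q2 mul1r.
have [||_ [b [bE _ _]]] := @off_unit _ _ _ _ F i i _ _ _ nJa.
- by rewrite !mulrA (idemM F).
- by rewrite -!mulrA (idemM F).
by exists b.
Qed.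

Lemma frame_local_radical i x : local_radical (e i) x <-> J x /\ x * e i = x.
Proof.
split=> [[xi nx]|[Jx xi]]; split=> //.
  rewrite -xi -[x]mul1r -(frame_sum F) !mulr_suml.
  apply: big_ind => [||t _]; [exact: (J0 F)|exact: (JD F)|].
  have [ti|nti] := eqVneq t i; last exact: (frame_off F).
  apply: contrapT => nJ; have [||_ [b [bE _ _]]] := @off_unit _ _ _ _ F i t _ _ _ nJ.
  - by rewrite !mulrA (idemM F).
  - by rewrite -!mulrA (idemM F).
  apply: nJ; rewrite nx ?mulr0; first exact: (J0 F).
  by exists (b * e t); rewrite -[RHS]bE -!mulrA xi.
move=> [a aE]; have Je : J (e i) by rewrite -aE; apply: (JMl F).
have [n en] := nilpotentJ F Je.
suff en1 r : e i ^+ r.+1 = e i by rewrite -(en1 n) exprS en mulr0.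
by elim: r => [|r IHr]; rewrite ?expr1 // exprS IHr (idemM F).
Qed.

Definition left_ideal_of x : set A^o := [set y | exists a, y = a * x].

Lemma left_ideal_of_submodule x : submodule (left_ideal_of x).
Proof.
apply/submoduleP; split; first by exists 0; rewrite mul0r.
by move=> c _ _ [a ->] [b ->]; exists (c * a + b); rewrite mulrDl -mulrA.
Qed.

Lemma left_ideal_ofP x (U : set A^o) : submodule U -> left_ideal_of x `<=` U <-> U x.
Proof.
move=> sU; split=> [|Ux _ [a ->]]; first by apply; exists 1; rewrite mul1r.
exact: (submoduleZ a sU).
Qed.

(** Without a homogeneous generator, every homogeneous [x] in [U] is [a y] with [a] in [J] and [y]
    homogeneous in [U]. Repetition puts [x] in a vanishing power of [J], so [x = 0], and then 0 is a
    generator after all. *)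
Lemma uniserial_generator (U : set A^o) i :
  uniserial_submodule U -> U `<=` local_radical (e i) ->
  exists p, [/\ exists t, lhomog e J i t p, luniserial p & U = left_ideal_of p].
Proof.
move=> [sU uU] UJ.
have UM a x : U x -> U (a * x) by apply: (submoduleZ a sU).
have cmp x y : U x -> U y -> (exists a, x = a * y) \/ (exists a, y = a * x).
  move=> Ux Uy; have [|||||] := uU (left_ideal_of x) (left_ideal_of y);
    try exact: left_ideal_of_submodule; try exact/left_ideal_ofP.
  - by move=> h; left; apply: (h x); exists 1; rewrite mul1r.
  by move=> h; right; apply: (h y); exists 1; rewrite mul1r.
have [t [p [Up tp gen]]] : exists t p, [/\ U p, e t * p = p &
    forall s y, U y -> e s * y = y -> exists a, y = a * p].
  apply: contrapT => no.
  have step t x : U x -> e t * x = x -> exists s y a,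
      [/\ U y, e s * y = y, J a & x = a * y].
    move=> Ux tx; have [s [y [Uy sy nyx]]] : exists s y,
        [/\ U y, e s * y = y & ~ exists a, y = a * x].
      apply: contrapT => no'; apply: no; exists t, x; split=> // s y Uy sy.
      by apply: contrapT => nyx; apply: no'; exists s, y.
    have [[a xE]|//] := cmp x y Ux Uy.
    exists s, y, (e t * a * e s); split=> //; last by rewrite -!mulrA sy -xE.
    apply: contrapT => nJ; have [||_ [b [bE _ _]]] := @off_unit _ _ _ _ F s t _ _ _ nJ.
    - by rewrite !mulrA (idemM F).
    - by rewrite -!mulrA (idemM F).
    by apply: nyx; exists (b * e t); rewrite -{1}sy -bE -!mulrA sy xE.
  have [n nil] := frame_nil F.
  have chain : forall r t x, U x -> e t * x = x -> exists s : seq A, exists y,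
      [/\ size s = r, forall z, z \in s -> J z & x = (\prod_(z <- s) z) * y].
    elim=> [|r IHr] t x Ux tx; first by exists [::], x; rewrite big_nil mul1r.
    have [s [y [a [Uy sy Ja ->]]]] := step t x Ux tx.
    have [l [z [lr lJ ->]]] := IHr s y Uy sy.
    exists (a :: l), z; split; rewrite /= ?lr ?big_cons ?mulrA // => w.
    by rewrite inE => /predU1P[->|/lJ].
  have x0 t x : U x -> e t * x = x -> x = 0.
    by move=> Ux tx; have [s [y [sn sJ ->]]] := chain n t x Ux tx; rewrite nil ?mul0r.
  apply: no; exists i, 0; split; [exact: (submodule0 sU)|by rewrite mulr0|].
  by move=> s y Uy sy; exists 0; rewrite mulr0; apply: x0 sy.
have UE : U = left_ideal_of p.
  rewrite predeqE => y; split=> [Uy|[a ->]]; last exact: UM.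
  have H s : exists a, e s * y = a * p.
    by apply: (gen s); [apply: UM|rewrite mulrA (idemM F)].
  have [f fE] := boolp.choice H.
  exists (\sum_s f s); rewrite mulr_suml -[LHS]mul1r -(frame_sum F) mulr_suml.
  by apply: eq_bigr => s _; rewrite fE.
have [Jp pi] := (frame_local_radical i p).1 (UJ p Up).
exists p; split=> //; first by exists t.
apply/luniserialP => a b; exact: cmp (UM a _ Up) (UM b _ Up).
Qed.

Lemma left_biserial_lgens i : left_biserial A ->
  exists p p', [/\ lgens e J i p p', luniserial p & luniserial p'].
Proof.
move=> bA; have [ei0|/eqP ei0] := eqVneq (e i) 0.
  exists 0, 0; split; try exact: runiserial0.
  apply/lgensP; split; try by exists i; apply: homog0 (frame_op F) _ _.
  by move=> z Jz; rewrite ei0 mulr0 => <-; exists 0, 0; rewrite mulr0 addr0.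
have [U [W [uU uW XE _]]] := left_biserial_local_radical bA (frame_local i) ei0.
have [UX WX] := biserial_set_sub uU uW XE.
have [p [hp up UE]] := uniserial_generator uU UX.
have [p' [hp' up' WE]] := uniserial_generator uW WX.
exists p, p'; split=> //; apply/lgensP; split=> // z Jz zi.
have : local_radical (e i) z by apply/frame_local_radical.
rewrite XE UE WE => -[_ [a ->] [_ [b ->] <-]].
by exists a, b.
Qed.

Lemma luniserial_left_ideal x : luniserial x -> uniserial_submodule (left_ideal_of x).
Proof.
move=> /luniserialP ux; split; first exact: left_ideal_of_submodule.
move=> U W sU sW Ux Wx.
have [|nUW] := pselect (U `<=` W); [by left|right=> w Ww].
have [y [Uy nWy]] : exists y, U y /\ ~ W y.
  by apply: contrapT => h; apply: nUW => y Uy; apply: contrapT => nWy; apply: h; exists y.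
have [[a yE] [b wE]] := (Ux y Uy, Wx w Ww).
have [[c E]|[c E]] := ux a b.
  by case: nWy; rewrite yE E -wE; apply: (submoduleZ c sW).
by rewrite wE E -yE; apply: (submoduleZ c sU).
Qed.

(** As [J] kills [D], a coefficient between nonzero homogeneous elements of [D] is outside [J],
    hence a unit. Comparability in [A x] then makes any two such elements multiples of each other,
    so a nonzero submodule of [D] is all of [D]. *)
Lemma biserial_set_local_radical i x y :
  lgens e J i x y -> luniserial x -> luniserial y ->
  (forall a b j, a * x = b * y -> J j -> j * (a * x) = 0) ->
  biserial_set (local_radical (e i) : set A^o).
Proof.
move=> /lgensP[[s /lhomogE[Jx xi _]] [t /lhomogE[Jy yi _]] gen] ux uy inter.
exists (left_ideal_of x), (left_ideal_of y); split.
- exact: luniserial_left_ideal.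
- exact: luniserial_left_ideal.
- rewrite predeqE => z; split=> [/frame_local_radical[Jz zi]|].
    have [a [b ->]] := gen z Jz zi.
    by exists (a * x); [exists a|exists (b * y) => //; exists b].
  move=> [_ [a ->] [_ [b ->] <-]]; apply/frame_local_radical; split.
    by apply: (JD F); apply: (JMl F).
  by rewrite mulrDl -!mulrA xi yi.
set D := _ `&` _.
have sD : submodule D by apply: submoduleI; apply: left_ideal_of_submodule.
have [D0|nD] := pselect (D = [set 0]); [by left|right; split=> // W sW WD].
have [W0|nW] := pselect (W = [set 0]); [by left|right].
rewrite predeqE => z; split=> [/WD//|Dz].
have DM a v : D v -> D (a * v) by apply: (submoduleZ a sD).
have WM a v : W v -> W (a * v) by apply: (submoduleZ a sW).
have JD0 j v : J j -> D v -> j * v = 0.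
  by move=> Jj [[a ->] [b vE]]; apply: inter vE Jj.
have [w [Ww w0]] : exists w, W w /\ w <> 0.
  apply: contrapT => h; apply: nW; rewrite predeqE => v.
  split=> [Wv|->]; last exact: submodule0.
  by apply: contrapT => v0; apply: h; exists v.
have [m [Wm m0]] : exists m, W (e m * w) /\ e m * w <> 0.
  apply: contrapT => h; apply: w0; rewrite -[w]mul1r -(frame_sum F) mulr_suml big1 // => m _.
  by apply: contrapT => m0; apply: h; exists m; split=> //; apply: WM.
suff Wn n : W (e n * z).
  rewrite -[z]mul1r -(frame_sum F) mulr_suml; apply: big_ind => // [|u v Wu Wv].
    exact: (submodule0 sW).
  exact: (submoduleD sW).
have Dn := DM (e n) z Dz; have Dm := WD _ Wm.
have en v : D (e n * v) -> e n * v = e n * (e n * v) by rewrite mulrA (idemM F).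
have [[a nE] [b mE]] : (exists a, e n * z = a * x) /\ (exists b, e m * w = b * x).
  by split; [case: Dn|case: Dm].
have unit r q c u v : e r * u = u -> e q * v = v -> D u -> D v -> u = c * v ->
    u = 0 \/ exists c', v = c' * u.
  move=> ru qv Du Dv uE; have [Jc|nJc] := pselect (J (e r * c * e q)).
    by left; rewrite -ru uE -qv -[LHS]/(e r * (c * (e q * v))) !mulrA JD0.
  have [||_ [c' [cE _ _]]] := @off_unit _ _ _ _ F q r _ _ _ nJc.
  - by rewrite !mulrA (idemM F).
  - by rewrite -!mulrA (idemM F).
  right; exists (c' * e r).
  by rewrite uE -{1}qv -cE -!mulrA qv.
have nn : e n * (e n * z) = e n * z by rewrite mulrA (idemM F).
have mm : e m * (e m * w) = e m * w by rewrite mulrA (idemM F).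
move/luniserialP: ux => /(_ a b); rewrite -nE -mE => -[[c cE]|[c cE]].
  by rewrite cE; apply: WM.
have [//|[c' ->]] := unit _ _ _ _ _ mm nn Dm Dn cE.
exact: WM.
Qed.

End FrameModules.

Lemma frame_bisected (A : pzRingType) (V : finType) (e : V -> A) (J : set A) m :
  frame e J -> biserial A -> bisected e J m.
Proof.
move=> F [bA bAc]; have Fc := frame_op F.
have [f fP] := boolp.choice (fun i => left_biserial_lgens F i bA).
have [f' f'P] := boolp.choice fP.
have [g gP] := boolp.choice (fun i => left_biserial_lgens Fc i bAc).
have [g' g'P] := boolp.choice gP.
exact: (bisected_of_uniserial (p := f) (p' := f') (q := g) (q' := g') F).
Qed.

Lemma bisected_left_biserial (A : pzRingType) (V : finType) (e : V -> A) (J : set A) u v :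
  frame e J -> bisection e J u v -> left_biserial A.
Proof.
move=> F B; apply: (left_biserial_of_local (frame_local F) (frame_sum F)) => l _.
have [x [y [Ux Uy gxy ixy]]] := bisection_lgens_u F B l.
have uU z : (exists m i, z = u m i) \/ z = 0 -> luniserial z.
  by case=> [[m [i ->]]|->]; [apply: bisection_luniserial B _ _|apply: runiserial0].
apply: (biserial_set_local_radical F gxy (uU x Ux) (uU y Uy)) => a b j.
exact: (bisection_inter F B Ux Uy gxy ixy).
Qed.

Lemma bisected_biserial (A : pzRingType) (V : finType) (e : V -> A) (J : set A) :
  frame e J -> (forall m, bisected e J m) -> biserial A.
Proof.
move=> F /(bisection_exists F)[u [v B]]; split.
  exact: bisected_left_biserial B.
exact: bisected_left_biserial (frame_op F) (bisection_op B).
Qed.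

Local Close Scope classical_set_scope.

(** * Local criteria *)

(** Over a bound quiver algebra this says that an arrow goes from [m] to [t] ([bound_frame_arrow]);
    stated through [J^2], it makes sense in every frame. *)
Definition frame_arrow (A : pzRingType) (V : finType) (e : V -> A) (J : set A) (m t : V) :=
  exists z, homog e J m t z /\ ~ ideal_pow J 2 z.

Lemma frame_arrow_op (A : pzRingType) (V : finType) (e : V -> A) (J : set A) (m t : V) :
  @frame_arrow A^c V e J m t <-> frame_arrow e J t m.
Proof.
split=> -[z [[Jz h1 h2] nJ]]; exists z; split; try by split.
  by move=> /ideal_pow_op.
by move=> /ideal_pow_op.
Qed.

(** * Corners of frames *)

Section FrameCorner.
Variables (A B : pzRingType) (V : finType) (e : V -> A) (J : set A).
Variables (eps : A) (j : B -> A) (S : {set V}).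
Hypotheses (F : frame e J) (C : corner_embedding eps j).
Hypothesis epsE : eps = \sum_(i in S) e i.

Lemma corner_idem_l i : eps * e i = if i \in S then e i else 0.
Proof.
rewrite epsE mulr_suml; case: ifP => iS.
  rewrite (bigD1 i) //= (idemM F) big1 ?addr0 // => t /andP[_ ti].
  by rewrite (frame_orth F) (negPf ti).
rewrite big1 // => t tS; rewrite (frame_orth F); case: eqP => // ti.
by rewrite ti iS in tS.
Qed.

Lemma corner_idem_r i : e i * eps = if i \in S then e i else 0.
Proof.
rewrite epsE mulr_sumr; case: ifP => iS.
  rewrite (bigD1 i) //= (idemM F) big1 ?addr0 // => t /andP[_ ti].
  by rewrite (frame_orth F) eq_sym (negPf ti).
rewrite big1 // => t tS; rewrite (frame_orth F); case: eqP => // ti.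
by rewrite -ti iS in tS.
Qed.

Lemma frame_corner : exists e' : V -> B,
  (forall i, j (e' i) = if i \in S then e i else 0) /\ frame e' (j @^-1` J)%classic.
Proof.
have H i : exists b, j b = if i \in S then e i else 0.
  have [b bE] := corner_surj C (e i); exists b.
  by rewrite bE corner_idem_l; case: ifP => iS; rewrite ?mul0r ?corner_idem_r ?iS.
have [e' e'E] := boolp.choice H; exists e'; split=> //.
have jM := corner_morphM C; have inj := corner_inj C.
have jB x y : j (x - y) = j x - j y by apply: (corner_morphB C).
have [J0 JD Jl Jr] := frame_ideal F.
split.
- move=> i t; apply: inj; rewrite jM !e'E (fun_if j) e'E (corner0 C).
  have [<-|it] := eqVneq i t; first by case: ifP; rewrite ?mul0r ?(idemM F).
  by case: ifP => _; case: ifP => _; rewrite ?mul0r ?mulr0 // (frame_orth F) (negPf it).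
- apply: inj; rewrite (corner_sum C) (corner_morph1 C) epsE [RHS]big_mkcond.
  by apply: eq_bigr => i _; rewrite e'E.
- split=> [|x y|a x|a x]; rewrite /preimage /=.
  + by rewrite (corner0 C).
  + by rewrite (cornerD C); apply: JD.
  + by rewrite jM; apply: Jl.
  by rewrite jM; apply: Jr.
- have [n nil] := frame_nil F; exists n => s sn sJ; apply: inj; rewrite (corner0 C).
  have [s0|s0] := eqVneq s [::].
    rewrite s0 big_nil (corner_morph1 C) -[eps]mul1r.
    by have := nil [::]; rewrite big_nil => -> //; [rewrite mul0r|rewrite -sn s0].
  (* [j] sends 1 to [eps], hence the last factor. *)
  have -> : j (\prod_(y <- s) y) = \prod_(y <- map j s) y * eps.
    elim: s {sn sJ s0} => [|x s IHs].
      by rewrite !big_nil mul1r (corner_morph1 C).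
    by rewrite /= !big_cons jM IHs mulrA.
  rewrite nil ?mul0r ?size_map // => _ /mapP[y ys ->]; exact: sJ.
- move=> i t a it; rewrite /preimage /= !jM !e'E.
  case: ifP => _; case: ifP => _; rewrite ?mul0r ?mulr0 //.
  exact: (frame_off F).
move=> i b; have [c [cc cu Jc]] := frame_diag F i (j b).
have [c' c'E] := corner_surj C c; exists c'.
have ee : eps * eps = eps by have := corner_idl C 1; rewrite (corner_morph1 C).
have jcE : j c' = c * eps by rewrite c'E -cc -mulrA ee.
have jc' x : j (c' * x) = c * j x by rewrite jM jcE -mulrA (corner_idl C).
split.
- by move=> x; apply: inj; rewrite jc' jM jcE mulrA -cc -mulrA (corner_idr C).
- case: cu => [c0|[d dc]]; [left|right].
    by apply: inj; rewrite jcE c0 mul0r (corner0 C).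
  have [d' d'E] := corner_surj C d; exists d'; apply: inj.
  rewrite jM d'E jcE (corner_morph1 C) -mulrA [eps * (c * _)]mulrA -cc -!mulrA ee.
  by rewrite [d * _]mulrA dc mul1r ee.
rewrite /preimage /= jB jc' !jM e'E; case: ifP => _ //.
by rewrite !mulr0 subrr.
Qed.

Variable e' : V -> B.
Hypothesis e'E : forall i, j (e' i) = if i \in S then e i else 0.
Local Notation J' := (j @^-1` J)%classic.

Lemma homog_corner m s x : homog e' J' m s x -> homog e J m s (j x).
Proof.
have jM := corner_morphM C; case=> Jx mx xs; split=> //.
  have : (if m \in S then e m else 0) * j x = j x by rewrite -e'E -jM mx.
  by case: ifP => // _ <-; rewrite mul0r mulr0.
have : j x * (if s \in S then e s else 0) = j x by rewrite -e'E -jM xs.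
by case: ifP => // _ <-; rewrite mulr0 mul0r.
Qed.

Lemma rgens_corner_lift m x y z : m \in S -> rgens e' J' m x y ->
  J z -> e m * z = z -> exists g h, z * eps = j x * g + j y * h.
Proof.
move=> mS [_ _ gen] Jz mz; have jM := corner_morphM C.
have [b bE] := corner_surj C z.
have jb : j b = z * eps by rewrite bE -{1}mz mulrA corner_idem_l mS mz.
have [||g [h bgh]] := gen b.
- by rewrite /preimage /= jb; apply: (JMr F).
- by apply: (corner_inj C); rewrite jM e'E mS jb mulrA mz.
by exists (j g), (j h); rewrite -jb bgh (cornerD C) !jM.
Qed.

(** The corner produces [z * eps]. The rest of [z] ends outside [S], where no arrow from [m] ends,
    so it lies in [J^2] and Nakayama's lemma disposes of it. *)
Lemma rgens_corner m x y : m \in S -> (forall t, t \notin S -> ~ frame_arrow e J m t) ->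
  rgens e' J' m x y -> rgens e J m (j x) (j y).
Proof.
move=> mS nar gxy; have [[s hx] [t hy] _] := gxy.
apply: (rgens_nakayama F).
- by exists s; apply: homog_corner.
- by exists t; apply: homog_corner.
move=> z Jz mz; have [g [h E]] := rgens_corner_lift mS gxy Jz mz; exists g, h.
have -> : z - (j x * g + j y * h) = \sum_(i in ~: S) z * e i.
  rewrite -E epsE mulr_sumr {1}(sum_idemr F z) (bigID (mem S)) /= addrAC subrr add0r.
  by apply: eq_bigl => i; rewrite inE.
apply: big_ind => [|a b|i]; [exact: ideal_pow0|exact: ideal_powD|].
rewrite inE => iS; apply: contrapT => nJ; apply: (nar i iS); exists (z * e i).
by split=> //; split; [exact: (JMr F)|rewrite mulrA mz|rewrite -mulrA (idemM F)].
Qed.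

(** In terms of [j x] and [j y], an element outside [J^2] ending at [t] needs a coefficient outside
    [J], which only a generator that itself ends at [t] can have. *)
Lemma frame_arrow_corner m t x y : m \in S -> t \in S -> rgens e' J' m x y ->
  frame_arrow e J m t ->
  (homog e J m t (j x) /\ ~ ideal_pow J 2 (j x)) \/
  (homog e J m t (j y) /\ ~ ideal_pow J 2 (j y)).
Proof.
move=> mS tS gxy [z [[Jz mz zt] nJz]]; have [[s hx] [r hy] _] := gxy.
have [g [h E]] := rgens_corner_lift mS gxy Jz mz.
have {}E : z = j x * g * e t + j y * h * e t.
  by rewrite -mulrDl -E -mulrA corner_idem_l tS zt.
have main w i c : homog e J m i w -> ideal_pow J 2 (w * c * e t) \/
    homog e J m t w /\ ~ ideal_pow J 2 w.
  move=> hw; have [Jw _ wi] := hw.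
  have [it|nit] := eqVneq i t; last first.
    by left; rewrite -wi -!mulrA; apply: J2M => //; rewrite mulrA; apply: (frame_off F).
  have [J2w|nJ2w] := pselect (ideal_pow J 2 w); last by right; rewrite -it.
  by left; do 2!apply: (ideal_powMr F).
case: (main _ _ g (homog_corner hx)) => [J1|]; last by left.
case: (main _ _ h (homog_corner hy)) => [J2|]; last by right.
by case: nJz; rewrite E; apply: ideal_powD.
Qed.

End FrameCorner.
Lemma corner_bisected (A B : pzRingType) (V : finType) (e : V -> A) (J : set A)
    (eps : A) (j : B -> A) (S : {set V}) m :
  frame e J -> corner_embedding eps j -> eps = \sum_(i in S) e i -> biserial B ->
  m \in S -> (forall t, t \notin S -> ~ frame_arrow e J m t /\ ~ frame_arrow e J t m) ->
  bisected e J m.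
Proof.
move=> F C epsE bB mS nar; have [e' [e'E F']] := frame_corner F C epsE.
have [u1 [u2 [v1 [v2 [gu gv uv1 uv2]]]]] := frame_bisected m F' bB.
exists (j u1), (j u2), (j v1), (j v2); split.
- by apply: (rgens_corner F C epsE e'E mS _ gu) => t /nar[].
- apply: (rgens_corner (frame_op F) (corner_embedding_op C) epsE e'E mS _ gv) => t.
  by move=> /nar[_ na] /frame_arrow_op.
- by rewrite -(corner_morphM C) uv1 (corner0 C).
by rewrite -(corner_morphM C) uv2 (corner0 C).
Qed.

(** Elements with different ends are not multiples of one another modulo [J^2], since coefficients
    between distinct vertices lie in [J]; so both can be exchanged into the given pair. *)
Lemma rgens_distinct (A : pzRingType) (V : finType) (e : V -> A) (J : set A)
    m s t a b x y : frame e J -> rgens e J m a b -> s != t ->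
  homog e J m s x -> homog e J m t y -> ~ ideal_pow J 2 x -> ~ ideal_pow J 2 y ->
  rgens e J m x y.
Proof.
move=> F gab st hx hy nx ny.
have [c gxc] : exists c, rgens e J m x c.
  by have [g|g] := rgens_exchange F gab hx nx; [exists b|exists a].
apply: rgensC; apply: (rgens_exchange2 F (rgensC gxc) hy) => h J2h; apply: ny.
have [[_ _ yt] [Jx _ xs]] := (hy, hx).
rewrite -yt -[y](subrK (x * h)) mulrDl; apply: ideal_powD.
  exact: (ideal_powMr F).
by rewrite -xs -!mulrA; apply: J2M => //; rewrite mulrA; apply: (frame_off F).
Qed.

Section StarData.
Variables (A : pzRingType) (V : finType) (e : V -> A) (J : set A) (m : V).
Hypothesis F : frame e J.
Local Notation J2 := (ideal_pow J 2).

(* What [bisected] at m in the corner of A at m and S says about A itself; the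
   last two clauses need S to contain the end, resp. the start, of every arrow at m. *)
Definition star_data (S : {set V}) := exists u v : bool -> A, [/\
  forall t, t \in m |: S -> frame_arrow e J m t ->
    exists i, homog e J m t (u i) /\ ~ J2 (u i),
  forall t, t \in m |: S -> frame_arrow e J t m ->
    exists i, lhomog e J m t (v i) /\ ~ J2 (v i),
  forall i, v i * u i = 0,
  (forall t, t \notin m |: S -> ~ frame_arrow e J m t) -> rgens e J m (u true) (u false) &
  (forall t, t \notin m |: S -> ~ frame_arrow e J t m) -> lgens e J m (v true) (v false)].

Lemma star_data_corner (B : pzRingType) (eps : A) (j : B -> A) (S : {set V}) :
  corner_embedding eps j -> eps = \sum_(i in m |: S) e i -> biserial B -> star_data S.
Proof.
move=> C epsE bB; have [e' [e'E F']] := frame_corner F C epsE.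
have [u1 [u2 [v1 [v2 [gu gv uv1 uv2]]]]] := frame_bisected m F' bB.
have mS : m \in m |: S by rewrite setU11.
exists (fun i : bool => if i then j u1 else j u2),
       (fun i : bool => if i then j v1 else j v2); split.
- move=> t tS ar; have [h|h] := frame_arrow_corner F C epsE e'E mS tS gu ar.
    by exists true.
  by exists false.
- move=> t tS /frame_arrow_op ar.
  have [[h1 h2]|[h1 h2]] :=
    frame_arrow_corner (frame_op F) (corner_embedding_op C) epsE e'E mS tS gv ar.
    by exists true; split=> // /ideal_pow_op.
  by exists false; split=> // /ideal_pow_op.
- by case; rewrite -(corner_morphM C) ?uv1 ?uv2 (corner0 C).
- by move=> na; apply: (rgens_corner F C epsE e'E mS na gu).
move=> na; apply: (rgens_corner (frame_op F) (corner_embedding_op C) epsE e'E mS _ gv) => t tS.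
by move=> /frame_arrow_op; apply: na.
Qed.

End StarData.

Lemma star_data_op (A : pzRingType) (V : finType) (e : V -> A) (J : set A) m S :
  star_data e J m S -> @star_data A^c V e J m S.
Proof.
move=> [u [v [hu hv uv gu gv]]]; exists v, u; split.
- move=> t tS /frame_arrow_op ar; have [i [h1 h2]] := hv t tS ar.
  by exists i; split=> // /ideal_pow_op.
- move=> t tS /frame_arrow_op ar; have [i [h1 h2]] := hu t tS ar.
  by exists i; split=> // /ideal_pow_op.
- exact: uv.
- by move=> na; apply: gv => t /na nt /frame_arrow_op.
by move=> na; apply: gu => t /na nt /frame_arrow_op.
Qed.

Lemma subset_card (T : finType) (X N : {set T}) k :
  X \subset N -> (#|X| <= k)%N -> (k <= #|N|)%N -> exists S : {set T},
  [/\ X \subset S, S \subset N & #|S| = k].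
Proof.
move=> XN; move: {2}(k - #|X|)%N (leqnn (k - #|X|)) => d.
elim: d X XN => [|d IHd] X XN kX Xk kN.
  by exists X; split=> //; apply/eqP; rewrite eqn_leq Xk -subn_eq0 -leqn0 kX.
have [<-|Xnk] := eqVneq #|X| k; first by exists X.
have ltXk : (#|X| < k)%N by rewrite ltn_neqAle Xnk.
have /fintype.properP[_ [x xN xX]] : X \proper N by rewrite properEcard XN (leq_trans ltXk).
have cX : #|x |: X| = #|X|.+1 by rewrite cardsU1 xX.
have [|||//|S [XS SN SE]] := IHd (x |: X).
- by rewrite finset.subUset finset.sub1set xN.
- by rewrite cX subnS -ltnS (leq_trans _ kX) // prednK // subn_gt0.
- by rewrite cX.
by exists S; split=> //; apply: fintype.subset_trans XS; apply: finset.subsetU1.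
Qed.

(** * At least four neighbours, seen three at a time *)

Section ThreeNeighbours.
Variables (A : pzRingType) (V : finType) (e : V -> A) (J : set A) (m : V).
Hypothesis F : frame e J.
Local Notation J2 := (ideal_pow J 2).
Variable N : {set V}.
Hypothesis N4 : (4 <= #|N|)%N.
Hypothesis data : forall S : {set V}, S \subset N -> #|S| = 3%N -> star_data e J m S.

Lemma homog_target t t' u : homog e J m t u -> homog e J m t' u -> ~ J2 u -> t = t'.
Proof.
move=> [_ _ ut] [_ _ ut'] nJ; apply: contrapT => /eqP tt'; apply: nJ.
rewrite -ut' -ut -mulrA (frame_orth F) (negPf tt') mulr0; exact: ideal_pow0.
Qed.

(** Three targets would fit into one set [S], whose star data would need three elements [u i] with
    distinct ends. *)
Lemma card_targets (X : {set V}) : X \subset N ->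
  (forall t, t \in X -> frame_arrow e J m t) -> (#|X| <= 2)%N.
Proof.
move=> XN arX; rewrite leqNgt; apply/negP => X3.
have [|S [_ SX S3]] := subset_card (finset.sub0set X) _ X3; first by rewrite cards0.
have [u [v [hu _ _ _ _]]] := data (fintype.subset_trans SX XN) S3.
have H (t : V) : exists i : bool, t \in S -> homog e J m t (u i) /\ ~ J2 (u i).
  have [tS|tS] := boolP (t \in S); last by exists true.
  have [||i hi] := hu t; last by exists i.
    by rewrite inE tS orbT.
  by apply: arX; apply: (fintype.subsetP SX).
have [f fP] := boolp.choice H.
have inj : {in S &, injective f}.
  move=> s t sS tS fst; have [hs nJ] := fP s sS; have [ht _] := fP t tS.
  by rewrite -fst in ht; apply: homog_target hs ht nJ.
have := card_in_imset inj; rewrite S3 => E.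
by have := max_card (mem [set f x | x in S]); rewrite E card_bool.
Qed.

(** Choose [S] of size three containing [x] and [Y]. The two vertices of [Y] use up both [v true]
    and [v false], so the [v i] that kills the [u i] ending at [x] lies outside [J^2]. *)
Lemma arrow_pair (Y : {set V}) x : x \in N -> Y \subset N -> #|Y| = 2%N ->
  frame_arrow e J m x -> (forall t, t \in Y -> frame_arrow e J t m) ->
  exists u v y, [/\ homog e J m x u, ~ J2 u, lhomog e J m y v, ~ J2 v & v * u = 0].
Proof.
move=> xN YN Y2 arx arY.
have [|||S [xYS SN S3]] := @subset_card V (x |: Y) N 3.
- by rewrite finset.subUset finset.sub1set xN.
- by rewrite cardsU1 Y2; case: (_ \notin _).
- exact: ltnW.
have [xS YS] : x \in S /\ Y \subset S.
  by move: xYS; rewrite finset.subUset finset.sub1set => /andP[].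
have [u [v [hu hv uv _ _]]] := data SN S3.
have [||i [hi ni]] := hu x; [by rewrite inE xS orbT|by []|].
have H (t : V) : exists k : bool, t \in Y -> lhomog e J m t (v k) /\ ~ J2 (v k).
  have [tY|tY] := boolP (t \in Y); last by exists true.
  have [||k hk] := hv t; [by rewrite inE (fintype.subsetP YS) ?orbT|exact: arY|by exists k].
have [f fP] := boolp.choice H.
have inj : {in Y &, injective f}.
  move=> s t sY tY fst; have [[_ _ sv] nJ] := fP s sY; have [[_ _ tv] _] := fP t tY.
  rewrite -fst in tv; apply: contrapT => /eqP st; apply: nJ.
  rewrite -sv -tv -[_ * _]/(e s * (e t * v (f s)) : A) mulrA (frame_orth F) (negPf st) mul0r.
  exact: ideal_pow0.
have fY : f @: Y = [set: bool].
  by apply/eqP; rewrite eqEcard finset.subsetT cardsT card_bool card_in_imset // Y2.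
have /imsetP[y yY iE] : i \in f @: Y by rewrite fY inE.
have [hv' nv'] := fP y yY.
by exists (u i), (v i), y; rewrite iE; split=> //; rewrite -iE.
Qed.

End ThreeNeighbours.

(** Each of the four elements has a partner outside [J^2] that annihilates it, but two partners may
    have the same end; [bisected_matching] makes the choice consistent. *)
Lemma D4_bisected (A : pzRingType) (V : finType) (e : V -> A) (J : set A) m (N : {set V}) :
  frame e J ->
  (forall t, t \in N <-> t <> m /\ (frame_arrow e J m t \/ frame_arrow e J t m)) ->
  (4 <= #|N|)%N ->
  (forall S : {set V}, S \subset N -> #|S| = 3%N -> star_data e J m S) ->
  bisected e J m.
Proof.
move=> F NP N4 data; have Fc := frame_op F.
have datac (S : {set V}) : S \subset N -> #|S| = 3%N -> @star_data A^c V e J m S.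
  by move=> SN S3; apply/star_data_op/data.
pose X := [set t in N | `[< frame_arrow e J m t >]].
pose Y := [set t in N | `[< frame_arrow e J t m >]].
have XN : X \subset N by apply/fintype.subsetP => t; rewrite inE => /andP[].
have YN : Y \subset N by apply/fintype.subsetP => t; rewrite inE => /andP[].
have arX t : t \in X -> frame_arrow e J m t by rewrite inE => /andP[_ /asboolP].
have arY t : t \in Y -> frame_arrow e J t m by rewrite inE => /andP[_ /asboolP].
have arYc t : t \in Y -> @frame_arrow A^c V e J m t by move=> /arY/frame_arrow_op.
have arXc t : t \in X -> @frame_arrow A^c V e J t m by move=> /arX ?; apply/frame_arrow_op.
have X2 := card_targets F data XN arX.
have Y2 := card_targets Fc datac YN arYc.
have NXY : N \subset X :|: Y.
  apply/fintype.subsetP => t tN; rewrite !inE tN /=; have /NP[_ [ar|ar]] := tN.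
    by apply/orP; left; apply/asboolP.
  by apply/orP; right; apply/asboolP.
(* At most two targets and at most two sources cover at least four neighbours, so both bounds are
   attained. *)
have le4 : (4 <= #|X| + #|Y|)%N.
  apply: (leq_trans N4); apply: (leq_trans (subset_leq_card NXY)).
  by rewrite cardsU leq_subr.
have cX : #|X| = 2%N.
  by apply/eqP; rewrite eqn_leq X2 -(leq_add2r #|Y|) (leq_trans _ le4) // (leq_add2l 2 _ 2).
have cY : #|Y| = 2%N.
  by apply/eqP; rewrite eqn_leq Y2 -(leq_add2l #|X|) (leq_trans _ le4) // cX.
have /cards2P[x1 [x2 [x12 XE]]] : #|X| == 2%N by rewrite cX.
have /cards2P[y1 [y2 [y12 YE]]] : #|Y| == 2%N by rewrite cY.
have [x1X x2X y1Y y2Y] : [/\ x1 \in X, x2 \in X, y1 \in Y & y2 \in Y].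
  by rewrite XE YE !inE !eqxx !orbT.
have pairX x : x \in X -> _ := fun xX =>
  arrow_pair F N4 data (fintype.subsetP XN x xX) YN cY (arX x xX) arY.
have pairY y : y \in Y -> exists u v x,
    [/\ lhomog e J m y v, ~ ideal_pow J 2 v, homog e J m x u, ~ ideal_pow J 2 u & v * u = 0].
  move=> yY; have [v [u [x [hv nv hu nu vu]]]] :=
    arrow_pair Fc N4 datac (fintype.subsetP YN y yY) XN cX (arYc y yY) arXc.
  by exists u, v, x; split=> // h; [apply: nv|apply: nu]; apply/ideal_pow_op.
have [u1 [v1 [s1 [hu1 nu1 hv1 nv1 vu1]]]] := pairX x1 x1X.
have [u2 [v2 [s2 [hu2 nu2 hv2 nv2 vu2]]]] := pairX x2 x2X.
have [w1 [q1 [t1 [hq1 nq1 hw1 nw1 qw1]]]] := pairY y1 y1Y.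
have [w2 [q2 [t2 [hq2 nq2 hw2 nw2 qw2]]]] := pairY y2 y2Y.
(* A set [S] containing all targets sees every arrow out of [m], loops included since [m] belongs to
   the star; its corner gives a generating pair. *)
have rg : exists a b, rgens e J m a b.
  have [|S [XS SN S3]] := subset_card XN _ (ltnW N4); first by rewrite cX.
  have [u [v [_ _ _ gu _]]] := data S SN S3.
  exists (u true), (u false); apply: gu => t tS ar; move: tS; rewrite inE negb_or inE.
  move=> /andP[/eqP tm /negP]; apply; apply: (fintype.subsetP XS); rewrite inE.
  by apply/andP; split; [apply/NP; split=> //; left|apply/asboolP].
have lg : exists a b, lgens e J m a b.
  have [|S [YS SN S3]] := subset_card YN _ (ltnW N4); first by rewrite cY.
  have [u [v [_ _ _ _ gv]]] := data S SN S3.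
  exists (v true), (v false); apply: gv => t tS ar; move: tS; rewrite inE negb_or inE.
  move=> /andP[/eqP tm /negP]; apply; apply: (fintype.subsetP YS); rewrite inE.
  by apply/andP; split; [apply/NP; split=> //; right|apply/asboolP].
have [a [b gab]] := rg; have [c [d gcd]] := lg.
have gu := rgens_distinct F gab x12 hu1 hu2 nu1 nu2.
have gq : lgens e J m q1 q2.
  by apply: (rgens_distinct Fc gcd y12 hq1 hq2) => /ideal_pow_op.
exact: (bisected_matching F gu hv1 hv2 nv1 nv2 vu1 vu2 gq hw1 hw2 nw1 nw2 qw1 qw2).
Qed.

(** * Bound quiver algebras *)

Section IdealGen.
Local Open Scope classical_set_scope.
Variable R : pzRingType.
Implicit Types (I K S : set R).

Lemma ideal_gen_ideal S : two_sided_ideal (ideal_gen S).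
Proof.
split=> [I [[]//]|x y Sx Sy I [hI SI]|a x Sx I [hI SI]|a x Sx I [hI SI]];
  have [_ ID Il Ir] := hI.
- by apply: ID; [apply: Sx|apply: Sy].
- by apply: Il; apply: Sx.
by apply: Ir; apply: Sx.
Qed.

Lemma sub_ideal_gen S : S `<=` ideal_gen S.
Proof. by move=> x Sx I [_]; apply. Qed.

Lemma ideal_gen_sub S K : two_sided_ideal K -> S `<=` K -> ideal_gen S `<=` K.
Proof. by move=> hK SK x; apply. Qed.

End IdealGen.

(** * The arrow ideal, tested on coefficients *)

Section PathAlgebraIdeals.
Variables (k : fieldType) (Q : quiver).
Local Notation kQ := (path_algebra k Q).
Local Notation elt := (path_elt k).
Implicit Types (f g : kQ) (p q r : qpath Q) (x y i j : vertex Q) (a : arrow Q).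

Lemma kQ_scale_mull (c : k) f g : (c *: f) * g = c *: (f * g).
Proof. exact: kQ_mulZl. Qed.

Lemma kQ_scale_mulr (c : k) f g : f * (c *: g) = c *: (f * g).
Proof. exact: kQ_mulZr. Qed.

Lemma path_coef_mul p q r : path_coef r (elt p * elt q) = (path_comp p q == Some r)%:R.
Proof.
rewrite path_eltM /path_mul; case: path_comp => [t|]; last by rewrite path_coef0.
by rewrite path_coef_elt eq_sym.
Qed.

Lemma path_comp_eq p q r : (path_comp p q == Some r) =
  [&& path_target p == path_source q, path_source r == path_source p &
      path_arrows r == path_arrows p ++ path_arrows q].
Proof.
have [pq|npq] := eqVneq (path_target p) (path_source q); last by rewrite path_compN.
have [s -> sE] := path_compE pq.
rewrite (inj_eq Some_inj) -val_eqE sE /path_source /path_arrows.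
by case: (val r) => u v /=; rewrite eq_sym xpair_eqE.
Qed.

Lemma qpath_eq p q : (p == q) =
  (path_source p == path_source q) && (path_arrows p == path_arrows q).
Proof. by rewrite -val_eqE /path_source /path_arrows; case: (val p); case: (val q). Qed.

Lemma path_source_trivial x : path_source (trivial_path x) = x. Proof. by []. Qed.
Lemma path_arrows_trivial x : path_arrows (trivial_path x) = [::]. Proof. by []. Qed.
Lemma path_source_arrow a : path_source (arrow_path a) = source a. Proof. by []. Qed.
Lemma path_arrows_arrow a : path_arrows (arrow_path a) = [:: a]. Proof. by []. Qed.

Lemma kQ_bilinear_ind (P : kQ -> kQ -> Prop) :
  (forall g, P 0 g) -> (forall f, P f 0) ->
  (forall f f' g, P f g -> P f' g -> P (f + f') g) ->
  (forall f g g', P f g -> P f g' -> P f (g + g')) ->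
  (forall c d p q, P (c *: elt p) (d *: elt q)) -> forall f g, P f g.
Proof.
move=> P0l P0r PDl PDr Pelt f g.
elim/kQ_ind: f => [|f f' IH IH'|c p]; [exact: P0l|exact: PDl|].
by elim/kQ_ind: g => [|g g' IH IH'|d q]; [exact: P0r|exact: PDr|].
Qed.

(** A trivial path factors only as its own square. *)
Lemma path_coef_trivialM x f g :
  path_coef (trivial_path x) (f * g) =
  path_coef (trivial_path x) f * path_coef (trivial_path x) g.
Proof.
move: f g; apply: kQ_bilinear_ind => [g|f|f f' g IH IH'|f g g' IH IH'|c d p q].
- by rewrite mul0r path_coef0 mul0r.
- by rewrite mulr0 path_coef0 mulr0.
- by rewrite mulrDl !path_coefD IH IH' mulrDl.
- by rewrite mulrDr !path_coefD IH IH' mulrDr.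
rewrite kQ_scale_mull kQ_scale_mulr !path_coefZ path_coef_mul !path_coef_elt.
rewrite -mulrA; congr (_ * _); rewrite mulrCA; congr (_ * _); rewrite -natrM mulnb.
congr (_ %:R); congr nat_of_bool; rewrite path_comp_eq !qpath_eq /path_target.
rewrite path_source_trivial path_arrows_trivial.
case: (path_arrows p) => [|b s] /=; last by rewrite !andbF.
by apply/and3P/and3P => -[]; rewrite ?andbT => /eqP <- /eqP ->; split; rewrite ?eqxx.
Qed.

(** An arrow factors only with the trivial path at its source or at its target, which gives a
    Leibniz rule. *)
Lemma path_coef_arrowM a f g :
  path_coef (arrow_path a) (f * g) =
  path_coef (trivial_path (source a)) f * path_coef (arrow_path a) g +
  path_coef (arrow_path a) f * path_coef (trivial_path (target a)) g.
Proof.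
move: f g; apply: kQ_bilinear_ind => [g|f|f f' g IH IH'|f g g' IH IH'|c d p q].
- by rewrite mul0r !path_coef0 !mul0r addr0.
- by rewrite mulr0 !path_coef0 !mulr0 addr0.
- by rewrite mulrDl !path_coefD IH IH' !mulrDl addrACA.
- by rewrite mulrDr !path_coefD IH IH' !mulrDr addrACA.
rewrite kQ_scale_mull kQ_scale_mulr !path_coefZ path_coef_mul !path_coef_elt.
rewrite -!mulrA -mulrDr; congr (_ * _).
rewrite [X in X + _]mulrCA [X in _ + X]mulrCA -mulrDr; congr (_ * _).
rewrite -!natrM !mulnb path_comp_eq !qpath_eq /path_target.
rewrite !path_source_trivial !path_arrows_trivial path_source_arrow path_arrows_arrow.
case: (path_arrows p) => [|b [|b' s]] /=; rewrite ?andbF ?add0r ?addr0 ?mul0n //.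
- congr (nat_of_bool _)%:R; rewrite eqxx andbT.
  by apply/and3P/and3P => -[/eqP h1 /eqP h2 h3]; rewrite ?h1 ?h2 -?h1 -?h2 ?eqxx; split.
- rewrite !eqseq_cons eqxx andbT; congr (nat_of_bool _)%:R.
  apply/and3P/and3P => -[].
    by move=> /eqP <- /eqP -> /andP[/eqP -> h]; split; rewrite ?eqxx.
  by move=> /andP[/eqP -> /eqP ->] /eqP <- h; split; rewrite ?eqxx.
by rewrite !eqseq_cons !andbF.
Qed.

Local Open Scope classical_set_scope.

(** This ideal and [no_short] bound the arrow ideal and its square from above; a single coefficient
    can refute membership in them. *)
Definition no_trivial : set kQ := [set f | forall x, path_coef (trivial_path x) f = 0].

Definition no_short : set kQ :=
  [set f | no_trivial f /\ forall a, path_coef (arrow_path a) f = 0].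

Lemma no_trivial_ideal : two_sided_ideal no_trivial.
Proof.
split=> [x|f g Kf Kg x|f g Kg x|f g Kf x].
- by rewrite path_coef0.
- by rewrite path_coefD Kf Kg addr0.
- by rewrite path_coef_trivialM Kg mulr0.
by rewrite path_coef_trivialM Kf mul0r.
Qed.

Lemma no_short_ideal : two_sided_ideal no_short.
Proof.
have [K0 KD Kl Kr] := no_trivial_ideal.
split=> [|f g [Kf Lf] [Kg Lg]|f g [Kg Lg]|f g [Kg Lg]]; split.
- exact: K0.
- by move=> a; rewrite path_coef0.
- exact: KD.
- by move=> a; rewrite path_coefD Lf Lg addr0.
- exact: Kl.
- by move=> a; rewrite path_coef_arrowM Kg Lg !mulr0 addr0.
- exact: Kr.
by move=> a; rewrite path_coef_arrowM Kg Lg !mul0r addr0.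
Qed.

Lemma no_shortM f g : no_trivial f -> no_trivial g -> no_short (f * g).
Proof.
have [_ _ Kl _] := no_trivial_ideal.
move=> Kf Kg; split; first exact: Kl.
by move=> a; rewrite path_coef_arrowM Kf Kg mul0r mulr0 addr0.
Qed.

Local Notation arr := (@arrow_ideal k Q).

Lemma arrow_ideal_ideal : two_sided_ideal arr.
Proof. exact: ideal_gen_ideal. Qed.

Lemma arrow_ideal_arrow a : arr (elt (arrow_path a)).
Proof. by apply: sub_ideal_gen; exists a. Qed.

Lemma arrow_ideal_no_trivial : arr `<=` no_trivial.
Proof.
apply: ideal_gen_sub no_trivial_ideal _ => _ [a _ <-] x.
by rewrite path_coef_elt qpath_eq andbF.
Qed.

Lemma ideal_exp2_no_short : ideal_exp arr 2 `<=` no_short.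
Proof.
apply: ideal_gen_sub no_short_ideal _ => _ [f arf [g hg <-]].
apply: no_shortM; first exact: arrow_ideal_no_trivial.
apply: (ideal_gen_sub no_trivial_ideal _ hg) => _ [f' /arrow_ideal_no_trivial Kf' [g' _ <-]].
by have [_ _ _ Kr] := no_trivial_ideal; apply: Kr.
Qed.

Lemma kQ_scaleE (c : k) f : c *: f = (c *: (1 : kQ)) * f.
Proof. by rewrite kQ_scale_mull mul1r. Qed.

Lemma arrow_idealZ (c : k) f : arr f -> arr (c *: f).
Proof. by rewrite kQ_scaleE; have [_ _ + _] := arrow_ideal_ideal; apply. Qed.

Lemma path_first_arrow p : path_arrows p <> [::] -> exists a q,
  [/\ elt p = elt (arrow_path a) * elt q, source a = path_source p &
      path_arrows p = a :: path_arrows q].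
Proof.
case: p => -[x [|a s]] //= ws _; have /andP[/eqP ax was] := ws.
pose q : qpath Q := exist (fun z => is_true (walk z.1 z.2)) (target a, s) was.
exists a, q; split=> //; rewrite path_eltM /path_mul.
have [//|r -> rE] := @path_compE _ (arrow_path a) q.
by congr elt; apply: val_inj; rewrite rE /= -ax.
Qed.

Lemma arrow_ideal_path p : path_arrows p <> [::] -> arr (elt p).
Proof.
move=> /path_first_arrow[a [q [-> _ _]]]; have [_ _ _ Kr] := arrow_ideal_ideal.
by apply: Kr; apply: arrow_ideal_arrow.
Qed.

Lemma trivial_pathP p : path_arrows p = [::] -> p = trivial_path (path_source p).
Proof. by move=> p0; apply/eqP; rewrite qpath_eq p0 !eqxx. Qed.

Local Notation E x := (elt (trivial_path x)).

Lemma vertex_elt_mull x p : E x * elt p = if x == path_source p then elt p else 0.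
Proof. by rewrite path_eltM /path_mul path_comp1l; case: eqP. Qed.

Lemma vertex_elt_mulr x p : elt p * E x = if x == path_target p then elt p else 0.
Proof. by rewrite path_eltM /path_mul path_comp1r; case: eqP. Qed.

Lemma corner_arrow_ideal i j f : exists c : k,
  arr (E i * f * E j - (if i == j then c else 0) *: E i).
Proof.
have [K0 KD Kl Kr] := arrow_ideal_ideal.
elim/kQ_ind: f => [|f g [c Hf] [d Hg]|c p].
- by exists 0; rewrite mulr0 mul0r if_same scale0r subr0.
- exists (c + d); move: (KD _ _ Hf Hg); rewrite mulrDr mulrDl addrACA -opprD -scalerDl.
  by case: eqP; rewrite ?addr0.
have [p0|/eqP p0] := eqVneq (path_arrows p) [::]; last first.
  exists 0; rewrite if_same scale0r subr0; apply: Kr; apply: Kl; apply: arrow_idealZ.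
  exact: arrow_ideal_path.
rewrite (trivial_pathP p0) kQ_scale_mulr kQ_scale_mull vertex_elt_mull path_source_trivial.
have [ix|ix] := eqVneq i (path_source p); last first.
  by exists 0; rewrite mul0r scaler0 if_same scale0r subr0.
rewrite -ix vertex_elt_mulr /path_target /= eq_sym.
exists c; case: eqP => [_|_]; first by rewrite subrr.
by rewrite scaler0 scale0r subr0.
Qed.

End PathAlgebraIdeals.

(** * The frame of a bound quiver algebra *)

Section BoundQuiverFrame.
Variables (k : fieldType) (Q : quiver) (I : set (path_algebra k Q)) (hI : admissible I).
Local Notation kQ := (path_algebra k Q).
Local Notation elt := (path_elt k).
Local Notation A := (bound_quiver_algebra hI).
Local Notation arr := (@arrow_ideal k Q).
Local Notation E x := (elt (trivial_path x)).
Implicit Types (f g : kQ) (p q : qpath Q) (x y i j l : vertex Q) (a : arrow Q).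

Definition bound_proj (f : kQ) : A := quotient_proj (proj1 hI) f.
Local Notation pi := bound_proj.

Lemma bound_projM f g : pi (f * g) = pi f * pi g.
Proof. exact: rmorphM. Qed.

Lemma bound_projD f g : pi (f + g) = pi f + pi g.
Proof. exact: raddfD. Qed.

Lemma bound_projB f g : pi (f - g) = pi f - pi g.
Proof. exact: raddfB. Qed.

Lemma bound_proj0 : pi 0 = 0.
Proof. exact: raddf0. Qed.

Lemma bound_proj1 : pi 1 = 1.
Proof. exact: rmorph1. Qed.

Lemma bound_proj_sum (T : Type) (r : seq T) (P : pred T) (F : T -> kQ) :
  pi (\sum_(t <- r | P t) F t) = \sum_(t <- r | P t) pi (F t).
Proof. exact: raddf_sum. Qed.

Lemma bound_proj_surj (y : A) : exists f, pi f = y.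
Proof. by exists (repr y); apply: quotient_reprK. Qed.

Lemma bound_proj_eq f g : pi f = pi g <-> I (f - g).
Proof. exact: quotient_projP. Qed.

Definition bound_radical : set A := [set y | exists2 f, arr f & pi f = y]%classic.
Local Notation J := bound_radical.

(** The scalars are the images of [c *: 1]; nilpotency comes from the power of the arrow ideal
    contained in [I]. *)
Lemma bound_frame : frame (vertex_idem hI) J.
Proof.
have [K0 KD Kl Kr] := arrow_ideal_ideal k Q.
have Jcorner i j f (c : k) :
    arr (E i * f * E j - (if i == j then c else 0) *: E i) ->
    J (vertex_idem hI i * pi f * vertex_idem hI j -
       (if i == j then pi (c *: (1 : kQ)) * vertex_idem hI i else 0)).
  move=> hc; eexists; first exact: hc.
  rewrite bound_projB !bound_projM; congr (_ - _).
  case: eqP => _; last by rewrite scale0r bound_proj0.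
  by rewrite kQ_scaleE bound_projM.
split.
- exact: vertex_idemM.
- by rewrite -bound_proj1 -[1 in RHS]/(kQ_one k Q) bound_proj_sum.
- split=> [|x y [f hf <-] [g hg <-]|x y [f hf <-]|x y [f hf <-]].
  + by exists 0; [exact: K0|exact: bound_proj0].
  + by exists (f + g); [exact: KD|exact: bound_projD].
  + have [g <-] := bound_proj_surj x.
    by exists (g * f); [exact: Kl|exact: bound_projM].
  have [g <-] := bound_proj_surj x.
  by exists (f * g); [exact: Kr|exact: bound_projM].
- have [[I0 _ _ _] [m [_ mI _]]] := hI; exists m => s sm sJ.
  have [f fm fE] : exists2 f, ideal_exp arr (size s) f & pi f = \prod_(y <- s) y.
    elim: s sJ {sm} => [|y s IHs] sJ; first by exists 1; rewrite ?big_nil ?bound_proj1.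
    have [g hg gE] := sJ y (mem_head y s).
    have [|f hf fE] := IHs; first by move=> z zs; apply: sJ; rewrite inE zs orbT.
    exists (g * f); last by rewrite big_cons bound_projM gE fE.
    by apply: sub_ideal_gen; exists g => //; exists f.
  rewrite -fE -bound_proj0; apply/bound_proj_eq; rewrite subr0; apply: mI.
  by rewrite -sm.
- move=> i j y ij; have [f <-] := bound_proj_surj y.
  have [c /Jcorner] := corner_arrow_ideal i j f.
  by rewrite (negPf ij) subr0.
move=> i y; have [f <-] := bound_proj_surj y.
have [c /Jcorner] := corner_arrow_ideal i i f; rewrite eqxx => Jc.
exists (pi (c *: (1 : kQ))); split=> //.
  move=> x; have [g <-] := bound_proj_surj x.
  by rewrite -!bound_projM kQ_scale_mull kQ_scale_mulr mul1r mulr1.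
have [->|c0] := eqVneq c 0; [by left; rewrite scale0r bound_proj0|right].
exists (pi (c^-1 *: (1 : kQ))).
by rewrite -bound_projM kQ_scale_mull mul1r scalerA mulVf // scale1r bound_proj1.
Qed.

Lemma ideal_pow2_no_short (y : A) : ideal_pow J 2 y -> exists2 f, no_short f & pi f = y.
Proof.
have [L0 LD _ _] := no_short_ideal k Q.
elim=> [|x z _ [f Lf <-] _ [g Lg <-]|[//|x [//|z [|//]]] _ sJ].
- by exists 0; [exact: L0|exact: bound_proj0].
- by exists (f + g); [exact: LD|exact: bound_projD].
have [|f hf fE] := sJ x; first by rewrite mem_head.
have [|g hg gE] := sJ z; first by rewrite !inE eqxx orbT.
exists (f * g); first by apply: no_shortM; apply: arrow_ideal_no_trivial.
by rewrite !big_cons big_nil mulr1 -fE -gE bound_projM.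
Qed.

Lemma bound_frame_arrow i j : frame_arrow (vertex_idem hI) J i j <->
  exists a, source a = i /\ target a = j.
Proof.
have [K0 KD Kl Kr] := arrow_ideal_ideal k Q.
split=> [[z [[[f hf <-] iz zj] nJz]]|[a [<- <-]]]; last first.
  exists (pi (elt (arrow_path a))); split.
    split; first by exists (elt (arrow_path a)) => //; apply: arrow_ideal_arrow.
      rewrite -bound_projM -[RHS]/(pi _); congr pi.
      by rewrite vertex_elt_mull eqxx.
    rewrite -bound_projM -[RHS]/(pi _); congr pi.
    by rewrite vertex_elt_mulr eqxx.
  move=> /ideal_pow2_no_short[f [Kf Lf] /bound_proj_eq If].
  (* [I] lies in the square of the arrow ideal, so its elements have coefficient 0 at every
     arrow. *)
  have [_ [m [_ _ I2]]] := hI.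
  have [_ /(_ a)] := ideal_exp2_no_short (I2 _ If).
  by rewrite raddfB /= Lf path_coef_elt eqxx sub0r => /eqP; rewrite oppr_eq0 oner_eq0.
apply: contrapT => na; apply: nJz.
have -> : pi f = pi (E i * f * E j).
  by rewrite !bound_projM -[X in X = _]zj -[X in X * _ = _]iz.
(* Without an arrow from [i] to [j], each path of the support that joins them has length at least
   two and splits into two factors in [J]. *)
rewrite [X in E i * X]path_eltE mulr_sumr mulr_suml bound_proj_sum.
rewrite big_seq; apply: big_ind => [|x y|p]; [exact: ideal_pow0|exact: ideal_powD|].
rewrite path_suppP => pf; rewrite kQ_scale_mulr kQ_scale_mull vertex_elt_mull.
have [ip|_] := eqVneq i (path_source p); last first.
  by rewrite mul0r scaler0 bound_proj0; apply: ideal_pow0.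
rewrite vertex_elt_mulr; have [jp|_] := eqVneq j (path_target p); last first.
  by rewrite scaler0 bound_proj0; apply: ideal_pow0.
have p0 : path_arrows p <> [::].
  move=> /trivial_pathP pE; move: pf; rewrite pE.
  by rewrite (arrow_ideal_no_trivial hf) eqxx.
have [a [q [-> ap pE]]] := path_first_arrow k p0.
have q0 : path_arrows q <> [::].
  move=> q0; apply: na; exists a; split; first by rewrite ap ip.
  by rewrite jp /path_target pE q0.
rewrite -kQ_scale_mull bound_projM; apply: J2M.
  by eexists; last by []; apply: arrow_idealZ; apply: arrow_ideal_arrow.
by eexists; last by []; apply: arrow_ideal_path.
Qed.

Lemma neighboursP l j : j \in neighbours l <->
  j <> l /\ (frame_arrow (vertex_idem hI) J l j \/ frame_arrow (vertex_idem hI) J j l).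
Proof.
rewrite inE; split=> [/andP[/eqP jl /existsP[a /orP[]/andP[/eqP ha /eqP hb]]]|].
- by split=> //; left; apply/bound_frame_arrow; exists a.
- by split=> //; right; apply/bound_frame_arrow; exists a.
move=> [/eqP -> ar] /=; apply/existsP.
by case: ar => /bound_frame_arrow[a [sa ta]]; exists a; rewrite sa ta !eqxx ?orbT.
Qed.

Lemma local_idemE l (S : {set vertex Q}) : S \subset neighbours l ->
  local_idem l hI S = \sum_(i in (l |: S)%SET) vertex_idem hI i.
Proof.
move=> SN; rewrite big_setU1 //; apply/negP => /(fintype.subsetP SN).
by rewrite inE eqxx.
Qed.

(** The vertex idempotents of the star already decompose [local_idem] into local ones. *)
Lemma biserial_local_corner l (S : {set vertex Q}) (SN : S \subset neighbours l) :
  biserial A -> biserial (corner_ring (local_idem l hI S) (local_idemP hI SN)).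
Proof.
have F := bound_frame; have epsE := local_idemE SN.
apply: (@biserial_corner_decomposition _ _ _ _
  [seq vertex_idem hI i | i <- enum (l |: S)%SET]).
- exact: (corner_embedding_val (local_idemP hI SN)).
- move=> _ /mapP[i iS ->]; rewrite mem_enum in iS; split.
  + exact: frame_local F i.
  + exact: frame_local (frame_op F) i.
  + by rewrite (corner_idem_l F epsE) iS.
  by rewrite (corner_idem_r F epsE) iS.
by rewrite big_map big_enum epsE.
Qed.

Lemma bisected_neighbours l :
  biserial (corner_ring (local_idem l hI (neighbours l))
                        (local_idemP hI (subxx (neighbours l)))) ->
  bisected (vertex_idem hI) J l.
Proof.
move=> bB; have F := bound_frame.
apply: (corner_bisected F (corner_embedding_val (local_idemP hI (subxx (neighbours l))))
  (local_idemE (subxx _)) bB); first exact: finset.setU11.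
move=> t; rewrite finset.in_setU1 negb_or => /andP[/eqP tl /negP tN].
by split=> ar; apply: tN; apply/neighboursP; split=> //; [left|right].
Qed.

End BoundQuiverFrame.

Theorem theorem3p2 (k : closedFieldType) :
  (forall (A : pzRingType) (iota : {rmorphism k -> A}),
     fd_algebra iota -> biserial A ->
     forall (e : A) (he : e * e = e), biserial (corner_ring e he))
  /\
  (forall (Q : quiver) (I : set (path_algebra k Q)) (hI : admissible I),
     biserial (bound_quiver_algebra hI) <->
     forall l : vertex Q,
       biserial (corner_ring (local_idem l hI (neighbours l))
                             (local_idemP hI (subxx (neighbours l)))))
  /\
  (forall (Q : quiver) (I : set (path_algebra k Q)) (hI : admissible I),
     biserial (bound_quiver_algebra hI) <->
     forall (l : vertex Q) (J : {set vertex Q}) (hJ : D4_neighbours l J),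
       biserial (corner_ring (local_idem l hI J)
                             (local_idemP hI (D4_neighbours_sub hJ)))).
Proof.
split=> [A iota fdA bA e he|].
  have [s [sP sE]] := local_decomposition fdA he.
  exact: biserial_corner_decomposition (corner_embedding_val he) sP sE bA.
split=> Q I hI; split=> [bA l|bl]; [exact: biserial_local_corner| |
    by move=> J hJ; apply: biserial_local_corner|].
  by apply: (bisected_biserial (bound_frame hI)) => l; apply: bisected_neighbours.
apply: (bisected_biserial (bound_frame hI)) => l.
have [N4|N4] := ltnP #|neighbours l| 4.
  have hJ : D4_neighbours l (neighbours l) by rewrite /D4_neighbours N4.
  apply: bisected_neighbours; move: (bl l _ hJ).
  (* The two corner rings differ only in the proof of the inclusion from which idempotency is
     derived. *)
  by rewrite (Prop_irrelevance (D4_neighbours_sub hJ) (subxx (neighbours l))).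
apply: (D4_bisected (bound_frame hI) (neighboursP hI l) N4) => S SN S3.
have hJ : D4_neighbours l S by rewrite /D4_neighbours ltnNge N4.
exact: (star_data_corner (bound_frame hI)
  (corner_embedding_val (local_idemP hI (D4_neighbours_sub hJ)))
  (local_idemE hI (D4_neighbours_sub hJ)) (bl l S hJ)).
Qed.
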